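(* Let $f(z)=\sum_{m=0}^\infty a_m z^m$ be a power series with complex coefficients and $\limsup_{m\to\infty}|a_m|^{1/m}=1$. Let $\{m_k\}$ be a strictly increasing sequence of positive integers and $\{\beta_k\}$ a sequence of real numbers such that $$\lim_{k\to\infty}\left|\mathrm{Re}\,(e^{-i\beta_k}a_{m_k})\right|^{1/m_k}=1 .$$ Let $\mathfrak{Fr}(\Lambda_+)$ and $\mathfrak{Fr}(\Lambda_-)$ be the associated sets of limit functions on $[0,1]$ (defined in the context), and let $\Delta\in[0,1]$. If some limit function $n\in\mathfrak{Fr}(\Lambda_+)\cup\mathfrak{Fr}(\Lambda_-)$ satisfies $$\liminf_{r\to0+}\frac{n(r)}{r}\le\Delta,$$ then $f$ has a singularity on the arc $I_\Delta=\{e^{i\theta}:|\theta|\le\pi\Delta\}$.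
   Context: Singularity on an arc: $f$ has a singularity on a closed arc $I$ of the unit circle if $f$ has no immediate analytic continuation from the unit disc to $I$, i.e. there is no function analytic in the union of the open unit disc and some open neighborhood of $I$ that coincides with $f$ in the unit disc. Sign changes: for a sequence of real numbers $\{c_m\}$, a sign change occurs at the place $m$ if $c_mc_k<0$ for some $k<m$ while $c_j=0$ for all $k<j<m$. Sets and counting functions: $\Lambda_{k,+}\subset[m_k,2m_k]$ and $\Lambda_{k,-}\subset[0,m_k]$ are the sets of integers $j$ in these segments at which sign changes of the sequence $\{\mathrm{Re}\,(e^{-i\beta_k}a_j)\}_{j\ge0}$ occur; $\Lambda_\pm=\{\Lambda_{k,\pm}\}_k$. For $r\in[0,1]$, $$n_{k,+}(r)=\frac1{m_k}\,\mathrm{card}\big(\Lambda_{k,+}\cap[m_k,(1+r)m_k]\big),\qquad n_{k,-}(r)=\frac1{m_k}\,\mathrm{card}\big(\Lambda_{k,-}\cap[(1-r)m_k,m_k]\big).$$ Limit functions: $\mathfrak{Fr}(\Lambda_+)$ (respectively $\mathfrak{Fr}(\Lambda_-)$) is the set of all functions $n$ on $[0,1]$ that are pointwise limits of subsequences of $\{n_{k,+}\}_k$ (respectively of $\{n_{k,-}\}_k$). Such $n$ are increasing (non-strictly), $n(0)=0$, and $|n(x)-n(y)|\le|x-y|$ for all $x,y\in[0,1]$. *)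

(* Defs.v *)
From Stdlib Require Import Reals List ClassicalEpsilon.
From Coquelicot Require Import Coquelicot.

Open Scope R_scope.

Definition expi (t : R) : C := (cos t, sin t).

(* [Rpower 0 y = 1] because [ln 0 = 0], so the root of 0 is treated apart.
   The value at [n = 0] plays no role in limits. *)
Definition nth_root (n : nat) (x : R) : R :=
  if Req_EM_T x 0 then 0 else Rpower x (/ INR n).

Definition analytic_at (g : C -> C) (z0 : C) : Prop :=
  exists (b : nat -> C) (r : posreal),
    forall z : C, Cmod (z - z0) < r ->
      @is_pseries C_AbsRing C_NormedModule b (z - z0)%C (g z).

Definition unit_disc (z : C) : Prop := Cmod z < 1.

(* [f] and [g] are total functions; only the values of [f] on the unit disc
   and those of [g] on the union of the disc and [U] matter. *)
Definition has_singularity_on (f : C -> C) (I : C -> Prop) : Prop :=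
  ~ exists (U : C -> Prop) (g : C -> C),
      @open C_UniformSpace U
      /\ (forall z, I z -> U z)
      /\ (forall z, unit_disc z \/ U z -> analytic_at g z)
      /\ (forall z, unit_disc z -> g z = f z).

Definition arc (Delta : R) (z : C) : Prop :=
  exists theta : R, Rabs theta <= PI * Delta /\ z = expi theta.

Definition sign_change (c : nat -> R) (m : nat) : Prop :=
  exists k : nat, (k < m)%nat /\ c m * c k < 0
    /\ forall j : nat, (k < j < m)%nat -> c j = 0.

Definition rotated_re (a : nat -> C) (beta : R) (j : nat) : R :=
  Re (expi (- beta) * a j)%C.

Definition Lambda_plus (a : nat -> C) (m : nat) (beta : R) (j : nat) : Prop :=
  (m <= j <= 2 * m)%nat /\ sign_change (rotated_re a beta) j.

Definition Lambda_minus (a : nat -> C) (m : nat) (beta : R) (j : nat) : Prop :=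
  (0 <= j <= m)%nat /\ sign_change (rotated_re a beta) j.

(* Number of [j <= N] in [E]: the cardinality of [E] when [N] bounds [E]. *)
Definition card_upto (N : nat) (E : nat -> Prop) : nat :=
  length (filter (fun j => if excluded_middle_informative (E j)
                           then true else false) (seq 0 (S N))).

Definition n_plus (a : nat -> C) (m : nat) (beta : R) (r : R) : R :=
  INR (card_upto (2 * m) (fun j => Lambda_plus a m beta j
                       /\ INR m <= INR j <= (1 + r) * INR m)) / INR m.

Definition n_minus (a : nat -> C) (m : nat) (beta : R) (r : R) : R :=
  INR (card_upto m (fun j => Lambda_minus a m beta j
                       /\ (1 - r) * INR m <= INR j <= INR m)) / INR m.

(* Functions on [0,1] are represented by total functions, whose values
   outside [0,1] are irrelevant. *)
Definition subsequential_limit (u : nat -> R -> R) (n : R -> R) : Prop :=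
  exists phi : nat -> nat,
    (forall i, (phi i < phi (S i))%nat)
    /\ forall r, 0 <= r <= 1 -> is_lim_seq (fun i => u (phi i) r) (n r).

Definition Fr_plus (a : nat -> C) (m : nat -> nat) (beta : nat -> R)
    : (R -> R) -> Prop :=
  subsequential_limit (fun k => n_plus a (m k) (beta k)).

Definition Fr_minus (a : nat -> C) (m : nat -> nat) (beta : nat -> R)
    : (R -> R) -> Prop :=
  subsequential_limit (fun k => n_minus a (m k) (beta k)).

(* The supremum over [d > 0] of the infimum over [x < r < x + d]. *)
Definition LimInf_right (h : R -> R) (x : R) : Rbar :=
  Rbar_lub (fun y => exists d : posreal,
    y = Glb_Rbar (fun v => exists r, x < r < x + d /\ v = h r)).

(* Main.v *)
Require Import Defs.
From Stdlib Require Import ZArith Reals List FinFun ClassicalEpsilon FunctionalExtensionality Lra Lia Psatz.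
From Coquelicot Require Import Coquelicot.

Open Scope R_scope.

(** Suppose that [f] continues across the arc. Then the Taylor coefficients of
    [f] at a point [z] of argument in a slightly larger arc, [|z| = r] close to
    [1], are exponentially smaller than [(1 - r)^(-k)]. They are sums of the
    [a_j] against binomial weights that peak at [j = m], so the weighted [a_j]
    have a Fourier transform that is exponentially small on the arc. Hence, up
    to exponentially small errors, the numbers [(-1)^j] times the real parts
    of the rotated weighted [a_(m+j)] (or [a_(m-j)]) are the values at the
    integers [j] near [0] of an exponential sum with frequencies in
    [[-PI b, PI b]], where [b < 1 - Delta].
    Correcting it, one gets a real polynomial, bounded by
    [exp (PI b |Im z| + o(m))] and not exponentially small at [0], with a zero
    in [(j, j+1)] unless a sign change occurs there.

    Since [liminf n(r)/r < 1 - b], at arbitrarily small scales there are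
    intervals on which these zeros are evenly spread with density larger than
    [b]. By Jensen's formula the polynomial is then exponentially small on a disc
    around such an interval. The harmonic function [y / |z - tau|^2] on the upper
    half plane turns this into a smaller value of [b] nearer to [0]. The gain
    does not depend on the scale; after finitely many steps [b] is negative,
    which contradicts the value at [0]. *)

(** * Maximum principle *)

(** Signs are known only at the integers, and a coefficient may vanish there, so even an
    exponentially small error could destroy the zeros. The exponential sum is therefore corrected by
    Lagrange interpolation to take prescribed values exactly. This costs a factor [12 ^ J] against a
    gain [4 ^ (-k)] with [k >= c0 * m], so [J] is about [T * m] with a small [T], and after
    rescaling by [m] everything is known on one small disc only. The argument has to be local at 0,
    and it is: the liminf looks only there, and a bound on a smaller disc can be fed back into the
    same step. Exponentials, Blaschke factors and means over circles are all replaced by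
    polynomials. Jensen's inequality and the barrier then rest on one maximum principle, which needs
    from a polynomial only division by [z - z0] and boundedness on bounded sets. Polynomials are
    accordingly an inductive closure, without degrees or coefficients. *)

Inductive is_poly : (C -> C) -> Prop :=
| poly_const c : is_poly (fun _ => c)
| poly_id : is_poly (fun z => z)
| poly_add P Q : is_poly P -> is_poly Q -> is_poly (fun z => P z + Q z)%C
| poly_mul P Q : is_poly P -> is_poly Q -> is_poly (fun z => P z * Q z)%C
| poly_ext P Q : (forall z, P z = Q z) -> is_poly P -> is_poly Q.

(** Iterated, this is the Taylor expansion at [z0]. It yields continuity, the third-order expansion
    in [four_product] and the removal of zeros in [divide_zeros]. *)
Lemma poly_div (P : C -> C) (z0 : C) : is_poly P ->
  exists Q, is_poly Q /\ forall z, P z = (P z0 + (z - z0) * Q z)%C.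
Proof.
induction 1 as [c| |P Q _ [P1 [hP1 eP]] _ [Q1 [hQ1 eQ]]
               |P Q hP [P1 [hP1 eP]] hQ [Q1 [hQ1 eQ]]|P Q e _ [P1 [hP1 eP]]].
- exists (fun _ => RtoC 0); split; [constructor|intros z; ring].
- exists (fun _ => RtoC 1); split; [constructor|intros z; ring].
- exists (fun z => P1 z + Q1 z)%C; split; [now constructor|].
  intros z; rewrite (eP z), (eQ z); ring.
- exists (fun z => P1 z * Q z + P z0 * Q1 z)%C; split.
  + apply poly_add; apply poly_mul; trivial; constructor.
  + intros z. transitivity ((P z0 + (z - z0) * P1 z) * Q z)%C; [now rewrite <- eP|].
    transitivity (P z0 * Q z + (z - z0) * (P1 z * Q z))%C; [ring|].
    rewrite (eQ z) at 1; ring.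
- exists P1; split; trivial. intros z; now rewrite <- !e.
Qed.

Lemma poly_bounded (P : C -> C) (B : R) : is_poly P ->
  exists M, 0 <= M /\ forall z, Cmod z <= B -> Cmod (P z) <= M.
Proof.
induction 1 as [c| |P Q _ [M [hM bM]] _ [N [hN bN]]
               |P Q _ [M [hM bM]] _ [N [hN bN]]|P Q e _ [M [hM bM]]].
- exists (Cmod c); split; [apply Cmod_ge_0|intros; lra].
- exists (Rmax 0 B); split; [apply Rmax_l|intros z h; apply Rle_trans with (1 := h), Rmax_r].
- exists (M + N); split; [lra|]. intros z h.
  apply Rle_trans with (1 := Cmod_triangle _ _), Rplus_le_compat; auto.
- exists (M * N); split; [nra|]. intros z h. rewrite Cmod_mult.
  apply Rmult_le_compat; auto using Cmod_ge_0.
- exists M; split; trivial. intros z h; rewrite <- e; auto.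
Qed.

Lemma poly_continuous (P : C -> C) (z : C) : is_poly P ->
  forall e, 0 < e -> exists d, 0 < d /\
    forall w, Cmod (w - z) < d -> Cmod (P w - P z) < e.
Proof.
intros hP e he.
destruct (poly_div P z hP) as [Q [hQ eQ]].
destruct (poly_bounded Q (Cmod z + 1) hQ) as [M [hM bM]].
exists (Rmin 1 (e / (M + 1))); split.
- apply Rmin_glb_lt; [lra|apply Rdiv_lt_0_compat; lra].
- intros w hw.
  assert (h1 : Cmod (w - z) < 1) by apply Rlt_le_trans with (1 := hw), Rmin_l.
  assert (h2 : Cmod (w - z) < e / (M + 1)) by apply Rlt_le_trans with (1 := hw), Rmin_r.
  assert (h3 : Cmod w <= Cmod z + 1).
  { replace w with (z + (w - z))%C by ring.
    apply Rle_trans with (1 := Cmod_triangle _ _); lra. }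
  rewrite (eQ w). replace (P z + (w - z) * Q w - P z)%C with ((w - z) * Q w)%C by ring.
  rewrite Cmod_mult.
  apply Rle_lt_trans with (Cmod (w - z) * (M + 1)).
  + apply Rmult_le_compat_l; [apply Cmod_ge_0|]. specialize (bM w h3); lra.
  + apply Rmult_lt_reg_r with (/ (M + 1)); [apply Rinv_0_lt_compat; lra|].
    rewrite Rmult_assoc, Rinv_r by lra. unfold Rdiv in h2; lra.
Qed.

Lemma Cmod_triangle_inv (x y : C) : Cmod x - Cmod y <= Cmod (x - y).
Proof.
assert (h := Cmod_triangle (x - y) y). replace (x - y + y)%C with x in h by ring. lra.
Qed.

Lemma Cmod_le_Re_Im (z : C) : Cmod z <= Rabs (Re z) + Rabs (Im z).
Proof.
assert (h := Cmod2_alt z).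
assert (h1 := Rabs_pos (Re z)). assert (h2 := Rabs_pos (Im z)).
apply Rsqr_incr_0_var; [|lra]. unfold Rsqr.
replace (Cmod z * Cmod z) with (Cmod z ^ 2) by ring.
rewrite h, <- (pow2_abs (Re z)), <- (pow2_abs (Im z)). nra.
Qed.

Lemma im_le_Cmod (z : C) : Rabs (Im z) <= Cmod z.
Proof. apply Rle_trans with (2 := Rmax_Cmod z), Rmax_r. Qed.

Definition closed_in_plane (K : C -> Prop) : Prop :=
  forall z, ~ K z -> exists d, 0 < d /\ forall w, Cmod (w - z) < d -> ~ K w.

(** Compactness of [K] in the form of a Lebesgue number. The square [[-B, B]^2] is covered: points
    off [K] get a disc that misses [K], so nothing has to be proved there. *)
Lemma compact_uniform (K : C -> Prop) (B : R) (Pr : R -> C -> Prop) :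
  (forall z, K z -> Cmod z <= B) -> closed_in_plane K ->
  (forall d d' w, 0 < d' <= d -> Pr d w -> Pr d' w) ->
  (forall z, K z -> exists d, 0 < d /\
     forall w, K w -> Cmod (w - z) < d -> Pr d w) ->
  exists d, 0 < d /\ forall w, K w -> Pr d w.
Proof.
intros hB hK mono loc.
(* [compactness_value_2d] controls each coordinate by [delta], hence the modulus only by
   [2 * delta]. *)
assert (H : forall u v : R, exists d : posreal,
          forall w, K w -> Cmod (w - (u, v)%R) < 2 * d -> Pr d w).
{ intros u v. destruct (classic (K (u, v))) as [k|k].
  - destruct (loc _ k) as [d [hd h]].
    assert (hd2 : 0 < d / 2) by lra.
    exists (mkposreal _ hd2). simpl. intros w kw hw.
    apply mono with d; [lra|]. apply h; trivial; lra.
  - destruct (hK _ k) as [d [hd h]].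
    assert (hd2 : 0 < d / 2) by lra.
    exists (mkposreal _ hd2). simpl. intros w kw hw.
    exfalso; apply (h w); trivial; lra. }
set (delta := fun u v : R => proj1_sig (constructive_indefinite_description _ (H u v))).
assert (hdelta : forall u v w, K w -> Cmod (w - (u, v)) < 2 * delta u v -> Pr (delta u v) w).
{ intros u v. unfold delta.
  destruct (constructive_indefinite_description _ (H u v)) as [x hx]. simpl. trivial. }
destruct (compactness_value_2d (- B) B (- B) B delta) as [d hd].
exists d; split; [apply cond_pos|].
intros w kw.
assert (h1 := hB w kw).
assert (h2 := re_le_Cmod w). assert (h3 := im_le_Cmod w).
apply Rabs_le_between in h2. apply Rabs_le_between in h3.
apply NNPP. intros nP.
apply (hd (Re w) (Im w)); [lra|lra|].
intros [u [v [_ [_ [hu [hv hle]]]]]].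
apply nP, mono with (delta u v); [split; [apply cond_pos|trivial]|].
apply hdelta; trivial.
apply Rle_lt_trans with (1 := Cmod_le_Re_Im _).
replace (Re (w - (u, v))) with (Re w - u) by reflexivity.
replace (Im (w - (u, v))) with (Im w - v) by reflexivity. lra.
Qed.

(** The gauge of [compact_uniform] carries a bound on [Psi], twice: first [Psi <= / d], which gives
    a finite supremum [S]; then, if [S] is not attained, [Psi <= S - d], which contradicts the
    choice of [S]. *)
Lemma usc_attains_max (K : C -> Prop) (B : R) (Psi : C -> R) (z1 : C) :
  (forall z, K z -> Cmod z <= B) -> closed_in_plane K ->
  (forall z, K z -> forall e, 0 < e -> exists d, 0 < d /\
     forall w, K w -> Cmod (w - z) < d -> Psi w < Psi z + e) ->
  K z1 -> exists z, K z /\ forall w, K w -> Psi w <= Psi z.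
Proof.
intros hB hK usc hz1.
destruct (compact_uniform K B (fun d w => Psi w <= / d) hB hK) as [d [hd hb]].
{ intros d d' w hle h. apply Rle_trans with (1 := h), Rinv_le_contravar; lra. }
{ intros z kz. destruct (usc z kz 1 Rlt_0_1) as [d [hd h]].
  assert (hM : 0 < Rabs (Psi z) + 1) by (assert (h' := Rabs_pos (Psi z)); lra).
  exists (Rmin d (/ (Rabs (Psi z) + 1))).
  assert (hp : 0 < / (Rabs (Psi z) + 1)) by now apply Rinv_0_lt_compat.
  split; [now apply Rmin_glb_lt|]. intros w kw hw.
  apply Rle_trans with (Rabs (Psi z) + 1).
  - assert (h1 : Cmod (w - z) < d) by apply Rlt_le_trans with (1 := hw), Rmin_l.
    specialize (h w kw h1). assert (h2 := Rle_abs (Psi z)); lra.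
  - rewrite <- (Rinv_inv (Rabs (Psi z) + 1)) at 1.
    apply Rinv_le_contravar; [now apply Rmin_glb_lt|apply Rmin_r]. }
destruct (completeness (fun x => exists z, K z /\ x = Psi z)) as [S [hS1 hS2]].
{ exists (/ d). intros x [z [kz ->]]. now apply hb. }
{ exists (Psi z1), z1; now split. }
apply NNPP; intros nmax.
assert (hlt : forall z, K z -> Psi z < S).
{ intros z kz. destruct (Rle_lt_or_eq_dec (Psi z) S) as [h|h]; trivial.
  - apply hS1; now exists z.
  - exfalso; apply nmax; exists z; split; trivial.
    intros w kw. rewrite h. apply hS1; now exists w. }
destruct (compact_uniform K B (fun d w => Psi w <= S - d) hB hK) as [d' [hd' hb']].
{ intros; lra. }
{ intros z kz. assert (hz := hlt z kz).
  assert (hp : 0 < (S - Psi z) / 2) by lra.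
  destruct (usc z kz _ hp) as [e [he h]].
  exists (Rmin e ((S - Psi z) / 2)). split; [now apply Rmin_glb_lt|].
  intros w kw hw.
  assert (h1 : Cmod (w - z) < e) by apply Rlt_le_trans with (1 := hw), Rmin_l.
  specialize (h w kw h1). assert (h2 := Rmin_r e ((S - Psi z) / 2)). lra. }
assert (S <= S - d') by (apply hS2; intros x [z [kz ->]]; auto). lra.
Qed.

Definition O3 (f g : R -> C) : Prop :=
  exists A, 0 <= A /\ forall rho, 0 <= rho <= 1 -> Cmod (f rho - g rho) <= A * rho ^ 3.

Definition bounded01 (f : R -> C) : Prop :=
  exists A, 0 <= A /\ forall rho, 0 <= rho <= 1 -> Cmod (f rho) <= A.

Lemma O3_mul f f' g g' : O3 f f' -> O3 g g' -> bounded01 f -> bounded01 g' ->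
  O3 (fun rho => f rho * g rho)%C (fun rho => f' rho * g' rho)%C.
Proof.
intros [A [hA a]] [B [hB b]] [F [hF ff]] [G [hG gg]].
exists (F * B + A * G); split; [nra|]. intros rho hr.
specialize (a rho hr); specialize (b rho hr); specialize (ff rho hr); specialize (gg rho hr).
replace (f rho * g rho - f' rho * g' rho)%C
  with (f rho * (g rho - g' rho) + (f rho - f' rho) * g' rho)%C by ring.
apply Rle_trans with (1 := Cmod_triangle _ _). rewrite !Cmod_mult.
replace ((F * B + A * G) * rho ^ 3) with (F * (B * rho ^ 3) + (A * rho ^ 3) * G) by ring.
apply Rplus_le_compat; apply Rmult_le_compat; auto using Cmod_ge_0.
Qed.

Lemma bounded01_mul f g : bounded01 f -> bounded01 g ->
  bounded01 (fun rho => f rho * g rho)%C.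
Proof.
intros [F [hF ff]] [G [hG gg]]. exists (F * G); split; [nra|].
intros rho hr; rewrite Cmod_mult. apply Rmult_le_compat; auto using Cmod_ge_0.
Qed.

Lemma O3_trans f g h : O3 f g -> O3 g h -> O3 f h.
Proof.
intros [A [hA a]] [B [hB b]]. exists (A + B); split; [lra|]. intros rho hr.
specialize (a rho hr); specialize (b rho hr).
replace (f rho - h rho)%C with ((f rho - g rho) + (g rho - h rho))%C by ring.
apply Rle_trans with (1 := Cmod_triangle _ _). lra.
Qed.

Lemma bounded01_poly P : is_poly P -> bounded01 (fun rho => P (RtoC rho)).
Proof.
intros hP. destruct (poly_bounded P 1 hP) as [M [hM b]].
exists M; split; trivial. intros rho hr; apply b. rewrite Cmod_R, Rabs_pos_eq; lra.
Qed.

Ltac polytac := repeat first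
  [assumption | apply poly_id | apply poly_const | apply poly_add | apply poly_mul].

Lemma poly_affine (P : C -> C) (a b : C) : is_poly P -> is_poly (fun z => P (a * z + b)%C).
Proof.
induction 1.
- constructor.
- polytac.
- now apply (poly_add (fun z => P (a * z + b)%C) (fun z => Q (a * z + b)%C)).
- now apply (poly_mul (fun z => P (a * z + b)%C) (fun z => Q (a * z + b)%C)).
- apply poly_ext with (2 := IHis_poly). intros z; apply H.
Qed.

(* Multiplying over the four directions cancels the terms of order 1 and 2, so
   that [log |P|] is superharmonic and subharmonic up to third order. *)
Lemma four_product (P : C -> C) (z : C) : is_poly P ->
  O3 (fun rho => P (rho + z) * P (Ci * rho + z) * (P ((-1) * rho + z) * P (- Ci * rho + z)))%C
     (fun _ => P z * P z * (P z * P z))%C.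
Proof.
intros hP.
destruct (poly_div P z hP) as [P1 [h1 e1]].
destruct (poly_div P1 z h1) as [P2 [h2 e2]].
destruct (poly_div P2 z h2) as [P3 [h3 e3]].
set (q := fun w : C => (P z + w * P1 z + w * w * P2 z)%C).
assert (e : forall w, P (w + z)%C = (q w + w * w * w * P3 (w + z))%C).
{ intros w; rewrite (e1 (w + z)%C), (e2 (w + z)%C), (e3 (w + z)%C); unfold q; ring. }
assert (hq : forall c, is_poly (fun w => q (c * w)%C)).
{ intros c; unfold q; polytac. }
assert (K : forall c, Cmod c = 1 -> O3 (fun rho => P (c * rho + z)%C) (fun rho => q (c * rho)%C)).
{ intros c hc. destruct (poly_bounded P3 (1 + Cmod z) h3) as [M [hM b]].
  exists M; split; trivial. intros rho hr. rewrite e.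
  match goal with |- Cmod ?x <= _ => replace x with ((c * rho) * (c * rho) * (c * rho) * P3 (c * rho + z))%C by ring end.
  rewrite !Cmod_mult, hc, Cmod_R, Rabs_pos_eq by lra.
  replace (1 * rho * (1 * rho) * (1 * rho)) with (rho ^ 3) by ring.
  rewrite (Rmult_comm M). apply Rmult_le_compat_l; [apply pow_le; lra|].
  apply b. apply Rle_trans with (1 := Cmod_triangle _ _).
  rewrite Cmod_mult, hc, Cmod_R, Rabs_pos_eq; lra. }
assert (B1 : forall c, bounded01 (fun rho => P (c * rho + z)%C)).
{ intros c. apply (bounded01_poly (fun w => P (c * w + z)%C)). now apply poly_affine. }
assert (B2 : forall c, bounded01 (fun rho => q (c * rho)%C)).
{ intros c. apply (bounded01_poly (fun w => q (c * w)%C)). apply hq. }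
assert (m1 : Cmod (- Ci) = 1) by (rewrite Cmod_opp; apply Cmod_Ci).
assert (m2 : Cmod (-1) = 1) by (rewrite Cmod_R, Rabs_left; lra).
apply O3_trans with (fun rho => P (1 * rho + z) * P (Ci * rho + z) * (P ((-1) * rho + z) * P (- Ci * rho + z)))%C.
{ exists 0; split; [lra|]. intros rho hr.
  replace (1 * rho + z)%C with (rho + z)%C by ring.
  rewrite Rmult_0_l. match goal with |- Cmod ?x <= _ => replace x with (RtoC 0) by ring end.
  rewrite Cmod_0; lra. }
apply O3_trans with (fun rho => q (1 * rho) * q (Ci * rho) * (q ((-1) * rho) * q (- Ci * rho)))%C.
{ apply (O3_mul (fun rho => P (1 * rho + z) * P (Ci * rho + z))%C
                (fun rho => q (1 * rho) * q (Ci * rho))%C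
                (fun rho => P ((-1) * rho + z) * P (- Ci * rho + z))%C
                (fun rho => q ((-1) * rho) * q (- Ci * rho))%C).
  - apply O3_mul; auto using Cmod_Ci. apply K, Cmod_1.
  - apply O3_mul; auto.
  - now apply bounded01_mul.
  - now apply bounded01_mul. }
(* The four quadratic parts multiply to [P z ^ 4 + rho ^ 4 * D + rho ^ 8 * E]: opposite directions
   combine to an even polynomial in [rho], and a quarter turn changes the sign of its [rho ^ 2]
   term. *)
set (D := (2 * P z * P z * P2 z * P2 z - (2 * P z * P2 z - P1 z * P1 z) * (2 * P z * P2 z - P1 z * P1 z))%C).
set (E := (P2 z * P2 z * P2 z * P2 z)%C).
exists (Cmod D + Cmod E); split.
{ generalize (Cmod_ge_0 D) (Cmod_ge_0 E); lra. }
intros rho hr.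
assert (hi : (Ci * Ci = -1)%C) by (unfold Ci, Cmult, RtoC; simpl; f_equal; ring).
match goal with |- Cmod ?x <= _ => replace x with
  (rho * rho * rho * (rho * D + rho * rho * rho * rho * rho * E))%C end.
2:{ unfold q, D, E.
    transitivity ((P z * P z + rho*rho*(2 * P z * P2 z - P1 z * P1 z)+ rho*rho*rho*rho*P2 z * P2 z) *
      ((P z * P z + (Ci * Ci) *rho*rho*(2 * P z * P2 z - P1 z * P1 z)+ (Ci * Ci) * (Ci * Ci) * rho*rho*rho*rho*P2 z * P2 z)) - P z * P z * (P z * P z))%C.
    - rewrite hi; ring.
    - ring. }
rewrite !Cmod_mult, !Cmod_R, Rabs_pos_eq by lra.
replace (rho * rho * rho) with (rho ^ 3) by ring.
rewrite (Rmult_comm (_ + _)). apply Rmult_le_compat_l; [apply pow_le; lra|].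
apply Rle_trans with (1 := Cmod_triangle _ _).
rewrite !Cmod_mult, !Cmod_R, Rabs_pos_eq by lra.
apply Rplus_le_compat.
- assert (h := Cmod_ge_0 D); nra.
- assert (h := Cmod_ge_0 E).
  assert (rho * rho * rho * rho * rho <= 1).
  { replace (rho * rho * rho * rho * rho) with (rho ^ 5) by ring.
    rewrite <- (pow1 5). apply pow_incr; lra. }
  nra.
Qed.

Lemma exp_le_compat (x y : R) : x <= y -> exp x <= exp y.
Proof. intros [h|h]; [now apply Rlt_le, exp_increasing|rewrite h; lra]. Qed.

(* The mean value inequality over the vertices of a square, up to third order. *)
Definition four_point (K : C -> Prop) (H : C -> R) (z : C) : Prop :=
  exists A d, 0 <= A /\ 0 < d /\ forall rho, 0 < rho < d ->
    (K (rho + z)%C /\ K (Ci * rho + z)%C /\ K ((-1) * rho + z)%C /\ K (- Ci * rho + z)%C) /\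
    4 * H z - A * rho ^ 3 <=
      H (rho + z)%C + H (Ci * rho + z)%C + H ((-1) * rho + z)%C + H (- Ci * rho + z)%C.

Definition usc_on (K : C -> Prop) (H : C -> R) : Prop :=
  forall z, K z -> forall e, 0 < e -> exists d, 0 < d /\
    forall w, K w -> Cmod (w - z) < d -> H w < H z + e.

(** The product [|P| * exp H] is used in place of [log |P| + H] because it is finite at the zeros of
    [P]. *)
Lemma usc_mul_exp (K : C -> Prop) (P : C -> C) (H : C -> R) :
  is_poly P -> usc_on K H -> usc_on K (fun z => Cmod (P z) * exp (H z)).
Proof.
intros hP hH z kz e he.
set (p := Cmod (P z)). set (x := exp (H z)).
assert (hp : 0 <= p) by apply Cmod_ge_0. assert (hx : 0 < x) by apply exp_pos.
set (t := Rmin 1 (e / (p + x + 2))).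
assert (ht : 0 < t) by (apply Rmin_glb_lt; [lra|apply Rdiv_lt_0_compat; lra]).
assert (ht1 : t <= 1) by apply Rmin_l.
assert (ht2 : t * (p + x + 2) <= e).
{ apply Rle_trans with (e / (p + x + 2) * (p + x + 2)).
  - apply Rmult_le_compat_r; [lra|apply Rmin_r].
  - right; field; lra. }
destruct (poly_continuous P z hP t ht) as [d1 [hd1 h1]].
assert (hl : 0 < ln (1 + t / x)).
{ rewrite <- ln_1. apply ln_increasing; [lra|]. assert (0 < t / x) by (apply Rdiv_lt_0_compat; lra). lra. }
destruct (hH z kz _ hl) as [d2 [hd2 h2]].
exists (Rmin d1 d2); split; [now apply Rmin_glb_lt|].
intros w kw hw.
assert (a1 : Cmod (P w) < p + t).
{ assert (h := h1 w (Rlt_le_trans _ _ _ hw (Rmin_l _ _))).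
  assert (h' := Cmod_triangle_inv (P w) (P z)). fold p in h'. lra. }
assert (a2 : exp (H w) < x + t).
{ assert (h := h2 w kw (Rlt_le_trans _ _ _ hw (Rmin_r _ _))).
  apply exp_increasing in h. rewrite exp_plus, exp_ln in h.
  - fold x in h. replace (x * (1 + t / x)) with (x + t) in h by (field; lra). trivial.
  - assert (0 < t / x) by (apply Rdiv_lt_0_compat; lra). lra. }
apply Rlt_le_trans with ((p + t) * (x + t)).
- apply Rmult_le_0_lt_compat; auto using Cmod_ge_0, Rlt_le, exp_pos.
- nra.
Qed.

(** [|z| ^ 2] has constant positive Laplacian: its four-point sum exceeds four times the central
    value by exactly [4 * rho ^ 2], which beats any error of third order. *)
Lemma Cmod_sq_four (z : C) (rho : R) :
  Cmod (rho + z) ^ 2 + Cmod (Ci * rho + z) ^ 2 + Cmod ((-1) * rho + z) ^ 2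
    + Cmod (- Ci * rho + z) ^ 2 = 4 * Cmod z ^ 2 + 4 * rho ^ 2.
Proof. rewrite !Cmod2_alt. destruct z as [x y]. simpl. ring. Qed.

Lemma Cmod_sq_continuous (z : C) (e : R) : 0 < e ->
  exists d, 0 < d /\ forall w, Cmod (w - z) < d -> Cmod w ^ 2 < Cmod z ^ 2 + e.
Proof.
intros he. assert (hz := Cmod_ge_0 z).
set (d := Rmin 1 (e / (2 * Cmod z + 2))).
assert (hd : 0 < d) by (apply Rmin_glb_lt; [lra|apply Rdiv_lt_0_compat; lra]).
assert (hd1 : d <= 1) by apply Rmin_l.
assert (hd2 : d * (2 * Cmod z + 2) <= e).
{ apply Rle_trans with (e / (2 * Cmod z + 2) * (2 * Cmod z + 2)).
  - apply Rmult_le_compat_r; [lra|apply Rmin_r].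
  - right; field; lra. }
exists d; split; trivial. intros w hw.
assert (h := Cmod_triangle (w - z) z). replace (w - z + z)%C with w in h by ring.
assert (hw0 := Cmod_ge_0 w). nra.
Qed.

(** The arithmetic behind [max_principle], with [p] for [|P z| ^ 4]: for small [rho] the gain
    [4 * eps * rho ^ 2] outweighs the defect [A' * rho ^ 3] of the product and the defect
    [A * rho ^ 3] of the exponent. *)
Lemma four_point_arith (p A A' eps rho : R) :
  0 < p -> 0 <= A -> 0 <= A' -> 0 < eps -> 0 < rho <= 1 / 2 ->
  rho * (2 * (A * p + A' * (1 + 4 * eps) + 1)) <= 4 * eps * p ->
  rho * (2 * (A * p + A' * (1 + 4 * eps) + 1)) <= p ->
  0 < p - A' * rho ^ 3 /\
  p < (p - A' * rho ^ 3) * (1 + (4 * eps * rho ^ 2 - A * rho ^ 3)).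
Proof.
intros hp hA hA' heps [r0 r1] h1 h2.
assert (a1 : 0 <= A * p) by now apply Rmult_le_pos, Rlt_le.
assert (a2 : 0 <= A' * eps) by now apply Rmult_le_pos, Rlt_le.
assert (b2 : 0 < rho ^ 2) by now apply pow_lt.
assert (b2' : rho ^ 2 <= 1) by nra.
assert (b3 : 0 < rho ^ 3) by now apply pow_lt.
split; [nra|].
assert (q1 : 0 <= A' * A * rho ^ 6).
{ apply Rmult_le_pos; [now apply Rmult_le_pos|apply pow_le; lra]. }
assert (q2 : A' * eps * rho ^ 5 <= A' * eps * rho ^ 3).
{ apply Rmult_le_compat_l; trivial. replace (rho ^ 5) with (rho ^ 3 * rho ^ 2) by ring. nra. }
assert (q3 : 0 < rho ^ 2 * (4 * eps * p - rho * (A * p + A' * (1 + 4 * eps) + 1/2))).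
{ apply Rmult_lt_0_compat; trivial. nra. }
nra.
Qed.

(* The term [eps * |z|^2] makes the four-point mean of [log |P| + H]
   strictly larger than its central value. *)
Theorem max_principle (K : C -> Prop) (B : R) (P : C -> C) (H : C -> R) (M : R) :
  is_poly P -> 0 < M ->
  (forall z, K z -> Cmod z <= B) -> closed_in_plane K -> usc_on K H ->
  (forall z, K z -> Cmod (P z) * exp (H z) <= M \/ four_point K H z) ->
  forall z, K z -> Cmod (P z) * exp (H z) <= M.
Proof.
intros hP hM hB hK hH alt z1 kz1.
apply Rnot_lt_le; intros hlt.
set (Phi := fun z => Cmod (P z) * exp (H z)) in *.
assert (hB0 : 0 <= B) by (apply Rle_trans with (2 := hB _ kz1), Cmod_ge_0).
(* On [K] the perturbation multiplies the bound [M] by at most the square root of [Phi z1 / M], so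
   the bound stays below the value at [z1], and the maximum of the perturbed function violates it
   too. *)
set (eps := ln (Phi z1 / M) / (2 * (B ^ 2 + 1))).
assert (hq : 1 < Phi z1 / M).
{ apply Rmult_lt_reg_r with M; trivial. unfold Rdiv; rewrite Rmult_assoc, Rinv_l; unfold Phi; lra. }
assert (hln : 0 < ln (Phi z1 / M)) by (rewrite <- ln_1; apply ln_increasing; lra).
assert (hB2 : 0 <= B ^ 2) by (apply pow_le; trivial).
assert (heps : 0 < eps) by (apply Rdiv_lt_0_compat; lra).
assert (hMB : M * exp (eps * B ^ 2) < Phi z1).
{ apply Rlt_le_trans with (M * exp (ln (Phi z1 / M))).
  - apply Rmult_lt_compat_l; trivial. apply exp_increasing.
    replace (ln (Phi z1 / M)) with (eps * (2 * (B ^ 2 + 1))) by (unfold eps; field; lra). nra.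
  - rewrite exp_ln by lra. right; field; lra. }
set (H' := fun z => H z + eps * Cmod z ^ 2).
assert (hH' : usc_on K H').
{ intros z kz e he. destruct (hH z kz (e / 2) ltac:(lra)) as [d1 [hd1 h1]].
  destruct (Cmod_sq_continuous z (e / 2 / eps)) as [d2 [hd2 h2]].
  { apply Rdiv_lt_0_compat; lra. }
  exists (Rmin d1 d2); split; [now apply Rmin_glb_lt|]. intros w kw hw.
  assert (a1 := h1 w kw (Rlt_le_trans _ _ _ hw (Rmin_l _ _))).
  assert (a2 := h2 w (Rlt_le_trans _ _ _ hw (Rmin_r _ _))).
  apply (Rmult_lt_compat_l eps) in a2; trivial. unfold H'.
  replace (eps * (Cmod z ^ 2 + e / 2 / eps)) with (eps * Cmod z ^ 2 + e / 2) in a2 by (field; lra). lra. }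
destruct (usc_attains_max K B (fun z => Cmod (P z) * exp (H' z)) z1 hB hK
            (usc_mul_exp K P H' hP hH') kz1) as [z [kz hmax]].
assert (hz : M * exp (eps * B ^ 2) < Cmod (P z) * exp (H' z)).
{ apply Rlt_le_trans with (1 := hMB), Rle_trans with (2 := hmax z1 kz1). unfold Phi, H'.
  apply Rmult_le_compat_l; [apply Cmod_ge_0|].
  apply exp_le_compat. nra. }
destruct (alt z kz) as [hb|[A [d [hA [hd h4]]]]].
{ apply (Rlt_irrefl (M * exp (eps * B ^ 2))). apply Rlt_le_trans with (1 := hz).
  unfold H'. rewrite exp_plus, <- Rmult_assoc. apply Rmult_le_compat; trivial.
  - apply Rmult_le_pos; [apply Cmod_ge_0|apply Rlt_le, exp_pos].
  - apply Rlt_le, exp_pos.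
  - apply exp_le_compat. apply Rmult_le_compat_l; [lra|].
    apply pow_incr; split; [apply Cmod_ge_0|auto]. }
set (p := Cmod (P z)) in *.
assert (hp : 0 < p).
{ assert (h : 0 < p * exp (H' z)).
  { apply Rle_lt_trans with (2 := hz). apply Rmult_le_pos; [lra|apply Rlt_le, exp_pos]. }
  assert (h' := exp_pos (H' z)). assert (0 <= p) by apply Cmod_ge_0.
  destruct (Req_dec p 0) as [e|e]; [rewrite e in h|]; lra. }
destruct (four_product P z hP) as [A' [hA' h4']].
assert (hp4 : 0 < p ^ 4) by now apply pow_lt.
set (den := 4 * eps * p ^ 4).
set (big := A * p ^ 4 + A' * (1 + 4 * eps) + 1).
assert (hbig : 0 < big).
{ assert (0 <= A * p ^ 4) by (apply Rmult_le_pos; lra).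
  assert (0 <= A' * (1 + 4 * eps)) by (apply Rmult_le_pos; lra). unfold big; lra. }
assert (hden : 0 < den) by (apply Rmult_lt_0_compat; lra).
set (rho := Rmin (Rmin (1 / 2) (d / 2)) (Rmin den (p ^ 4) / (2 * big))).
assert (r0 : 0 < rho).
{ apply Rmin_glb_lt; [apply Rmin_glb_lt; lra|]. apply Rdiv_lt_0_compat; [now apply Rmin_glb_lt|lra]. }
assert (r1 : rho <= 1 / 2) by (apply Rle_trans with (1 := Rmin_l _ _), Rmin_l).
assert (r2 : rho <= d / 2) by (apply Rle_trans with (1 := Rmin_l _ _), Rmin_r).
assert (r34 : rho * (2 * big) <= Rmin den (p ^ 4)).
{ apply Rle_trans with (Rmin den (p ^ 4) / (2 * big) * (2 * big)).
  - apply Rmult_le_compat_r; [lra|apply Rmin_r].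
  - right; field; lra. }
assert (r3 := Rle_trans _ _ _ r34 (Rmin_l _ _)).
assert (r4 := Rle_trans _ _ _ r34 (Rmin_r _ _)).
destruct (h4 rho ltac:(lra)) as [[k1 [k2 [k3 k4]]] h5].
specialize (h4' rho ltac:(lra)).
(* The maximality inequalities at the four neighbours are multiplied: [four_product] controls the
   values of [P], while [four_point] and [Cmod_sq_four] control the sum of the exponents. *)
assert (m1 := hmax _ k1). assert (m2 := hmax _ k2).
assert (m3 := hmax _ k3). assert (m4 := hmax _ k4). simpl in m1, m2, m3, m4.
assert (prod : forall a b x y, 0 <= a -> 0 <= b -> a <= x -> b <= y -> a * b <= x * y).
{ intros; apply Rmult_le_compat; trivial. }
assert (nn : forall w, 0 <= Cmod (P w) * exp (H' w)).
{ intros w. apply Rmult_le_pos; [apply Cmod_ge_0|apply Rlt_le, exp_pos]. }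
assert (m12 := prod _ _ _ _ (nn _) (nn _) m1 m2).
assert (m34 := prod _ _ _ _ (nn _) (nn _) m3 m4).
assert (m := prod _ _ _ _ ltac:(apply Rmult_le_pos; apply nn) ltac:(apply Rmult_le_pos; apply nn) m12 m34).
set (X1 := (rho + z)%C) in *. set (X2 := (Ci * rho + z)%C) in *.
set (X3 := ((-1) * rho + z)%C) in *. set (X4 := (- Ci * rho + z)%C) in *.
assert (hprod : p ^ 4 - A' * rho ^ 3 <= Cmod (P X1) * Cmod (P X2) * (Cmod (P X3) * Cmod (P X4))).
{ rewrite <- !Cmod_mult.
  match type of h4' with Cmod (?x - ?y) <= _ => assert (hh := Cmod_triangle_inv y x) end.
  replace (P z * P z * (P z * P z) - P X1 * P X2 * (P X3 * P X4))%C
    with (- (P X1 * P X2 * (P X3 * P X4) - P z * P z * (P z * P z)))%C in hh by ring.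
  rewrite Cmod_opp in hh. rewrite !(Cmod_mult (P z * P z)), !(Cmod_mult (P z)) in hh. fold p in hh.
  replace (p ^ 4) with (p * p * (p * p)) by ring. lra. }
set (S := H' X1 + H' X2 + (H' X3 + H' X4)).
assert (hS : 4 * H' z + 4 * eps * rho ^ 2 - A * rho ^ 3 <= S).
{ unfold S, H'. assert (e := Cmod_sq_four z rho). fold X1 X2 X3 X4 in e.
  apply (f_equal (Rmult eps)) in e. lra. }
assert (m' : (p ^ 4 - A' * rho ^ 3) * exp S <= p ^ 4 * exp (4 * H' z)).
{ apply Rle_trans with (Cmod (P X1) * Cmod (P X2) * (Cmod (P X3) * Cmod (P X4)) * exp S).
  - apply Rmult_le_compat_r; [apply Rlt_le, exp_pos|trivial].
  - unfold S. rewrite !exp_plus. replace (4 * H' z) with (H' z + H' z + (H' z + H' z)) by ring.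
    rewrite !exp_plus.
    eapply Rle_trans; [|eapply Rle_trans; [exact m|]]; right; ring. }
destruct (four_point_arith (p ^ 4) A A' eps rho) as [hpos hfin]; trivial; [lra|].
assert (mm : (p ^ 4 - A' * rho ^ 3) * exp (4 * eps * rho ^ 2 - A * rho ^ 3) <= p ^ 4).
{ apply Rmult_le_reg_r with (exp (4 * H' z)); [apply exp_pos|].
  apply Rle_trans with (2 := m'). rewrite Rmult_assoc, <- exp_plus.
  apply Rmult_le_compat_l; [lra|]. apply exp_le_compat. lra. }
assert (e1 := exp_ineq1_le (4 * eps * rho ^ 2 - A * rho ^ 3)).
apply (Rlt_irrefl (p ^ 4)), Rlt_le_trans with (1 := hfin), Rle_trans with (2 := mm).
apply Rmult_le_compat_l; lra.
Qed.

(** * Jensen's inequality *)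

Lemma expi_plus (s t : R) : expi (s + t) = (expi s * expi t)%C.
Proof. unfold expi, Cmult; simpl. rewrite cos_plus, sin_plus. f_equal; ring. Qed.

Lemma expi_0 : expi 0 = 1%C.
Proof. unfold expi; now rewrite cos_0, sin_0. Qed.

Lemma Cmod_expi (t : R) : Cmod (expi t) = 1.
Proof.
assert (h := Cmod2_alt (expi t)). simpl in h.
assert (h1 := sin2_cos2 t). unfold Rsqr in h1. assert (h2 := Cmod_ge_0 (expi t)).
nra.
Qed.

Lemma unit_circle (w : C) : Cmod w = 1 -> exists t, w = expi t.
Proof.
intros hw. assert (h := Cmod2_alt w). rewrite hw in h.
assert (hr := re_le_Cmod w). rewrite hw in hr. apply Rabs_le_between in hr.
assert (hs : sin (acos (Re w)) = Rabs (Im w)).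
{ rewrite sin_acos by trivial. rewrite <- sqrt_Rsqr_abs. f_equal. unfold Rsqr in *. lra. }
destruct (Rle_dec 0 (Im w)) as [hi|hi].
- exists (acos (Re w)). unfold expi. rewrite cos_acos, hs, Rabs_pos_eq by trivial.
  now destruct w.
- exists (- acos (Re w)). unfold expi. rewrite cos_neg, sin_neg, cos_acos, hs by trivial.
  rewrite Rabs_left, Ropp_involutive by lra. now destruct w.
Qed.

Fixpoint rsum (f : nat -> R) (n : nat) : R :=
  match n with O => 0 | S n => rsum f n + f n end.

Lemma rsum_ext f g n : (forall i, (i < n)%nat -> f i = g i) -> rsum f n = rsum g n.
Proof. induction n; simpl; intros h; trivial. rewrite IHn, h; auto. Qed.

Lemma rsum_le f g n : (forall i, (i < n)%nat -> f i <= g i) -> rsum f n <= rsum g n.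
Proof.
induction n; simpl; intros h; [lra|]. apply Rplus_le_compat; auto.
Qed.

Lemma rsum_scal c f n : rsum (fun i => c * f i) n = c * rsum f n.
Proof. induction n; simpl; [ring|]. rewrite IHn; ring. Qed.

Lemma rsum_plus f g n : rsum (fun i => f i + g i) n = rsum f n + rsum g n.
Proof. induction n; simpl; [ring|]. rewrite IHn; ring. Qed.

Lemma rsum_const c n : rsum (fun _ => c) n = INR n * c.
Proof. induction n; [simpl; ring|]. rewrite S_INR; simpl. rewrite IHn; ring. Qed.

Lemma rsum_shift f n : rsum f (S n) = f O + rsum (fun i => f (S i)) n.
Proof. induction n; simpl in *; [ring|]. rewrite IHn; ring. Qed.

(** Equally spaced points over one period [PI] of [|sin|]; divided by [M], the sum approximates the
    mean [2 / PI], whatever [phi] is. *)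
Definition sin_sum (M : nat) (phi : R) : R :=
  rsum (fun l => Rabs (sin (phi + INR l * (PI / INR M)))) M.

Lemma sin_sum_shift M phi : (0 < M)%nat ->
  sin_sum M (phi + PI / INR M) = sin_sum M phi.
Proof.
intros hM. assert (hMr := lt_0_INR _ hM). unfold sin_sum.
assert (hMh : INR M * (PI / INR M) = PI) by (field; lra).
set (h := PI / INR M) in *. clearbody h.
destruct M as [|N]; [lia|].
rewrite (rsum_shift (fun l => Rabs (sin (phi + INR l * h)))). simpl rsum at 1.
rewrite Rplus_comm. f_equal.
- replace (phi + h + INR N * h) with (phi + PI).
  + rewrite neg_sin, Rabs_Ropp. simpl. f_equal. f_equal. ring.
  + rewrite <- hMh, S_INR. ring.
- apply rsum_ext. intros i _. f_equal. f_equal. rewrite S_INR. ring.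
Qed.

Lemma sin_sum_period M (n : Z) phi : (0 < M)%nat ->
  sin_sum M (phi + IZR n * (PI / INR M)) = sin_sum M phi.
Proof.
intros hM. set (h := PI / INR M).
assert (P : forall k x, sin_sum M (x + INR k * h) = sin_sum M x).
{ induction k; intros x.
  - f_equal; simpl; ring.
  - rewrite S_INR. replace (x + (INR k + 1) * h) with (x + INR k * h + h) by ring.
    unfold h at 2. now rewrite sin_sum_shift. }
destruct (Z.le_gt_cases 0 n) as [hn|hn].
- rewrite <- (Z2Nat.id n hn), <- INR_IZR_INZ. apply P.
- rewrite <- (P (Z.to_nat (- n))). f_equal. rewrite (INR_IZR_INZ (Z.to_nat (- n))), Z2Nat.id by lia.
  rewrite opp_IZR; ring.
Qed.

(** All angles lie in [[0, PI]], so the absolute values drop and, after multiplication by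
    [sin (h / 2)], the sum telescopes to half a difference of two cosines. *)
Lemma sin_sum_first M phi : (0 < M)%nat -> 0 <= phi <= PI / INR M ->
  sin_sum M phi * sin (PI / INR M / 2) <= 1.
Proof.
intros hM hp. assert (hMr := lt_0_INR _ hM).
unfold sin_sum.
assert (hMh : INR M * (PI / INR M) = PI) by (field; lra).
set (h := PI / INR M) in *. clearbody h.
assert (T : forall n, rsum (fun l => sin (phi + INR l * h)) n * sin (h / 2)
  = (cos (phi - h / 2) - cos (phi + INR n * h - h / 2)) / 2).
{ induction n.
  - simpl. replace (phi + 0 * h - h / 2) with (phi - h / 2) by ring. lra.
  - simpl rsum. rewrite Rmult_plus_distr_r, IHn, S_INR.
    replace (phi + (INR n + 1) * h - h / 2) with (phi + INR n * h + h / 2) by lra.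
    generalize (cos (phi - h / 2)). intros c. rewrite cos_plus, cos_minus. field. }
replace (rsum _ M) with (rsum (fun l => sin (phi + INR l * h)) M).
- rewrite T. assert (c1 := COS_bound (phi - h / 2)).
  assert (c2 := COS_bound (phi + INR M * h - h / 2)). lra.
- apply rsum_ext. intros i hi. rewrite Rabs_pos_eq; trivial.
  assert (hi' : INR i + 1 <= INR M) by (rewrite <- S_INR; apply le_INR; lia).
  assert (0 <= INR i) by apply pos_INR.
  apply sin_ge_0; nra.
Qed.

Lemma sin_sum_bound M phi : (0 < M)%nat -> sin_sum M phi * sin (PI / INR M / 2) <= 1.
Proof.
intros hM. assert (hpi := PI_RGT_0). assert (hMr := lt_0_INR _ hM).
set (h := PI / INR M).
assert (hh : 0 < h) by (apply Rdiv_lt_0_compat; trivial).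
destruct (archimed (phi / h)) as [a1 a2].
set (n := (up (phi / h) - 1)%Z).
assert (hn : IZR n = IZR (up (phi / h)) - 1) by (unfold n; now rewrite minus_IZR).
rewrite <- (sin_sum_period M (- n) phi) by trivial. fold h. apply sin_sum_first; trivial. fold h.
rewrite opp_IZR, hn.
assert (e : phi = phi / h * h) by (field; lra).
set (x := phi / h) in *. set (y := IZR (up x)) in *. rewrite e. nra.
Qed.

(** By [sin_sum_bound] the mean is at most [1 / (M * sin (PI / (2 * M)))], which tends to
    [2 / PI]. *)
Lemma abs_sin_mean (e : R) : 0 < e -> exists M, (0 < M)%nat /\
  forall phi, sin_sum M phi <= INR M * (2 / PI + e).
Proof.
intros he. assert (hpi := PI_RGT_0).
set (e' := Rmin (1 / 2) (e / 2)).
assert (he' : 0 < e') by (apply Rmin_glb_lt; lra).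
assert (e1 : e' <= 1 / 2) by apply Rmin_l. assert (e2 : e' <= e / 2) by apply Rmin_r.
destruct (derivable_pt_lim_sin_0 e' he') as [d hd].
destruct (archimed_cor1 (d / PI)) as [M [hM1 hM2]].
{ apply Rdiv_lt_0_compat; [apply cond_pos|trivial]. }
exists M; split; trivial. intros phi.
assert (hM : 0 < INR M) by now apply lt_0_INR.
set (x := PI / INR M / 2).
assert (hx : 0 < x) by (unfold x; repeat apply Rdiv_lt_0_compat; lra).
assert (hxd : x < d).
{ apply (Rmult_lt_compat_r PI) in hM1; trivial.
  replace (d / PI * PI) with (pos d) in hM1 by (field; lra).
  unfold x. replace (PI / INR M / 2) with (/ INR M * PI / 2) by (field; lra).
  assert (0 < / INR M * PI) by (apply Rmult_lt_0_compat; trivial; now apply Rinv_0_lt_compat). lra. }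
assert (hs := hd x ltac:(lra) ltac:(rewrite Rabs_pos_eq; lra)).
rewrite Rplus_0_l, sin_0, Rminus_0_r in hs. apply Rabs_lt_between in hs.
assert (hs' : x * (1 - e') < sin x).
{ apply (Rmult_lt_reg_r (/ x)); [now apply Rinv_0_lt_compat|].
  replace (x * (1 - e') * / x) with (1 - e') by (field; lra). unfold Rdiv in hs; lra. }
assert (h := sin_sum_bound M phi hM2). fold x in h.
set (s := sin_sum M phi) in *.
assert (hS : 0 <= s).
{ unfold s, sin_sum. rewrite <- (Rmult_0_r (INR M)), <- rsum_const. apply rsum_le. intros; apply Rabs_pos. }
assert (h1 : s * (x * (1 - e')) <= 1).
{ apply Rle_trans with (2 := h). apply Rmult_le_compat_l; lra. }
assert (hMx : INR M * x = PI / 2) by (unfold x; field; lra).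
apply Rmult_le_reg_r with (x * (1 - e')); [apply Rmult_lt_0_compat; lra|].
apply Rle_trans with (1 := h1).
replace (INR M * (2 / PI + e) * (x * (1 - e'))) with (INR M * x * ((2 / PI + e) * (1 - e'))) by ring.
rewrite hMx. replace (PI / 2 * ((2 / PI + e) * (1 - e'))) with ((1 + PI / 2 * e) * (1 - e')) by (field; apply PI_neq0).
assert (p2 : e <= PI / 2 * e) by (assert (h2 := PI2_1); nra).
generalize dependent (PI / 2 * e). intros u hu. clear -hu e1 e2 he he'.
generalize dependent e'. intros; nra.
Qed.

Fixpoint cprod (f : nat -> C) (n : nat) : C :=
  match n with O => RtoC 1 | S n => (cprod f n * f n)%C end.

Lemma cprod_poly (F : nat -> C -> C) n :
  (forall i, is_poly (F i)) -> is_poly (fun w => cprod (fun i => F i w) n).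
Proof. intros h; induction n; simpl; polytac. apply h. Qed.

Lemma Cmod_cprod_le (f : nat -> C) (g : nat -> R) n :
  (forall i, Cmod (f i) <= exp (g i)) -> Cmod (cprod f n) <= exp (rsum g n).
Proof.
intros h; induction n; simpl.
- rewrite Cmod_1, exp_0; lra.
- rewrite Cmod_mult, exp_plus. apply Rmult_le_compat; auto using Cmod_ge_0.
Qed.

Lemma cprod_ext f g n : (forall i, f i = g i) -> cprod f n = cprod g n.
Proof. intros h; induction n; simpl; trivial. now rewrite IHn, h. Qed.

Lemma cprod_const c n : cprod (fun _ => c) n = (c ^ n)%C.
Proof. induction n; simpl; trivial. rewrite IHn; ring. Qed.

Lemma interior_four_point (K : C -> Prop) (z : C) (d : R) : 0 < d ->
  (forall w, Cmod (w - z) < d -> K w) -> four_point K (fun _ => 0) z.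
Proof.
intros hd h. exists 0, d. split; [lra|split; [trivial|]]. intros rho hr.
assert (k : forall c, Cmod c = 1 -> K (c * rho + z)%C).
{ intros c hc. apply h. replace (c * rho + z - z)%C with (c * rho)%C by ring.
  rewrite Cmod_mult, hc, Cmod_R, Rabs_pos_eq; lra. }
split; [|lra]. repeat split; try apply k.
- replace (rho + z)%C with (1 * rho + z)%C by ring. apply k, Cmod_1.
- apply Cmod_Ci.
- rewrite Cmod_R, Rabs_left; lra.
- rewrite Cmod_opp; apply Cmod_Ci.
Qed.

Lemma usc_const (K : C -> Prop) (c : R) : usc_on K (fun _ => c).
Proof. intros z _ e he; exists 1; split; [lra|]. intros; lra. Qed.

Lemma disc_max_principle (P : C -> C) (M : R) : is_poly P -> 0 < M ->
  (forall t, Cmod (P (expi t)) <= M) -> Cmod (P 0) <= M.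
Proof.
intros hP hM hb.
set (K := fun z : C => Cmod z <= 1).
assert (h : Cmod (P 0) * exp 0 <= M).
{ apply (max_principle K 1 P (fun _ => 0) M); trivial.
  - intros z hz. unfold K in hz. exists (Cmod z - 1); split; [lra|].
    intros w hw hw'. unfold K in hw'. assert (h := Cmod_triangle_inv z w).
    replace (z - w)%C with (- (w - z))%C in h by ring. rewrite Cmod_opp in h. lra.
  - apply usc_const.
  - intros z hz. destruct (Rle_lt_or_eq_dec _ _ hz) as [h|h].
    + right. apply interior_four_point with (1 - Cmod z); [lra|].
      intros w hw. unfold K. assert (h' := Cmod_triangle_inv w z). lra.
    + left. rewrite exp_0, Rmult_1_r. destruct (unit_circle z h) as [t ->]. apply hb.
  - unfold K. rewrite Cmod_0; lra. }
rewrite exp_0 in h; lra.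
Qed.

Lemma le_exp_of_forall (x a : R) : (forall e, 0 < e -> x <= exp (a + e)) -> x <= exp a.
Proof.
intros h. apply Rnot_lt_le; intros hlt.
assert (hx : 0 < x) by (apply Rlt_trans with (2 := hlt), exp_pos).
assert (hl : a < ln x) by (rewrite <- (ln_exp a); apply ln_increasing; trivial; apply exp_pos).
specialize (h ((ln x - a) / 2) ltac:(lra)).
apply (Rlt_irrefl x), Rle_lt_trans with (1 := h).
rewrite <- (exp_ln x) at 2 by trivial. apply exp_increasing; lra.
Qed.

(* The mean over the circle is replaced by a product of rotated copies of [Q],
   to which the maximum principle applies; [2 / PI] is the mean of [|sin|]. *)
Lemma jensen_circle (Q : C -> C) (z : C) (R X Y : R) : is_poly Q -> 0 <= Y ->
  (forall t, Cmod (Q (z + R * expi t)%C) <= exp (X + Y * Rabs (sin t))) ->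
  Cmod (Q z) <= exp (X + Y * (2 / PI)).
Proof.
intros hQ hY hb. apply le_exp_of_forall. intros e he.
set (e' := e / (Y + 1)).
assert (he' : 0 < e') by (apply Rdiv_lt_0_compat; lra).
assert (hYe : Y * e' <= e) by (unfold e'; apply Rmult_le_reg_r with (Y + 1); [lra|]; field_simplify; nra).
destruct (abs_sin_mean e' he') as [M [hM hsum]].
set (h := PI / INR M) in *.
(* [W 0] is [Q z ^ M]. The rotations run over half a turn only, which is a full period of [|sin|],
   so on the unit circle the exponents add up to a [sin_sum]. *)
set (W := fun w : C => cprod (fun l => Q ((R * expi (INR l * h)) * w + z)%C) M).
assert (hW : is_poly W).
{ apply (cprod_poly (fun l w => Q ((R * expi (INR l * h)) * w + z)%C)).
  intros i. now apply (poly_affine Q). }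
assert (hM' : 0 < INR M) by now apply lt_0_INR.
assert (hW0 : Cmod (W 0%C) <= exp (INR M * (X + Y * (2 / PI) + e))).
{ apply disc_max_principle; trivial; [apply exp_pos|]. intros t. unfold W.
  apply Rle_trans with (exp (rsum (fun l => X + Y * Rabs (sin (t + INR l * h))) M)).
  - apply Cmod_cprod_le. intros l.
    replace (R * expi (INR l * h) * expi t + z)%C with (z + R * expi (t + INR l * h))%C; trivial.
    rewrite expi_plus; ring.
  - apply exp_le_compat. rewrite rsum_plus, rsum_const, rsum_scal.
    specialize (hsum t). unfold sin_sum in hsum. fold h in hsum.
    apply (Rmult_le_compat_l Y) in hsum; trivial.
    apply Rle_trans with (INR M * X + Y * (INR M * (2 / PI + e'))); [lra|].
    replace (INR M * X + Y * (INR M * (2 / PI + e'))) with (INR M * (X + Y * (2 / PI) + Y * e')) by ring.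
    apply Rmult_le_compat_l; lra. }
assert (e0 : W 0%C = (Q z ^ M)%C).
{ unfold W. rewrite <- cprod_const. apply cprod_ext. intros i. f_equal. ring. }
rewrite e0, Cmod_pow in hW0.
apply Rnot_lt_le; intros hlt.
apply (Rlt_irrefl (Cmod (Q z) ^ M)), Rle_lt_trans with (1 := hW0).
replace (exp (INR M * (X + Y * (2 / PI) + e))) with (exp (X + Y * (2 / PI) + e) ^ M).
- clear -hM hlt. destruct M as [|M]; [lia|]. clear hM.
  assert (0 < exp (X + Y * (2 / PI) + e)) by apply exp_pos.
  induction M as [|M IH]; [simpl; lra|].
  rewrite <- (tech_pow_Rmult _ (S M)), <- (tech_pow_Rmult (Cmod (Q z)) (S M)).
  apply Rmult_le_0_lt_compat; trivial; [lra|apply pow_le; lra].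
- clear. induction M; [simpl; now rewrite Rmult_0_l, exp_0|].
  rewrite S_INR, <- tech_pow_Rmult, IHM, <- exp_plus. f_equal; ring.
Qed.

Fixpoint lprod (f : R -> R) (l : list R) : R :=
  match l with nil => 1 | x :: l => f x * lprod f l end.

Fixpoint zprod (z : C) (l : list R) : C :=
  match l with nil => RtoC 1 | x :: l => ((z - x) * zprod z l)%C end.

Lemma divide_zeros (l : list R) : forall P, is_poly P -> NoDup l ->
  (forall x, In x l -> P (RtoC x) = 0%C) ->
  exists Q, is_poly Q /\ forall z, P z = (zprod z l * Q z)%C.
Proof.
induction l as [|x l IH]; intros P hP hl hz.
- exists P; split; trivial. intros z; simpl; ring.
- destruct (poly_div P x hP) as [Q [hQ eQ]].
  assert (e0 : P (RtoC x) = 0%C) by (apply hz; now left).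
  rewrite e0 in eQ. inversion hl as [|? ? hx hl']; subst.
  destruct (IH Q hQ hl') as [Q' [hQ' e']].
  { intros y hy. assert (h := hz y (or_intror hy)). rewrite eQ in h.
    assert (hyx : y <> x) by (intros ->; contradiction).
    assert (hne : (y - x)%C <> 0%C).
    { intros h'. apply hyx. apply (f_equal Re) in h'. simpl in h'. lra. }
    apply (f_equal (fun c => (c / (y - x))%C)) in h.
    replace ((0 + (y - x) * Q y) / (y - x))%C with (Q (RtoC y)) in h by (field; trivial).
    rewrite h. field; trivial. }
  exists Q'; split; trivial. intros z. rewrite eQ, e'. simpl. ring.
Qed.

(** The factor for [x] has the modulus of [w - x] on the circle [|w - z| = r] and the value [r] at
    the centre. Putting it in place of [w - x] is division by a Blaschke factor, with a polynomial
    as result. *)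
Fixpoint reflected_prod (z : C) (r : R) (l : list R) (w : C) : C :=
  match l with
  | nil => RtoC 1
  | x :: l => ((/ r * (r * r - Cconj (x - z) * (w - z))) * reflected_prod z r l w)%C
  end.

Lemma reflected_prod_poly z r l : is_poly (reflected_prod z r l).
Proof.
induction l as [|x l IH]; simpl; [constructor|].
apply poly_mul; trivial.
apply poly_ext with (P := fun w : C => (/ r * (r * r + - Cconj (x - z) * (w + - z)))%C).
- intros w; unfold Cminus; ring.
- polytac.
Qed.

Lemma reflected_prod_center z (r : R) l : 0 < r ->
  reflected_prod z r l z = RtoC (r ^ length l).
Proof.
intros hR. induction l as [|x l IH]; simpl; trivial.
rewrite IH, RtoC_mult. field. intros h. apply RtoC_inj in h. lra.
Qed.

Lemma reflected_prod_circle z (r : R) l t : 0 < r ->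
  Cmod (reflected_prod z r l (z + r * expi t)) = Cmod (zprod (z + r * expi t) l).
Proof.
intros hR. induction l as [|x l IH]; simpl; trivial.
assert (hR0 : RtoC r <> 0%C) by (intros h; apply RtoC_inj in h; lra).
assert (hu : (expi t * Cconj (expi t))%C = 1%C).
{ rewrite <- Cmod2_conj, Cmod_expi. f_equal; ring. }
replace (/ r * (r * r - Cconj (x - z) * (z + r * expi t - z)))%C
  with (expi t * (Cconj (z + r * expi t - x)))%C.
- rewrite !Cmod_mult, IH, Cmod_conj, Cmod_expi. ring.
- rewrite !Cminus_conj, Cplus_conj, Cmult_conj.
  assert (eR : Cconj r = r) by (unfold Cconj, RtoC; simpl; f_equal; ring).
  rewrite eR.
  transitivity (r * (expi t * Cconj (expi t)) - (Cconj x - Cconj z) * expi t)%C; [ring|].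
  rewrite hu. field. trivial.
Qed.

Lemma Cmod_zprod z l : Cmod (zprod z l) = lprod (fun x => Cmod (z - x)) l.
Proof. induction l; simpl; [apply Cmod_1|]. now rewrite Cmod_mult, IHl. Qed.

(* Dividing by the Blaschke product of the zeros does not change the modulus on
   the circle. *)
Lemma jensen_zeros (P : C -> C) (z : C) (r X Y : R) (l : list R) :
  is_poly P -> 0 < r -> 0 <= Y -> NoDup l ->
  (forall x, In x l -> P (RtoC x) = 0%C) ->
  (forall t, Cmod (P (z + r * expi t)%C) <= exp (X + Y * Rabs (sin t))) ->
  Cmod (P z) <= exp (X + Y * (2 / PI)) * lprod (fun x => Cmod (z - x) / r) l.
Proof.
intros hP hR hY hl hz hb.
destruct (divide_zeros l P hP hl hz) as [Q [hQ eQ]].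
assert (h : Cmod (reflected_prod z r l z * Q z) <= exp (X + Y * (2 / PI))).
{ apply (jensen_circle (fun w => reflected_prod z r l w * Q w)%C z r X Y); trivial.
  - apply poly_mul; trivial. apply reflected_prod_poly.
  - intros t. rewrite Cmod_mult, reflected_prod_circle, <- Cmod_mult, <- eQ by trivial. apply hb. }
rewrite reflected_prod_center, Cmod_mult, Cmod_R in h by trivial.
assert (hRn : 0 < r ^ length l) by now apply pow_lt.
rewrite Rabs_pos_eq in h by lra.
rewrite eQ, Cmod_mult, Cmod_zprod.
assert (e : lprod (fun x => Cmod (z - x)) l = r ^ length l * lprod (fun x => Cmod (z - x) / r) l).
{ clear -hR. induction l; simpl; [ring|]. rewrite IHl. field; lra. }
rewrite e.
assert (hp : 0 <= lprod (fun x => Cmod (z - x) / r) l).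
{ clear -hR. induction l; simpl; [lra|]. apply Rmult_le_pos; trivial.
  apply Rdiv_le_0_compat; trivial. apply Cmod_ge_0. }
replace (r ^ length l * lprod (fun x => Cmod (z - x) / r) l * Cmod (Q z))
  with (r ^ length l * Cmod (Q z) * lprod (fun x => Cmod (z - x) / r) l) by ring.
now apply Rmult_le_compat_r.
Qed.

(** * Decay near an excess of zeros *)

Lemma exp_pow (x : R) (n : nat) : exp x ^ n = exp (INR n * x).
Proof.
induction n; [simpl; now rewrite Rmult_0_l, exp_0|].
rewrite S_INR, <- tech_pow_Rmult, IHn, <- exp_plus. f_equal; ring.
Qed.

(** A weak form of Stirling's formula, by induction from [(n / (n + 1)) ^ (n + 1) <= exp (-1)]. *)
Lemma fact_bound (k : nat) : (1 <= k)%nat ->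
  INR (fact k) <= INR k ^ (k + 1) * exp (1 - INR k).
Proof.
induction k as [|k IH]; intros hk; [lia|].
destruct k as [|k]; [simpl; replace (1 - 1) with 0 by ring; rewrite exp_0; lra|].
specialize (IH ltac:(lia)). set (n := S k) in *.
assert (hn : 0 < INR n) by (apply lt_0_INR; lia). clearbody n.
rewrite fact_simpl, mult_INR, S_INR.
assert (h : (INR n / (INR n + 1)) ^ (n + 1) <= exp (-1)).
{ replace (-1) with (INR (n + 1) * (- / (INR n + 1))).
  - rewrite <- exp_pow. apply pow_incr. split; [apply Rdiv_le_0_compat; lra|].
    apply Rle_trans with (2 := exp_ineq1_le _). right; field; lra.
  - rewrite plus_INR; simpl. field; lra. }
apply Rle_trans with ((INR n + 1) * (INR n ^ (n + 1) * exp (1 - INR n))).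
{ apply Rmult_le_compat_l; lra. }
replace (S n + 1)%nat with (S (n + 1)) by lia. rewrite <- tech_pow_Rmult, Rmult_assoc.
apply Rmult_le_compat_l; [lra|].
replace (1 - (INR n + 1)) with (-1 + (1 - INR n)) by ring. rewrite exp_plus, <- Rmult_assoc.
apply Rmult_le_compat_r; [apply Rlt_le, exp_pos|].
replace (INR n) with ((INR n + 1) * (INR n / (INR n + 1))) at 1 by (field; lra).
rewrite Rpow_mult_distr. apply Rmult_le_compat_l; trivial. apply pow_le; lra.
Qed.

Fixpoint rprod (f : nat -> R) (n : nat) : R :=
  match n with O => 1 | S n => rprod f n * f n end.

Lemma rprod_cells (K : R) (n : nat) : 0 < K ->
  rprod (fun i => (INR i + 2) / K) n = INR (fact (n + 1)) / K ^ n.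
Proof.
intros hK; induction n; [simpl; field|].
replace (S n + 1)%nat with (S (n + 1)) by lia.
rewrite fact_simpl, mult_INR, S_INR, plus_INR. simpl rprod. rewrite IHn, <- tech_pow_Rmult.
simpl INR. assert (K ^ n <> 0) by (apply pow_nonzero; lra). field; split; trivial; lra.
Qed.

(** The product is [k! / k ^ (k - 1)], that is [exp (- k)] up to a power of [k]. It discretises the
    integral of [log t] over [[0, 1]], the contribution of evenly spread zeros in Jensen's
    formula. *)
Lemma cells_product_small (e : R) : 0 < e -> exists k, (2 <= k)%nat /\
  0 <= rprod (fun i => (INR i + 2) / INR k) (k - 1) <= exp (- (INR k * (1 - e))).
Proof.
intros he. destruct (archimed_cor1 (e / 5)) as [j [h1 h2]]; [lra|].
set (i := S j).
assert (hi : 0 < INR i) by (apply lt_0_INR; unfold i; lia).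
(* A square, so that the surplus factor [k ^ 2 = i ^ 4] is at most [exp (4 * (i - 1))], while the
   allowance [e * k] is at least [5 * i]. *)
exists (i * i)%nat. split; [unfold i; nia|].
assert (hk : (1 <= i * i)%nat) by (unfold i; nia).
assert (hK : 0 < INR (i * i)) by (apply lt_0_INR; lia).
rewrite rprod_cells by trivial.
replace (i * i - 1 + 1)%nat with (i * i)%nat by lia.
assert (hp : 0 < INR (i * i) ^ (i * i - 1)) by now apply pow_lt.
split; [apply Rdiv_le_0_compat; trivial; apply pos_INR|].
apply Rmult_le_reg_r with (INR (i * i) ^ (i * i - 1)); trivial.
unfold Rdiv. rewrite Rmult_assoc, Rinv_l, Rmult_1_r by lra.
apply Rle_trans with (1 := fact_bound _ hk).
replace (i * i + 1)%nat with ((i * i - 1) + 2)%nat by lia.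
rewrite pow_add, Rmult_assoc, (Rmult_comm (exp _)). apply Rmult_le_compat_l; [lra|].
rewrite mult_INR.
assert (hl : INR i <= exp (INR i - 1)) by (assert (h := exp_ineq1_le (INR i - 1)); lra).
apply Rle_trans with (exp (INR i - 1) ^ 4 * exp (1 - INR i * INR i)).
- apply Rmult_le_compat_r; [apply Rlt_le, exp_pos|].
  replace ((INR i * INR i) ^ 2) with (INR i ^ 4) by ring. apply pow_incr; lra.
- rewrite exp_pow, <- exp_plus. apply exp_le_compat. simpl (INR 4).
  assert (h5 : 5 <= e * INR i).
  { assert (hj : 0 < INR j) by now apply lt_0_INR.
    assert (h : 1 < e / 5 * INR j).
    { apply (Rmult_lt_compat_r (INR j)) in h1; trivial. rewrite Rinv_l in h1; lra. }
    unfold i; rewrite S_INR. lra. }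
   nra.
Qed.

Fixpoint fconcat (L : nat -> list R) (n : nat) : list R :=
  match n with O => nil | S n => fconcat L n ++ L n end.

Lemma in_fconcat L n x : In x (fconcat L n) -> exists i, (i < n)%nat /\ In x (L i).
Proof.
induction n; simpl; [contradiction|]. intros h. apply in_app_or in h. destruct h as [h|h].
- destruct (IHn h) as [i [hi h']]. exists i; split; trivial; lia.
- exists n; split; trivial; lia.
Qed.

Lemma NoDup_fconcat (L : nat -> list R) (key : R -> R) (u : nat -> R) n :
  (forall i j, (i <= j)%nat -> u i <= u j) ->
  (forall i, (i < n)%nat -> NoDup (L i)) ->
  (forall i x, (i < n)%nat -> In x (L i) -> u i < key x < u (S i)) ->
  NoDup (fconcat L n).
Proof.
intros hu. induction n; intros h1 h2; simpl; [constructor|].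
apply NoDup_app; [apply IHn; auto| auto |].
intros x hx hx'. apply in_fconcat in hx. destruct hx as [i [hi hx]].
assert (a := h2 i x ltac:(lia) hx). assert (b := h2 n x ltac:(lia) hx').
assert (c := hu (S i) n ltac:(lia)). lra.
Qed.

Lemma lprod_app f l l' : lprod f (l ++ l') = lprod f l * lprod f l'.
Proof. induction l; simpl; [ring|]. rewrite IHl; ring. Qed.

Lemma lprod_bounds (f : R -> R) (c : R) (q : nat) (l : list R) : c <= 1 ->
  (forall x, In x l -> 0 <= f x <= c) -> (q <= length l)%nat ->
  0 <= lprod f l <= c ^ q.
Proof.
intros hc. revert q. induction l as [|x l IH]; intros q hf hq; simpl in *.
- replace q with O by lia. simpl; lra.
- assert (hx := hf x (or_introl eq_refl)).
  destruct q as [|q].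
  + destruct (IH O ltac:(auto) ltac:(lia)) as [h1 h2]. simpl in *. nra.
  + destruct (IH q ltac:(auto) ltac:(lia)) as [h1 h2]. split; [nra|].
    simpl. apply Rmult_le_compat; lra.
Qed.

Lemma lprod_fconcat (f : R -> R) (L : nat -> list R) (c : nat -> R) (q n : nat) :
  (forall i, (i < n)%nat -> c i <= 1) ->
  (forall i x, (i < n)%nat -> In x (L i) -> 0 <= f x <= c i) ->
  (forall i, (i < n)%nat -> (q <= length (L i))%nat) ->
  0 <= lprod f (fconcat L n) <= rprod c n ^ q.
Proof.
induction n; intros hc hf hq; simpl.
- rewrite pow1; lra.
- rewrite lprod_app, Rpow_mult_distr.
  destruct (lprod_bounds f (c n) q (L n)) as [a1 a2]; auto.
  destruct IHn as [b1 b2]; auto.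
  split; [now apply Rmult_le_pos|]. apply Rmult_le_compat; trivial.
Qed.

(* [s = 1] for the cells to the right of [tau], [s = -1] for those to its left. *)
Definition cell_zeros (P : C -> C) (tau h s : R) (n q : nat) (L : nat -> list R) : Prop :=
  forall i, (i < n)%nat -> NoDup (L i) /\ (q <= length (L i))%nat /\
    forall x, In x (L i) -> P (RtoC x) = 0%C /\ INR i * h < s * (x - tau) < INR (S i) * h.

(* The zeros have density [g], while the growth [B <= PI * b] only allows the
   density [b]. *)
Lemma local_decay (b g : R) : 0 <= b -> b < g <= 1 -> exists k, (2 <= k)%nat /\
  forall (P : C -> C) (m B eta tau r : R) (q : nat) (Lr Ll : nat -> list R),
  is_poly P -> 0 < m -> 0 <= B <= PI * b -> 0 < r ->
  (forall z, Cmod (z - tau) <= 2 * r -> Cmod (P z) <= exp (m * (B * Rabs (Im z) + eta))) ->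
  cell_zeros P tau (r / INR k) 1 (k - 1) q Lr ->
  cell_zeros P tau (r / INR k) (-1) (k - 1) q Ll ->
  m * (r / INR k) * g <= INR q ->
  forall z, Cmod (z - tau) <= r / INR k ->
    Cmod (P z) <= exp (m * (B * Rabs (Im z) + eta - r * (g - b))).
Proof.
(* The zeros yield [2 * g * (1 - e)] against a growth of [2 * b]. The loss [2 * g * e = g * (g - b)]
   is at most [g - b], half of the ideal gain [2 * (g - b)]. *)
intros hb hg. set (e := (g - b) / 2).
destruct (cells_product_small e) as [k [hk [hk0 hk1]]]; [unfold e; lra|].
exists k; split; trivial.
intros P m B eta tau r q Lr Ll hP hm hB hr hbound hLr hLl hq z hz.
assert (hK : 0 < INR k) by (apply lt_0_INR; lia).
set (h := r / INR k) in *.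
assert (hh : 0 < h) by now apply Rdiv_lt_0_compat.
assert (hrh : r = INR k * h) by (unfold h; field; lra).
assert (hpi := PI_RGT_0).
set (l := fconcat Lr (k - 1) ++ fconcat Ll (k - 1)).
assert (mono : forall i j, (i <= j)%nat -> INR i * h <= INR j * h).
{ intros i j hij. apply Rmult_le_compat_r; [lra|now apply le_INR]. }
assert (hl : NoDup l).
{ apply NoDup_app.
  - apply (NoDup_fconcat Lr (fun x => 1 * (x - tau)) (fun i => INR i * h)); trivial.
    + intros i hi; apply hLr; trivial.
    + intros i x hi hx; now apply hLr.
  - apply (NoDup_fconcat Ll (fun x => -1 * (x - tau)) (fun i => INR i * h)); trivial.
    + intros i hi; apply hLl; trivial.
    + intros i x hi hx; now apply hLl.
  - intros x h1 h2. apply in_fconcat in h1. apply in_fconcat in h2.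
    destruct h1 as [i [hi h1]], h2 as [j [hj h2]].
    destruct (hLr i hi) as [_ [_ a]]. destruct (a x h1) as [_ a'].
    destruct (hLl j hj) as [_ [_ c]]. destruct (c x h2) as [_ c'].
    assert (u := mono O i ltac:(lia)). assert (v := mono O j ltac:(lia)). simpl in u, v. lra. }
assert (hzero : forall x, In x l -> P (RtoC x) = 0%C).
{ intros x hx. apply in_app_or in hx. destruct hx as [hx|hx]; apply in_fconcat in hx;
  destruct hx as [i [hi hx]]; [destruct (hLr i hi) as [_ [_ a]]|destruct (hLl i hi) as [_ [_ a]]];
  now destruct (a x hx). }
assert (hjz := jensen_zeros P z r (m * (B * Rabs (Im z) + eta)) (m * B * r) l hP hr).
assert (hmB : 0 <= m * B * r) by (apply Rmult_le_pos; [apply Rmult_le_pos|]; lra).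
specialize (hjz hmB hl hzero).
assert (hcirc : forall t, Cmod (P (z + r * expi t)%C) <=
   exp (m * (B * Rabs (Im z) + eta) + m * B * r * Rabs (sin t))).
{ intros t. eapply Rle_trans; [apply hbound|].
  - replace (z + r * expi t - tau)%C with ((z - tau) + r * expi t)%C by ring.
    apply Rle_trans with (1 := Cmod_triangle _ _).
    rewrite Cmod_mult, Cmod_expi, Cmod_R, Rabs_pos_eq by lra.
    assert (h <= r). { rewrite hrh. assert (1 <= INR k) by (apply (le_INR 1); lia). nra. }
    lra.
  - apply exp_le_compat.
    replace (m * (B * Rabs (Im z) + eta) + m * B * r * Rabs (sin t))
      with (m * (B * (Rabs (Im z) + r * Rabs (sin t)) + eta)) by ring.
    apply Rmult_le_compat_l; [lra|]. apply Rplus_le_compat_r, Rmult_le_compat_l; [lra|].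
    replace (Im (z + r * expi t)) with (Im z + r * sin t) by (unfold Im; simpl; ring).
    apply Rle_trans with (1 := Rabs_triang _ _). rewrite Rabs_mult, (Rabs_pos_eq r) by lra. lra. }
specialize (hjz hcirc).
apply Rle_trans with (1 := hjz).
set (f := fun x : R => Cmod (z - x) / r) in *.
(* A zero in cell [i] is within [(i + 1) * h] of [tau], and [z] within [h], whence the factor
   [(i + 2) / k]. Stopping after [k - 1] cells keeps these factors at most 1, so zeros beyond the
   first [q] of a cell do no harm. *)
assert (hdist : forall s L, Rabs s = 1 -> cell_zeros P tau h s (k - 1) q L ->
  0 <= lprod f (fconcat L (k - 1)) <= rprod (fun i => (INR i + 2) / INR k) (k - 1) ^ q).
{ intros s L hs hL. apply lprod_fconcat.
  - intros i hi. apply Rmult_le_reg_r with (INR k); trivial.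
    unfold Rdiv; rewrite Rmult_assoc, Rinv_l, Rmult_1_r, Rmult_1_l by lra.
    replace 2 with (INR 2) by (simpl; ring). rewrite <- plus_INR. apply le_INR; lia.
  - intros i x hi hx. destruct (hL i hi) as [_ [_ a]]. destruct (a x hx) as [_ a'].
    unfold f. split; [apply Rdiv_le_0_compat; trivial; apply Cmod_ge_0|].
    apply Rmult_le_reg_r with r; trivial.
    unfold Rdiv at 1; rewrite Rmult_assoc, Rinv_l, Rmult_1_r by lra.
    replace (z - x)%C with ((z - tau) + (tau - x)%R)%C by (apply injective_projections; simpl; ring).
    apply Rle_trans with (1 := Cmod_triangle _ _). rewrite Cmod_R.
    assert (hx' : Rabs (tau - x) <= (INR i + 1) * h).
    { rewrite S_INR in a'. replace (Rabs (tau - x)) with (Rabs (s * (tau - x))) by (rewrite Rabs_mult, hs; ring).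
      assert (v := mono O i ltac:(lia)). simpl in v.
      replace (s * (tau - x)) with (- (s * (x - tau))) by ring. rewrite Rabs_Ropp, Rabs_pos_eq; lra. }
    replace ((INR i + 2) / INR k * r) with ((INR i + 2) * h) by (rewrite hrh; field; lra). lra.
  - intros i hi. now destruct (hL i hi) as [_ [a _]]. }
assert (hd1 := hdist 1 Lr ltac:(rewrite Rabs_pos_eq; lra) hLr).
assert (hd2 := hdist (-1) Ll ltac:(rewrite Rabs_left; lra) hLl).
unfold l. rewrite lprod_app.
assert (hpq : rprod (fun i => (INR i + 2) / INR k) (k - 1) ^ q <= exp (- (INR k * (1 - e))) ^ q).
{ apply pow_incr; now split. }
rewrite exp_pow in hpq. set (E := exp (INR q * - (INR k * (1 - e)))) in *.
apply Rle_trans with (exp (m * (B * Rabs (Im z) + eta) + m * B * r * (2 / PI)) * (E * E)).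
{ apply Rmult_le_compat_l; [apply Rlt_le, exp_pos|]. apply Rmult_le_compat; lra. }
unfold E. rewrite <- !exp_plus. apply exp_le_compat.
assert (he : 0 < e <= 1 / 2) by (unfold e; lra).
assert (hqk : m * r * g * (1 - e) <= INR q * (INR k * (1 - e))).
{ rewrite <- Rmult_assoc. apply Rmult_le_compat_r; [lra|].
  apply (Rmult_le_compat_r (INR k)) in hq; [|lra].
  replace (m * r * g) with (m * h * g * INR k) by (rewrite hrh; ring). trivial. }
assert (hBb : B * (2 / PI) <= 2 * b).
{ replace (2 * b) with (PI * b * (2 / PI)) by (field; lra).
  apply Rmult_le_compat_r; [apply Rdiv_le_0_compat; lra|lra]. }
assert (hmr : 0 < m * r) by now apply Rmult_lt_0_compat.
assert (hBb' : m * B * r * (2 / PI) <= m * r * (2 * b)).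
{ replace (m * B * r * (2 / PI)) with (m * r * (B * (2 / PI))) by ring. apply Rmult_le_compat_l; lra. }
assert (hfin : m * r * (2 * b) - 2 * (m * r * g * (1 - e)) <= m * - (r * (g - b))).
{ replace (m * - (r * (g - b))) with (m * r * (- (g - b))) by ring.
  replace (m * r * (2 * b) - 2 * (m * r * g * (1 - e))) with (m * r * (2 * b - 2 * (g * (1 - e)))) by ring.
  apply Rmult_le_compat_l; [lra|].
   unfold e in *. nra. }
lra.
Qed.

(** * The half-plane barrier *)

Lemma Im_inv (w : C) : w <> 0%C -> Im (/ w) = - (Im w / Cmod w ^ 2).
Proof.
intros hw. rewrite Cmod2_alt.
assert (h : fst w ^ 2 + snd w ^ 2 <> 0).
{ intros h. apply hw. destruct w as [x y]. simpl in h. unfold RtoC. f_equal; nra. }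
unfold Im, Re, Cinv; simpl in *. field. intros h'; apply h; lra.
Qed.

(** The four inverses sum to [4 * w ^ 3 / (w ^ 4 - rho ^ 4)], which differs from [4 / w] by a term
    of order [rho ^ 4]. The imaginary part expresses that the barrier is harmonic. *)
Lemma four_inverse (w : C) : w <> 0%C -> exists A d, 0 <= A /\ 0 < d /\
  forall rho, 0 < rho < d ->
    Cmod (/ (rho + w) + / (Ci * rho + w) + / ((-1) * rho + w) + / (- Ci * rho + w) - 4 / w)
      <= A * rho ^ 3.
Proof.
intros hw. assert (hm := proj1 (Cmod_gt_0 w) hw). set (c := Cmod w) in *.
assert (hc5 : 0 < c ^ 5) by now apply pow_lt.
exists (8 / c ^ 5), (Rmin 1 (c / 2)). split; [apply Rdiv_le_0_compat; lra|].
split; [apply Rmin_glb_lt; lra|]. intros rho [r0 r1].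
assert (r2 : rho < 1) by apply Rlt_le_trans with (1 := r1), Rmin_l.
assert (r3 : rho < c / 2) by apply Rlt_le_trans with (1 := r1), Rmin_r.
assert (nz : forall u, Cmod u = 1 -> (u * rho + w)%C <> 0%C).
{ intros u hu h. assert (e : w = (- (u * rho))%C).
  { replace w with ((u * rho + w) - u * rho)%C by ring. rewrite h; ring. }
  apply (f_equal Cmod) in e. rewrite Cmod_opp, Cmod_mult, hu, Cmod_R, Rabs_pos_eq in e by lra.
  fold c in e. lra. }
assert (n1 := nz 1%C Cmod_1). replace (1 * rho + w)%C with (rho + w)%C in n1 by ring.
assert (n2 := nz Ci Cmod_Ci).
assert (n3 : ((-1) * rho + w)%C <> 0%C) by (apply nz; rewrite Cmod_R, Rabs_left; lra).
assert (n4 : (- Ci * rho + w)%C <> 0%C) by (apply nz; rewrite Cmod_opp; apply Cmod_Ci).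
assert (hi : (Ci * Ci = -1)%C) by (unfold Ci, Cmult, RtoC; simpl; f_equal; ring).
set (D := (w * w * w * w - rho * rho * rho * rho)%C).
assert (eD : D = ((rho + w) * (Ci * rho + w) * ((-1) * rho + w) * (- Ci * rho + w))%C).
{ unfold D. transitivity ((w * w - rho * rho) * (w * w - (Ci * Ci) * rho * rho))%C.
  - rewrite hi; ring.
  - ring. }
assert (nD : D <> 0%C).
{ rewrite eD. repeat apply Cmult_neq_0; trivial. }
match goal with |- Cmod ?x <= _ => replace x with (4 * (rho * rho * rho * rho) / (w * D))%C end.
2:{ assert (e1 : (/ (rho + w) + / ((-1) * rho + w) = 2 * w / (w * w - rho * rho))%C).
    { field. repeat split; trivial.
      replace (w * w - rho * rho)%C with ((rho + w) * ((-1) * rho + w))%C by ring.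
      now apply Cmult_neq_0. }
    assert (e2 : (/ (Ci * rho + w) + / (- Ci * rho + w) = 2 * w / (w * w + rho * rho))%C).
    { assert (ee : (w * w + rho * rho)%C = ((Ci * rho + w) * (- Ci * rho + w))%C).
      { transitivity (w * w - (Ci * Ci) * rho * rho)%C; [rewrite hi; ring|ring]. }
      rewrite ee. field. split; trivial. }
    assert (f1 : (w * w - rho * rho)%C <> 0%C).
    { replace (w * w - rho * rho)%C with ((rho + w) * ((-1) * rho + w))%C by ring. now apply Cmult_neq_0. }
    assert (f2 : (w * w + rho * rho)%C <> 0%C).
    { intros h. apply nD. unfold D. replace (w * w * w * w - rho * rho * rho * rho)%C
        with ((w * w + rho * rho) * (w * w - rho * rho))%C by ring. rewrite h; ring. }
    transitivity ((/ (rho + w) + / ((-1) * rho + w)) + (/ (Ci * rho + w) + / (- Ci * rho + w)) - 4 / w)%C; [|ring].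
    rewrite e1, e2. unfold D in *. field. repeat split; trivial. }
rewrite Cmod_div by now apply Cmult_neq_0.
rewrite !Cmod_mult, !Cmod_R, (Rabs_pos_eq rho), (Rabs_pos_eq 4) by lra. fold c.
assert (hD : c ^ 4 / 2 <= Cmod D).
{ assert (h := Cmod_triangle_inv (w * w * w * w) (rho * rho * rho * rho)). fold D in h.
  rewrite !Cmod_mult, Cmod_R, Rabs_pos_eq in h by lra. fold c in h.
  assert (rho ^ 4 <= (c / 2) ^ 4) by (apply pow_incr; lra).
   simpl in *. nra. }
apply Rle_trans with (4 * rho ^ 3 / (c * (c ^ 4 / 2))).
- unfold Rdiv. apply Rmult_le_compat.
  + apply Rmult_le_pos; [lra|]. repeat apply Rmult_le_pos; lra.
  + apply Rlt_le, Rinv_0_lt_compat, Rmult_lt_0_compat; trivial. now apply Cmod_gt_0.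
  + apply Rmult_le_compat_l; [lra|].
    replace (rho * rho * rho * rho) with (rho ^ 3 * rho) by ring.
    rewrite <- (Rmult_1_r (rho ^ 3)) at 2. apply Rmult_le_compat_l; [apply pow_le; lra|lra].
  + apply Rinv_le_contravar.
    * apply Rmult_lt_0_compat; trivial. assert (0 < c ^ 4) by now apply pow_lt. lra.
    * apply Rmult_le_compat_l; trivial. lra.
- right. field. lra.
Qed.

Definition real_symmetric (P : C -> C) : Prop := forall z, P (Cconj z) = Cconj (P z).

(* On the upper half disc minus the small disc, [log |P|] is compared with the
   harmonic function [y -> m ((B + A) y - kappa y / |z - tau|^2)]. *)
Lemma barrier_upper (P : C -> C) (m B eta rho tau sigma c : R) :
  is_poly P -> 0 < m -> 0 <= B -> 0 < sigma <= tau / 4 -> 8 * tau <= rho -> 0 < c ->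
  (forall z, Cmod z <= rho -> Cmod (P z) <= exp (m * (B * Rabs (Im z) + eta))) ->
  (forall z, Cmod (z - tau) <= sigma ->
     Cmod (P z) <= exp (m * (B * Rabs (Im z) + eta - c))) ->
  forall z, Cmod z <= tau / 2 -> 0 <= Im z ->
    Cmod (P z) <= exp (m * ((B - c * sigma / (8 * tau ^ 2)) * Im z + eta)).
Proof.
intros hP hm hB hs ht hc hb hdec.
(* Both constants come from the boundary. On [|z - tau| = sigma] one has [y <= sigma], so
   [kappa * y / sigma ^ 2 <= c], the decay available there. On [|z| = rho] one has
   [|z - tau| >= rho / 2], so the barrier is at most [A * y], which the slope [B + A] absorbs. *)
set (kappa := c * sigma). assert (hk : 0 < kappa) by now apply Rmult_lt_0_compat.
set (A := 4 * kappa / rho ^ 2).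
 assert (hrho : 0 < rho) by lra.
assert (hrho2 : 0 < rho ^ 2) by now apply pow_lt.
assert (hA : 0 < A) by (apply Rdiv_lt_0_compat; lra).
set (K := fun z : C => Cmod z <= rho /\ 0 <= Im z /\ sigma <= Cmod (z - tau)).
set (H := fun z : C => m * (- (B + A) * Im z - kappa * Im (/ (z - tau)))).
assert (nz : forall z, K z -> (z - tau)%C <> 0%C).
{ intros z [_ [_ h]] e. rewrite e, Cmod_0 in h. lra. }
assert (eH : forall z, K z -> H z = m * (- (B + A) * Im z + kappa * (Im z / Cmod (z - tau) ^ 2))).
{ intros z kz. unfold H. rewrite Im_inv by now apply nz.
  replace (Im (z - tau)) with (Im z) by (unfold Im; simpl; ring). ring. }
assert (lip : forall z w, Rabs (Im w - Im z) <= Cmod (w - z)).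
{ intros z w. replace (Im w - Im z) with (Im (w - z)) by (unfold Im; simpl; ring). apply im_le_Cmod. }
assert (MP : forall z, K z -> Cmod (P z) * exp (H z) <= exp (m * eta)).
{ apply (max_principle K rho P H); trivial.
  - apply exp_pos.
  - intros z kz; apply kz.
  - intros z nk. destruct (Rle_dec (Cmod z) rho) as [h1|h1].
    + destruct (Rle_dec 0 (Im z)) as [h2|h2].
      * assert (h3 : Cmod (z - tau) < sigma) by (apply Rnot_le_lt; intros h3; apply nk; repeat split; trivial).
        exists (sigma - Cmod (z - tau)); split; [lra|]. intros w hw [_ [_ k]].
        assert (h := Cmod_triangle (w - z) (z - tau)).
        replace (w - z + (z - tau))%C with (w - tau)%C in h by ring. lra.
      * exists (- Im z); split; [lra|]. intros w hw [_ [k _]].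
        assert (h := lip z w). apply Rabs_le_between in h. lra.
    + exists (Cmod z - rho); split; [lra|]. intros w hw [k _].
      assert (h := Cmod_triangle_inv z w). replace (z - w)%C with (- (w - z))%C in h by ring.
      rewrite Cmod_opp in h. lra.
  - intros z kz e he.
    set (N := m * ((B + A) + kappa / sigma ^ 2) + 1).
    assert (hs2 : 0 < sigma ^ 2) by (apply pow_lt; lra).
    assert (hks : 0 < kappa / sigma ^ 2) by (apply Rdiv_lt_0_compat; lra).
    assert (hN : 0 < m * ((B + A) + kappa / sigma ^ 2)) by (apply Rmult_lt_0_compat; lra).
    exists (e / N). split; [apply Rdiv_lt_0_compat; unfold N; lra|].
    intros w kw hw.
    assert (d1 : Rabs (Im w - Im z) <= Cmod (w - z)) by apply lip.
    assert (d2 : Rabs (Im (/ (w - tau)) - Im (/ (z - tau))) <= Cmod (w - z) / sigma ^ 2).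
    { replace (Im (/ (w - tau)) - Im (/ (z - tau))) with (Im (/ (w - tau) - / (z - tau))) by (unfold Im; simpl; ring).
      apply Rle_trans with (1 := im_le_Cmod _).
      assert (nw := nz w kw). assert (nzz := nz z kz).
      replace (/ (w - tau) - / (z - tau))%C with (- (w - z) / ((w - tau) * (z - tau)))%C by (field; split; trivial).
      rewrite Cmod_div by now apply Cmult_neq_0.
      rewrite Cmod_opp, Cmod_mult. apply Rmult_le_compat_l; [apply Cmod_ge_0|].
      apply Rinv_le_contravar; trivial. destruct kw as [_ [_ kw]], kz as [_ [_ kz]].
      simpl. rewrite Rmult_1_r. apply Rmult_le_compat; lra. }
    apply Rabs_le_between in d1. apply Rabs_le_between in d2. unfold H.
    assert (hw' : N * Cmod (w - z) < e).
    { apply (Rmult_lt_compat_l N) in hw; [|unfold N; lra].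
      replace (N * (e / N)) with e in hw by (field; unfold N; lra). trivial. }
    apply Rle_lt_trans with (m * (- (B + A) * Im z - kappa * Im (/ (z - tau))) + N * Cmod (w - z)); [|lra].
    assert (q1 : - (B + A) * Im w <= - (B + A) * Im z + (B + A) * Cmod (w - z)) by nra.
    assert (q2 : - kappa * Im (/ (w - tau)) <= - kappa * Im (/ (z - tau)) + kappa / sigma ^ 2 * Cmod (w - z)).
    { replace (kappa / sigma ^ 2 * Cmod (w - z)) with (kappa * (Cmod (w - z) / sigma ^ 2)) by (field; lra). nra. }
    unfold N. nra.
  - intros z kz. assert (kz' := kz). destruct kz' as [k1 [k2 k3]].
    destruct (Rle_lt_or_eq_dec _ _ k2) as [l2|l2].
    2:{ left. rewrite eH, <- l2 by trivial. unfold Rdiv. rewrite !Rmult_0_l, !Rmult_0_r, Rplus_0_r, Rmult_0_r, exp_0, Rmult_1_r.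
        apply Rle_trans with (1 := hb z k1). rewrite <- l2, Rabs_R0. apply exp_le_compat. right; ring. }
    assert (hPz : Cmod (P z) <= exp (m * (B * Im z + eta))).
    { rewrite <- (Rabs_pos_eq (Im z)) by lra. now apply hb. }
    destruct (Rle_lt_or_eq_dec _ _ k1) as [l1|l1].
    2:{ left. apply Rle_trans with (exp (m * (B * Im z + eta)) * exp (H z)).
        - apply Rmult_le_compat_r; trivial. apply Rlt_le, exp_pos.
        - rewrite <- exp_plus. apply exp_le_compat. rewrite eH by trivial.
          assert (hd : rho / 2 <= Cmod (z - tau)).
          { assert (h := Cmod_triangle_inv z tau). rewrite Cmod_R, Rabs_pos_eq in h; lra. }
          assert (hq : Im z / Cmod (z - tau) ^ 2 <= Im z / (rho / 2) ^ 2).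
          { apply Rmult_le_compat_l; [lra|]. apply Rinv_le_contravar; [apply pow_lt; lra|].
            apply pow_incr; lra. }
          assert (ee : kappa * (Im z / (rho / 2) ^ 2) = A * Im z) by (unfold A; field; lra).
          apply (Rmult_le_compat_l kappa) in hq; [|lra].
          rewrite <- Rmult_plus_distr_l. apply Rmult_le_compat_l; lra. }
    destruct (Rle_lt_or_eq_dec _ _ k3) as [l3|l3].
    2:{ left. apply Rle_trans with (exp (m * (B * Im z + eta - c)) * exp (H z)).
        - apply Rmult_le_compat_r; [apply Rlt_le, exp_pos|].
          rewrite <- (Rabs_pos_eq (Im z)) by lra. apply hdec; lra.
        - rewrite <- exp_plus. apply exp_le_compat. rewrite eH by trivial. rewrite <- l3.
          assert (hi : Im z <= sigma).
          { assert (h := im_le_Cmod (z - tau)).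
            replace (Im (z - tau)) with (Im z) in h by (unfold Im; simpl; ring).
            rewrite Rabs_pos_eq in h; lra. }
          assert (kappa * (Im z / sigma ^ 2) <= c).
          { replace (kappa * (Im z / sigma ^ 2)) with (c * (Im z / sigma)) by (unfold kappa; field; lra).
            rewrite <- (Rmult_1_r c) at 2. apply Rmult_le_compat_l; [lra|].
            apply Rmult_le_reg_r with sigma; [lra|]. unfold Rdiv; rewrite Rmult_assoc, Rinv_l; lra. }
          rewrite <- Rmult_plus_distr_l. apply Rmult_le_compat_l; [lra|]. nra. }
    right.
    destruct (four_inverse (z - tau) (nz z kz)) as [A0 [d [hA0 [hd h4]]]].
    set (d' := Rmin (Rmin d (rho - Cmod z)) (Rmin (Im z) (Cmod (z - tau) - sigma))).
    exists (m * kappa * A0), d'. split; [apply Rmult_le_pos; trivial; apply Rmult_le_pos; lra|].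
    split; [repeat apply Rmin_glb_lt; lra|]. intros r [r0 r1].
    assert (e1 : d' <= d) by (apply Rle_trans with (1 := Rmin_l _ _), Rmin_l).
    assert (e2 : d' <= rho - Cmod z) by (apply Rle_trans with (1 := Rmin_l _ _), Rmin_r).
    assert (e3 : d' <= Im z) by (apply Rle_trans with (1 := Rmin_r _ _), Rmin_l).
    assert (e4 : d' <= Cmod (z - tau) - sigma) by (apply Rle_trans with (1 := Rmin_r _ _), Rmin_r).
    assert (near : forall w, Cmod (w - z) = r -> K w).
    { intros w hw. repeat split.
      - assert (h := Cmod_triangle_inv w z). lra.
      - assert (h := lip z w). apply Rabs_le_between in h. lra.
      - assert (h := Cmod_triangle_inv (z - tau) (z - w)).
        replace (z - tau - (z - w))%C with (w - tau)%C in h by ring.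
        replace (z - w)%C with (- (w - z))%C in h by ring. rewrite Cmod_opp in h. lra. }
    assert (nearu : forall u, Cmod u = 1 -> K (u * r + z)%C).
    { intros u hu. apply near. replace (u * r + z - z)%C with (u * r)%C by ring.
      rewrite Cmod_mult, hu, Cmod_R, Rabs_pos_eq; lra. }
    split.
    + split; [|split; [apply nearu, Cmod_Ci|split; apply nearu]].
      * replace (r + z)%C with (1 * r + z)%C by ring. apply nearu, Cmod_1.
      * rewrite Cmod_R, Rabs_left; lra.
      * rewrite Cmod_opp; apply Cmod_Ci.
    + specialize (h4 r ltac:(lra)). unfold H.
      match type of h4 with Cmod ?x <= _ => assert (hi := im_le_Cmod x) end.
      apply Rle_trans with (2 := h4) in hi. apply Rabs_le_between in hi. clear h4.
      replace (r + z - tau)%C with (r + (z - tau))%C by ring.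
      replace (Ci * r + z - tau)%C with (Ci * r + (z - tau))%C by ring.
      replace ((-1) * r + z - tau)%C with ((-1) * r + (z - tau))%C by ring.
      replace (- Ci * r + z - tau)%C with (- Ci * r + (z - tau))%C by ring.
      assert (i4 : forall w : C, Im (4 / w) = 4 * Im (/ w)) by (intros w; unfold Im, Cdiv; simpl; ring).
      assert (ip : forall x y : C, Im (x + y) = Im x + Im y) by reflexivity.
      assert (im : forall x y : C, Im (x - y) = Im x - Im y) by reflexivity.
      rewrite im, !ip, i4 in hi.
      set (I1 := Im (/ (r + (z - tau)))) in *. set (I2 := Im (/ (Ci * r + (z - tau)))) in *.
      set (I3 := Im (/ ((-1) * r + (z - tau)))) in *. set (I4 := Im (/ (- Ci * r + (z - tau)))) in *.
      set (I0 := Im (/ (z - tau))) in *.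
      replace (Im (r + z)) with (Im z) by (unfold Im; simpl; ring).
      replace (Im (Ci * r + z)) with (Im z + r) by (unfold Im; simpl; ring).
      replace (Im ((-1) * r + z)) with (Im z) by (unfold Im; simpl; ring).
      replace (Im (- Ci * r + z)) with (Im z - r) by (unfold Im; simpl; ring).
      assert (hmk : 0 < m * kappa) by now apply Rmult_lt_0_compat.
      assert (q := Rmult_le_compat_l (m * kappa) _ _ (Rlt_le _ _ hmk) (proj2 hi)).
      clear -q. nra. }
intros z hz hz0.
assert (hd1 : Cmod (z - tau) <= 2 * tau).
{ assert (h := Cmod_triangle z (- tau)). rewrite Cmod_opp, Cmod_R, Rabs_pos_eq in h by lra.
  unfold Cminus. lra. }
assert (hd2 : sigma <= Cmod (z - tau)).
{ assert (h := Cmod_triangle_inv tau z). rewrite Cmod_R, Rabs_pos_eq in h by lra.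
  replace (z - tau)%C with (- (tau - z))%C by ring. rewrite Cmod_opp. lra. }
assert (kz : K z) by (repeat split; trivial; lra).
assert (h := MP z kz). rewrite eH in h by trivial.
apply Rmult_le_reg_r with (exp (m * (- (B + A) * Im z + kappa * (Im z / Cmod (z - tau) ^ 2)))); [apply exp_pos|].
apply Rle_trans with (1 := h). rewrite <- exp_plus. apply exp_le_compat.
assert (hq : Im z / (2 * tau) ^ 2 <= Im z / Cmod (z - tau) ^ 2).
{ apply Rmult_le_compat_l; trivial. apply Rinv_le_contravar; [apply pow_lt; lra|]. apply pow_incr; lra. }
apply (Rmult_le_compat_l kappa) in hq; [|lra].
(* As [rho >= 8 * tau], the loss [A] is at most a quarter of the gain [kappa / (4 * tau ^ 2)]. Three
   quarters of the gain remain, and half of it is claimed. *)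
assert (hAb : A <= kappa / (16 * tau ^ 2)).
{ unfold A. replace (kappa / (16 * tau ^ 2)) with (4 * kappa / (8 * tau) ^ 2) by (field; lra).
  apply Rmult_le_compat_l; [lra|]. apply Rinv_le_contravar; [apply pow_lt; lra|]. apply pow_incr; lra. }
assert (e1 : kappa * (Im z / (2 * tau) ^ 2) = 4 * (kappa / (16 * tau ^ 2)) * Im z) by (field; lra).
assert (e2 : kappa / (8 * tau ^ 2) = 2 * (kappa / (16 * tau ^ 2))) by (field; lra).
rewrite <- Rmult_plus_distr_l. apply Rmult_le_compat_l; [lra|]. rewrite e2.
set (x := kappa / (16 * tau ^ 2)) in *.
 nra.
Qed.

Lemma barrier (P : C -> C) (m B eta rho tau sigma c : R) :
  is_poly P -> real_symmetric P ->
  0 < m -> 0 <= B -> 0 < sigma <= tau / 4 -> 8 * tau <= rho -> 0 < c ->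
  (forall z, Cmod z <= rho -> Cmod (P z) <= exp (m * (B * Rabs (Im z) + eta))) ->
  (forall z, Cmod (z - tau) <= sigma ->
     Cmod (P z) <= exp (m * (B * Rabs (Im z) + eta - c))) ->
  forall z, Cmod z <= tau / 2 ->
    Cmod (P z) <= exp (m * ((B - c * sigma / (8 * tau ^ 2)) * Rabs (Im z) + eta)).
Proof.
intros hP hsym hm hB hs ht hc hb hdec z hz.
destruct (Rle_dec 0 (Im z)) as [h|h].
- rewrite Rabs_pos_eq by trivial. apply (barrier_upper P m B eta rho); trivial.
- rewrite <- Cmod_conj, <- hsym. rewrite Rabs_left, <- im_conj by lra.
  apply (barrier_upper P m B eta rho); trivial.
  + now rewrite Cmod_conj.
  + rewrite im_conj; lra.
Qed.

(** * Descent on the exponential type *)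

Lemma rsum_telescope (f : nat -> R) n : rsum (fun j => f (S j) - f j) n = f n - f O.
Proof. induction n; simpl; [ring|]. rewrite IHn; ring. Qed.

Lemma rsum_ge_special (g : nat -> R) (c d : R) (n j : nat) : (j < n)%nat ->
  (forall i, (i < n)%nat -> c <= g i) -> c + d <= g j -> INR n * c + d <= rsum g n.
Proof.
induction n; intros hj hg hd; [lia|]. rewrite S_INR; simpl.
destruct (Nat.eq_dec j n) as [->|hne].
- assert (INR n * c <= rsum g n).
  { rewrite <- rsum_const. apply rsum_le. auto. }
  lra.
- assert (INR n * c + d <= rsum g n) by (apply IHn; auto; lia).
  assert (c <= g n) by auto. lra.
Qed.

Definition nonneg_nondecreasing_on (T : R) (n : R -> R) : Prop :=
  (forall x, 0 <= x <= T -> 0 <= n x) /\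
  (forall x y, 0 <= x -> x <= y -> y <= T -> n x <= n y).

(** Otherwise telescoping over [r / 2 ^ j] would give [n r >= D * r] in the limit. An octave, unlike
    [[0, r]], has distance to 0 comparable to its length, as the barrier requires. *)
Lemma small_octave (n : R -> R) (T D : R) : nonneg_nondecreasing_on T n ->
  (forall d, 0 < d -> exists r, 0 < r < d /\ n r < D * r) ->
  forall d, 0 < d <= T -> exists r, 0 < r < d /\ n r - n (r / 2) <= D * (r / 2).
Proof.
intros [n0 _] hD d hd. apply NNPP; intros hno.
assert (h : forall r, 0 < r < d -> D * (r / 2) < n r - n (r / 2)).
{ intros r hr. apply Rnot_le_lt; intros h; apply hno; exists r; now split. }
destruct (hD d (proj1 hd)) as [r [hr hn]].
assert (it : forall j, 0 < r / 2 ^ j <= r /\ D * (r - r / 2 ^ j) <= n r - n (r / 2 ^ j)).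
{ induction j as [|j [IH1 IH2]].
  - simpl. replace (r / 1) with r by field. lra.
  - assert (h2 : 0 < 2 ^ j) by (apply pow_lt; lra).
    replace (r / 2 ^ S j) with (r / 2 ^ j / 2) by (simpl; field; lra).
    assert (h' := h (r / 2 ^ j) ltac:(lra)). split; lra. }
assert (hlim : forall j, D * r - n r <= D * (r / 2 ^ j)).
{ intros j. destruct (it j) as [h1 h2]. assert (h3 := n0 (r / 2 ^ j) ltac:(lra)). lra. }
assert (hDr : 0 < D * r).
{ assert (h0 := n0 r ltac:(lra)). lra. }
destruct (pow_lt_1_zero (1 / 2) ltac:(rewrite Rabs_pos_eq; lra) ((D * r - n r) / (D * r))) as [N hN].
{ apply Rdiv_lt_0_compat; lra. }
specialize (hN N (le_n _)). rewrite Rabs_pos_eq in hN by (apply pow_le; lra).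
apply (Rmult_lt_compat_l (D * r)) in hN; trivial.
replace (D * r * ((D * r - n r) / (D * r))) with (D * r - n r) in hN by (field; repeat split; intros e; rewrite e in hDr; lra).
specialize (hlim N). assert (2 ^ N <> 0) by (apply pow_nonzero; lra).
replace (D * (r / 2 ^ N)) with (D * r * (1 / 2) ^ N) in hlim; [lra|].
unfold Rdiv at 1. rewrite Rmult_1_l, pow_inv. field; trivial.
Qed.

(* If one of the [K] cells of an interval is much steeper than average, another
   one is flatter than average; iterating can only lower the slope boundedly often. *)
Lemma flat_subinterval (n : R -> R) (T D e : R) (K : nat) : (0 < K)%nat -> 0 <= D -> 0 < e ->
  nonneg_nondecreasing_on T n ->
  exists c0, 0 < c0 /\ forall A w, 0 <= A -> 0 < w -> A + w <= T ->
    n (A + w) - n A <= D * w ->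
    exists A' w', A <= A' /\ A' + w' <= A + w /\ c0 * w <= w' /\
      forall j, (j < K)%nat ->
        n (A' + INR (S j) * (w' / INR K)) - n (A' + INR j * (w' / INR K)) <= (D + e) * (w' / INR K).
Proof.
intros hK hD he [n0 mono]. assert (hKr : 0 < INR K) by now apply lt_0_INR.
assert (hK1 : 1 <= INR K) by now apply (le_INR 1).
assert (claim : forall N A w, 0 <= A -> 0 < w -> A + w <= T -> n (A + w) - n A <= D * w ->
  n (A + w) - n A <= INR N * (e / INR K) * w ->
  exists A' w', A <= A' /\ A' + w' <= A + w /\ (/ INR K) ^ N * w <= w' /\
      forall j, (j < K)%nat ->
        n (A' + INR (S j) * (w' / INR K)) - n (A' + INR j * (w' / INR K)) <= (D + e) * (w' / INR K)).
{ induction N as [|N IH]; intros A w hA hw hT h1 h2.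
  - exists A, w. repeat split; try lra. intros j hj.
    assert (hwK : 0 < w / INR K) by now apply Rdiv_lt_0_compat.
    assert (hj1 : INR (S j) * (w / INR K) <= w).
    { replace w with (INR K * (w / INR K)) at 2 by (field; lra).
      apply Rmult_le_compat_r; [lra|]. apply le_INR; lia. }
    assert (hj0 := pos_INR j). rewrite S_INR in *.
    assert (m1 := mono A (A + INR j * (w / INR K)) ltac:(lra) ltac:(nra) ltac:(nra)).
    assert (m2 := mono (A + (INR j + 1) * (w / INR K)) (A + w) ltac:(nra) ltac:(lra) ltac:(lra)).
    simpl in h2. rewrite !Rmult_0_l in h2.
    assert (0 < (D + e) * (w / INR K)) by (apply Rmult_lt_0_compat; lra). lra.
  - set (h := w / INR K) in *.
    assert (hh : 0 < h) by now apply Rdiv_lt_0_compat.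
    assert (hwh : w = INR K * h) by (unfold h; field; lra).
    destruct (classic (forall j, (j < K)%nat ->
       n (A + INR (S j) * h) - n (A + INR j * h) <= (D + e) * h)) as [hall|hex].
    + exists A, w. repeat split; try lra; trivial.
      rewrite <- (Rmult_1_l w) at 2. apply Rmult_le_compat_r; [lra|].
      rewrite <- (pow1 (S N)). apply pow_incr. split; [apply Rlt_le, Rinv_0_lt_compat; lra|].
      rewrite <- Rinv_1. apply Rinv_le_contravar; lra.
    + set (s := (n (A + w) - n A) / w).
      assert (hs : n (A + w) - n A = s * w) by (unfold s; field; lra).
      assert (hsD : s <= D) by (apply Rmult_le_reg_r with w; lra).
      assert (hsN : s <= INR (S N) * (e / INR K)) by (apply Rmult_le_reg_r with w; lra).
      destruct (classic (exists j, (j < K)%nat /\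
         n (A + INR (S j) * h) - n (A + INR j * h) <= (s - e / INR K) * h)) as [[j [hj hjs]]|hno].
      * assert (hj0 := pos_INR j).
        assert (hj1 : INR j + 1 <= INR K) by (rewrite <- S_INR; apply le_INR; lia).
        assert (heK : 0 < e / INR K) by now apply Rdiv_lt_0_compat.
        assert (hAj : A + INR (S j) * h = A + INR j * h + h) by (rewrite S_INR; ring).
        rewrite hAj in hjs.
        assert (hjh : 0 <= INR j * h) by (apply Rmult_le_pos; lra).
        assert (hjw : INR j * h + h <= w).
        { rewrite hwh. replace (INR j * h + h) with ((INR j + 1) * h) by ring. apply Rmult_le_compat_r; lra. }
        destruct (IH (A + INR j * h) h) as [A' [w' [a1 [a2 [a3 a4]]]]]; trivial; try lra.
        -- apply Rle_trans with (1 := hjs). apply Rmult_le_compat_r; lra.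
        -- apply Rle_trans with (1 := hjs). apply Rmult_le_compat_r; [lra|]. rewrite S_INR in hsN. lra.
        -- exists A', w'. split; [lra|]. split; [lra|]. split; trivial.
           apply Rle_trans with (2 := a3). right. rewrite <- tech_pow_Rmult, hwh. generalize ((/ INR K) ^ N). intros x. field; lra.
      * exfalso. apply not_all_ex_not in hex. destruct hex as [j hj].
        apply imply_to_and in hj. destruct hj as [hj hj'].
        apply Rnot_le_lt in hj'.
        assert (hsum := rsum_telescope (fun j => n (A + INR j * h)) K).
        cbv beta in hsum. replace (A + INR 0 * h) with A in hsum by (simpl; ring).
        rewrite <- hwh, hs in hsum.
        (* If no cell is flatter than [s - e / K], the cells lose at most [e * h] together, while
           the steep cell exceeds its share by [(e + e / K) * h]. The total would be more than
           [s * w]. *)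
        assert (hlow := rsum_ge_special (fun j => n (A + INR (S j) * h) - n (A + INR j * h))
          ((s - e / INR K) * h) ((e + e / INR K) * h) K j hj).
        cbv beta in hlow. rewrite hsum in hlow.
        assert (hh2 : INR K * ((s - e / INR K) * h) + (e + e / INR K) * h <= s * w).
        { apply hlow.
          - intros i hi. apply Rlt_le, Rnot_le_lt. intros hle; apply hno; exists i; now split.
          - apply Rle_trans with (2 := Rlt_le _ _ hj').
            replace ((s - e / INR K) * h + (e + e / INR K) * h) with ((s + e) * h) by ring.
            apply Rmult_le_compat_r; lra. }
        replace (INR K * ((s - e / INR K) * h) + (e + e / INR K) * h) with (s * w + e / INR K * h) in hh2
          by (rewrite hwh; field; lra).
        assert (0 < e / INR K * h) by (apply Rmult_lt_0_compat; trivial; now apply Rdiv_lt_0_compat).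
        lra. }
destruct (nfloor_ex (D / (e / INR K))) as [N [_ hN]].
{ apply Rdiv_le_0_compat; trivial; now apply Rdiv_lt_0_compat. }
exists ((/ INR K) ^ (S N)). split; [apply pow_lt, Rinv_0_lt_compat; lra|].
intros A w hA hw hT hn. apply claim; trivial.
apply Rle_trans with (1 := hn), Rmult_le_compat_r; [lra|].
assert (heK : 0 < e / INR K) by now apply Rdiv_lt_0_compat.
rewrite S_INR. apply Rlt_le.
apply (Rmult_lt_compat_r (e / INR K)) in hN; trivial.
replace (D / (e / INR K) * (e / INR K)) with D in hN by (field; lra). trivial.
Qed.

Definition ev (Q : nat -> Prop) : Prop := exists N, forall i, (N <= i)%nat -> Q i.

Lemma ev_and Q Q' : ev Q -> ev Q' -> ev (fun i => Q i /\ Q' i).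
Proof.
intros [N h] [N' h']. exists (N + N')%nat. intros i hi. split; [apply h|apply h']; lia.
Qed.

Lemma ev_impl (Q Q' : nat -> Prop) : (forall i, Q i -> Q' i) -> ev Q -> ev Q'.
Proof. intros h [N hN]. exists N; auto. Qed.

Lemma ev_forall (Q : nat -> nat -> Prop) K : (forall j, (j < K)%nat -> ev (Q j)) ->
  ev (fun i => forall j, (j < K)%nat -> Q j i).
Proof.
induction K; intros h.
- exists O; intros; lia.
- destruct (ev_and _ _ (IHK ltac:(auto)) (h K ltac:(lia))) as [N hN].
  exists N. intros i hi j hj. destruct (hN i hi) as [h1 h2].
  destruct (Nat.eq_dec j K) as [->|]; trivial. apply h1; lia.
Qed.

Lemma ev_exists Q : ev Q -> exists i, Q i.
Proof. intros [N h]; exists N; auto. Qed.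

Lemma nat_ceiling (x : R) : 0 < x -> exists q, x <= INR q /\
  forall l, x <= INR l -> (q <= l)%nat.
Proof.
intros hx. destruct (nfloor1_ex x hx) as [k [h1 h2]].
exists (S k). rewrite S_INR. split; trivial.
intros l hl. assert (h : INR k < INR l) by lra. apply INR_lt in h. lia.
Qed.

(** The rescaled polynomials [z -> P (m * z)], with [mm] for [m], reduced to what the descent uses.
    In [zf_zeros] every unit cell would contribute a zero, at density 1, but for the sign changes
    counted by [n]. *)
Record zero_family (p : nat -> C -> C) (mm : nat -> R) (n : R -> R) (T b : R) : Prop := {
  zf_poly : forall i, is_poly (p i);
  zf_sym : forall i, real_symmetric (p i);
  zf_pos : forall i, 0 < mm i;
  zf_type : forall eta, 0 < eta -> ev (fun i => forall z, Cmod z <= T ->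
    Cmod (p i z) <= exp (mm i * (PI * b * Rabs (Im z) + eta)));
  zf_center : forall eta, 0 < eta -> ev (fun i => exp (- (mm i * eta)) <= Cmod (p i 0%C));
  zf_zeros : forall al be eta, 0 <= al -> al < be -> be <= T -> 0 < eta ->
    ev (fun i => exists l, NoDup l /\ (forall x, In x l -> p i (RtoC x) = 0%C /\ al < x < be) /\
      mm i * (be - al - (n be - n al) - eta) <= INR (length l))
}.

(** The radius is existential because every step of the descent shrinks the disc. *)
Definition type_bound (p : nat -> C -> C) (mm : nat -> R) (T B : R) : Prop :=
  exists rho, 0 < rho <= T /\ forall eta, 0 < eta -> ev (fun i => forall z, Cmod z <= rho ->
    Cmod (p i z) <= exp (mm i * (B * Rabs (Im z) + eta))).

(** The barrier gains [r * (g - b) * (r / k) / (8 * tau ^ 2)], which is homogeneous of degree 0 in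
    the scale. Since [flat_subinterval] keeps [r] comparable to [tau], a fixed amount is gained,
    independent of [B] and [rho]. *)
Lemma type_bound_decreases p mm n T b D : zero_family p mm n T b -> 0 < T ->
  nonneg_nondecreasing_on T n ->
  (forall d, 0 < d -> exists r, 0 < r < d /\ n r < D * r) ->
  0 <= b -> 0 <= D -> D < 1 - b ->
  exists c, 0 < c /\ forall B, 0 <= B <= PI * b -> type_bound p mm T B ->
    type_bound p mm T (B - c).
Proof.
intros Z hT hn hliminf hb hD hbD.
(* The gap is cut into quarters so that [g = b + 2 * e] equals [1 - (D + e) - e], the density of
   zeros left by the slope [D + e] of a cell and the error [e] of [zf_zeros]. *)
set (e := (1 - D - b) / 4). assert (he : 0 < e) by (unfold e; lra).
set (g := b + 2 * e). assert (hg : b < g <= 1) by (unfold g, e; lra).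
destruct (local_decay b g hb hg) as [k [hk hlocal]].
assert (hkr : 2 <= INR k) by now apply (le_INR 2).
(* [k] cells of length [r / k] on each side of the midpoint [tau]; [local_decay] takes the [k - 1]
   nearest ones. *)
destruct (flat_subinterval n T D e (2 * k) ltac:(lia) hD he hn) as [c0 [hc0 hflat]].
exists ((g - b) * c0 ^ 2 / (128 * INR k)).
assert (hc0' : 0 < c0 ^ 2) by now apply pow_lt.
split; [apply Rdiv_lt_0_compat; [apply Rmult_lt_0_compat|]; lra|].
intros B hB [rho [hrho hbound]].
(* From [tau <= r1 < rho / 16] follow [8 * tau <= rho], for the barrier, and that the disc of radius
   [2 * r] about [tau] lies where the bound is known. *)
destruct (small_octave n T D hn hliminf (rho / 16)) as [r1 [hr1 hoct]]; [lra|].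
destruct (hflat (r1 / 2) (r1 / 2)) as [A' [w' [a1 [a2 [a3 a4]]]]]; try lra.
{ replace (r1 / 2 + r1 / 2) with r1 by field. trivial. }
set (r := w' / 2). set (tau := A' + r). set (h := r / INR k).
assert (hw' : 0 < w') by (apply Rlt_le_trans with (2 := a3), Rmult_lt_0_compat; lra).
assert (hr : 0 < r) by (unfold r; lra).
assert (hh : 0 < h) by (apply Rdiv_lt_0_compat; lra).
assert (hhr : r = INR k * h) by (unfold h; field; lra).
assert (ewh : w' / INR (2 * k) = h).
{ unfold h, r. rewrite mult_INR. simpl (INR 2). field. lra. }
rewrite ewh in a4.
assert (htau : r1 / 2 <= tau <= r1) by (unfold tau, r; lra).
exists (tau / 2). split; [lra|]. intros eta heta.
assert (cells : ev (fun i => forall j, (j < 2 * k)%nat -> exists l, NoDup l /\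
   (forall x, In x l -> p i (RtoC x) = 0%C /\ A' + INR j * h < x < A' + INR (S j) * h) /\
   mm i * h * g <= INR (length l))).
{ apply ev_forall. intros j hj.
  assert (hj1 : INR (S j) * h <= w').
  { replace w' with (INR (2 * k) * h).
    - apply Rmult_le_compat_r; [lra|]. apply le_INR; lia.
    - rewrite <- ewh. field. rewrite mult_INR; simpl (INR 2). lra. }
  assert (hj0 : 0 <= INR j * h) by (apply Rmult_le_pos; [apply pos_INR|lra]).
  assert (ej : INR (S j) * h = INR j * h + h) by (rewrite S_INR; ring).
  assert (heh : 0 < e * h) by now apply Rmult_lt_0_compat.
  generalize (zf_zeros _ _ _ _ _ Z (A' + INR j * h) (A' + INR (S j) * h) (e * h)
     ltac:(lra) ltac:(lra) ltac:(lra) heh).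
  apply ev_impl. intros i [l [l1 [l2 l3]]]. exists l. repeat split; trivial; try apply (l2 x); trivial.
  apply Rle_trans with (2 := l3). rewrite Rmult_assoc. apply Rmult_le_compat_l.
  - apply Rlt_le, (zf_pos _ _ _ _ _ Z).
  - assert (aj := a4 j hj). unfold g, e in *. lra. }
assert (cells' := ev_and _ _ cells (hbound eta heta)).
revert cells'. apply ev_impl. clear cells. intros i [hcells hbd] z hz.
assert (hm := zf_pos _ _ _ _ _ Z i). assert (hP := zf_poly _ _ _ _ _ Z i).
destruct (choice (fun (j : nat) l => (j < 2 * k)%nat -> NoDup l /\
   (forall x, In x l -> p i (RtoC x) = 0%C /\ A' + INR j * h < x < A' + INR (S j) * h) /\
   mm i * h * g <= INR (length l))) as [L hL].
{ intros j. destruct (classic (j < 2 * k)%nat) as [hj|hj].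
  - destruct (hcells j hj) as [l hl]; exists l; trivial.
  - exists nil; intros; contradiction. }
destruct (nat_ceiling (mm i * h * g)) as [q [hq1 hq2]].
{ apply Rmult_lt_0_compat; [now apply Rmult_lt_0_compat|lra]. }
assert (hdec : forall z, Cmod (z - tau) <= h ->
  Cmod (p i z) <= exp (mm i * (B * Rabs (Im z) + eta - r * (g - b)))).
{ apply (hlocal (p i) (mm i) B eta tau r q (fun j => L (k + j)%nat) (fun j => L (k - 1 - j)%nat)); trivial.
  - intros w hw. apply hbd.
    assert (ht := Cmod_triangle (w - tau) tau). rewrite Cmod_R, Rabs_pos_eq in ht by lra.
    replace (w - tau + tau)%C with w in ht by ring. unfold r in *. lra.
  - intros j hj. destruct (hL (k + j)%nat ltac:(lia)) as [l1 [l2 l3]].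
    split; trivial. split; [now apply hq2|]. intros x hx. destruct (l2 x hx) as [x1 x2].
    split; trivial. fold h. unfold tau. rewrite hhr. rewrite !S_INR, !plus_INR in *. lra.
  - intros j hj. destruct (hL (k - 1 - j)%nat ltac:(lia)) as [l1 [l2 l3]].
    split; trivial. split; [now apply hq2|]. intros x hx. destruct (l2 x hx) as [x1 x2].
    split; trivial. fold h. unfold tau. rewrite hhr. rewrite !S_INR in *.
    rewrite !minus_INR in x2 by lia. simpl (INR 1) in x2. lra. }
assert (hbar := barrier (p i) (mm i) B eta rho tau h (r * (g - b)) hP
  (zf_sym _ _ _ _ _ Z i) hm (proj1 hB)).
assert (hr4 : r <= r1 / 4) by (unfold r; lra).
assert (hh2 : h <= r / 2).
{ unfold h. apply Rmult_le_compat_l; [lra|]. apply Rinv_le_contravar; lra. }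
specialize (hbar ltac:(lra) ltac:(lra) ltac:(apply Rmult_lt_0_compat; lra) hbd hdec z hz).
apply Rle_trans with (1 := hbar). apply exp_le_compat, Rmult_le_compat_l; [lra|].
apply Rplus_le_compat_r, Rmult_le_compat_r; [apply Rabs_pos|].
apply Rplus_le_compat_l, Ropp_le_contravar.
assert (hrl : c0 * (r1 / 4) <= r) by (unfold r; lra).
unfold h.
apply Rle_trans with ((g - b) * (r * r) / (8 * INR k) / r1 ^ 2).
- replace ((g - b) * c0 ^ 2 / (128 * INR k)) with ((g - b) * ((c0 * (r1 / 4)) * (c0 * (r1 / 4))) / (8 * INR k) / r1 ^ 2)
    by (field; lra).
  apply Rmult_le_compat_r; [apply Rlt_le, Rinv_0_lt_compat, pow_lt; lra|].
  apply Rmult_le_compat_r; [apply Rlt_le, Rinv_0_lt_compat; lra|].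
  apply Rmult_le_compat_l; [lra|].
  assert (0 <= c0 * (r1 / 4)) by (apply Rmult_le_pos; lra).
  apply Rmult_le_compat; lra.
- apply Rle_trans with ((g - b) * (r * r) / (8 * INR k) / tau ^ 2).
  + apply Rmult_le_compat_l.
    * apply Rdiv_le_0_compat; [|lra]. apply Rmult_le_pos; [lra|nra].
    * apply Rinv_le_contravar; [apply pow_lt; lra|]. apply pow_incr; lra.
  + right. field. lra.
Qed.

(** For [B < 0] the bound is small off the real axis but not on it. Multiplying [p i] by its quarter
    turn repairs this, since [|sin t| + |cos t| >= 1]. The product is then small on a whole circle,
    hence at 0, against [zf_center]. *)
Lemma negative_type_absurd p mm n T b B : zero_family p mm n T b -> B < 0 ->
  type_bound p mm T B -> False.
Proof.
intros Z hB [rho [hrho hbound]].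
set (eta := - (B * rho) / 8).
assert (heta : 0 < eta) by (unfold eta; nra).
destruct (ev_exists _ (ev_and _ _ (hbound eta heta) (zf_center _ _ _ _ _ Z eta heta))) as [i [h1 h2]].
assert (hm := zf_pos _ _ _ _ _ Z i). assert (hP := zf_poly _ _ _ _ _ Z i).
set (W := fun w : C => (p i (rho * w + 0) * p i (rho * Ci * w + 0))%C).
assert (hW : is_poly W).
{ apply poly_mul; now apply (poly_affine (p i)). }
assert (hW0 : Cmod (W 0%C) <= exp (mm i * (B * rho + 2 * eta))).
{ apply disc_max_principle; trivial; [apply exp_pos|]. intros t. unfold W.
  rewrite Cmod_mult.
  assert (b1 : Cmod (p i (rho * expi t + 0)%C) <= exp (mm i * (B * (rho * Rabs (sin t)) + eta))).
  { eapply Rle_trans; [apply h1|].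
    - replace (rho * expi t + 0)%C with (rho * expi t)%C by ring.
      rewrite Cmod_mult, Cmod_expi, Cmod_R, Rabs_pos_eq; lra.
    - replace (Im (rho * expi t + 0)) with (rho * sin t) by (unfold Im; simpl; ring).
      rewrite Rabs_mult, (Rabs_pos_eq rho) by lra. lra. }
  assert (b2 : Cmod (p i (rho * Ci * expi t + 0)%C) <= exp (mm i * (B * (rho * Rabs (cos t)) + eta))).
  { eapply Rle_trans; [apply h1|].
    - replace (rho * Ci * expi t + 0)%C with (rho * Ci * expi t)%C by ring.
      rewrite !Cmod_mult, Cmod_expi, Cmod_Ci, Cmod_R, Rabs_pos_eq; lra.
    - replace (Im (rho * Ci * expi t + 0)) with (rho * cos t) by (unfold Im; simpl; ring).
      rewrite Rabs_mult, (Rabs_pos_eq rho) by lra. lra. }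
  apply Rle_trans with (exp (mm i * (B * (rho * Rabs (sin t)) + eta)) * exp (mm i * (B * (rho * Rabs (cos t)) + eta))).
  - apply Rmult_le_compat; trivial; apply Cmod_ge_0.
  - rewrite <- exp_plus. apply exp_le_compat. rewrite <- Rmult_plus_distr_l.
    apply Rmult_le_compat_l; [lra|].
    assert (hsc : 1 <= Rabs (sin t) + Rabs (cos t)).
    { assert (h := sin2_cos2 t). rewrite <- (Rsqr_abs (sin t)), <- (Rsqr_abs (cos t)) in h || rewrite (Rsqr_abs (sin t)), (Rsqr_abs (cos t)) in h.
      unfold Rsqr in h. assert (h3 := Rabs_pos (sin t)). assert (h4 := Rabs_pos (cos t)). nra. }
    assert (rho <= rho * (Rabs (sin t) + Rabs (cos t))) by nra. nra. }
assert (e0 : W 0%C = (p i 0 * p i 0)%C).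
{ unfold W. replace (rho * 0 + 0)%C with (RtoC 0) by ring. now replace (rho * Ci * 0 + 0)%C with (RtoC 0) by ring. }
rewrite e0, Cmod_mult in hW0.
assert (h3 : exp (- (mm i * eta)) * exp (- (mm i * eta)) <= exp (mm i * (B * rho + 2 * eta))).
{ apply Rle_trans with (2 := hW0). apply Rmult_le_compat; trivial; apply Rlt_le, exp_pos. }
rewrite <- exp_plus in h3.
assert (h4 : exp (mm i * (B * rho + 2 * eta)) < exp (- (mm i * eta) + - (mm i * eta))).
{ apply exp_increasing. assert (h : B * rho = - 8 * eta) by (unfold eta; field). rewrite h. nra. }
lra.
Qed.

Theorem zero_family_absurd p mm n T b D : zero_family p mm n T b -> 0 < T ->
  nonneg_nondecreasing_on T n ->
  (forall d, 0 < d -> exists r, 0 < r < d /\ n r < D * r) ->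
  0 <= b -> 0 <= D -> D < 1 - b -> False.
Proof.
intros Z hT hn hliminf hb hD hbD.
destruct (type_bound_decreases p mm n T b D Z hT hn hliminf hb hD hbD) as [c [hc step]].
assert (hpi := PI_RGT_0).
assert (claim : forall j, exists B, B <= PI * b - INR j * c /\ type_bound p mm T B).
{ induction j as [|j [B [h1 h2]]].
  - exists (PI * b). split; [simpl; lra|]. exists T. split; [lra|]. apply (zf_type _ _ _ _ _ Z).
  - destruct (Rlt_le_dec B 0) as [hB|hB].
    + exfalso. exact (negative_type_absurd _ _ _ _ _ _ Z hB h2).
    + exists (B - c). rewrite S_INR. split; [lra|]. apply step; trivial. split; trivial.
      assert (0 <= INR j * c) by (apply Rmult_le_pos; [apply pos_INR|lra]). lra. }
destruct (nfloor_ex (PI * b / c)) as [N [_ hN]].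
{ apply Rdiv_le_0_compat; trivial. apply Rmult_le_pos; lra. }
destruct (claim (S N)) as [B [h1 h2]].
apply (negative_type_absurd _ _ _ _ _ B Z); trivial.
rewrite S_INR in h1. apply (Rmult_lt_compat_r c) in hN; trivial.
replace (PI * b / c * c) with (PI * b) in hN by (field; lra). lra.
Qed.

(** * Power series *)

Fixpoint csum (u : nat -> C) (n : nat) : C :=
  match n with O => RtoC 0 | S n => (csum u n + u n)%C end.

Lemma csum_ext u v n : (forall i, (i < n)%nat -> u i = v i) -> csum u n = csum v n.
Proof. induction n; simpl; intros h; trivial. rewrite IHn, h; auto. Qed.

Lemma csum_plus u v n : csum (fun i => u i + v i)%C n = (csum u n + csum v n)%C.
Proof. induction n; simpl; [ring|]. rewrite IHn; ring. Qed.

Lemma csum_scal c u n : csum (fun i => c * u i)%C n = (c * csum u n)%C.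
Proof. induction n; simpl; [ring|]. rewrite IHn; ring. Qed.

Lemma csum_shift u n : csum u (S n) = (u O + csum (fun i => u (S i)) n)%C.
Proof. induction n; simpl in *; [ring|]. rewrite IHn; ring. Qed.

Lemma Cmod_csum u n : Cmod (csum u n) <= rsum (fun i => Cmod (u i)) n.
Proof.
induction n; simpl; [rewrite Cmod_0; lra|].
apply Rle_trans with (1 := Cmod_triangle _ _). lra.
Qed.

Definition Clim (s : nat -> C) (l : C) : Prop :=
  forall e, 0 < e -> ev (fun n => Cmod (s n - l) < e).

Lemma Clim_bound s l M : Clim s l -> ev (fun n => Cmod (s n) <= M) -> Cmod l <= M.
Proof.
intros hs hM. apply Rnot_lt_le; intros hlt.
destruct (ev_exists _ (ev_and _ _ (hs (Cmod l - M) ltac:(lra)) hM)) as [n [h1 h2]].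
assert (h := Cmod_triangle_inv l (s n)).
replace (l - s n)%C with (- (s n - l))%C in h by ring. rewrite Cmod_opp in h. lra.
Qed.

Lemma Clim_plus s t l m : Clim s l -> Clim t m -> Clim (fun n => s n + t n)%C (l + m)%C.
Proof.
intros hs ht e he. generalize (ev_and _ _ (hs (e / 2) ltac:(lra)) (ht (e / 2) ltac:(lra))).
apply ev_impl. intros n [h1 h2].
replace (s n + t n - (l + m))%C with ((s n - l) + (t n - m))%C by ring.
apply Rle_lt_trans with (1 := Cmod_triangle _ _). lra.
Qed.

Lemma Clim_scal c s l : Clim s l -> Clim (fun n => c * s n)%C (c * l)%C.
Proof.
intros hs e he. assert (hc := Cmod_ge_0 c).
generalize (hs (e / (Cmod c + 1)) ltac:(apply Rdiv_lt_0_compat; lra)).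
apply ev_impl. intros n h. replace (c * s n - c * l)%C with (c * (s n - l))%C by ring.
rewrite Cmod_mult. assert (h0 := Cmod_ge_0 (s n - l)).
apply Rle_lt_trans with ((Cmod c + 1) * Cmod (s n - l)); [nra|].
apply (Rmult_lt_compat_l (Cmod c + 1)) in h; [|lra].
replace ((Cmod c + 1) * (e / (Cmod c + 1))) with e in h by (field; lra). trivial.
Qed.

Lemma Clim_unique s l m : Clim s l -> Clim s m -> l = m.
Proof.
intros h1 h2.
assert (h : Cmod (l + (-1) * m) <= 0).
{ apply (Clim_bound (fun n => s n + (-1) * s n)%C).
  - apply Clim_plus; trivial. now apply Clim_scal.
  - exists O. intros i _. replace (s i + (-1) * s i)%C with (RtoC 0) by ring. rewrite Cmod_0; lra. }
assert (h' : (l + (-1) * m)%C = 0%C).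
{ apply Cmod_eq_0. apply Rle_antisym; trivial. apply Cmod_ge_0. }
replace l with ((l + (-1) * m) + m)%C by ring. rewrite h'; ring.
Qed.

Lemma Clim_ext s t l : (forall n, s n = t n) -> Clim s l -> Clim t l.
Proof. intros h hs e he. generalize (hs e he). apply ev_impl. intros n. now rewrite h. Qed.

Lemma Clim_succ s l : Clim s l <-> Clim (fun n => s (S n)) l.
Proof.
split; intros h e he; destruct (h e he) as [N hN].
- exists N. intros i hi; apply hN; lia.
- exists (S N). intros i hi. destruct i as [|i]; [lia|]. apply hN; lia.
Qed.

Lemma rsum_increment_le v N k : (forall n, 0 <= v n) -> rsum v N <= rsum v (N + k).
Proof.
intros hv; induction k; [rewrite Nat.add_0_r; lra|].
replace (N + S k)%nat with (S (N + k)) by lia. simpl. specialize (hv (N + k)%nat). lra.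
Qed.

Lemma csum_increment u v N k : (forall n, Cmod (u n) <= v n) ->
  Cmod (csum u (N + k) - csum u N) <= rsum v (N + k) - rsum v N.
Proof.
intros h; induction k.
- rewrite Nat.add_0_r. replace (csum u N - csum u N)%C with (RtoC 0) by ring. rewrite Cmod_0; lra.
- replace (N + S k)%nat with (S (N + k)) by lia. simpl.
  replace (csum u (N + k) + u (N + k)%nat - csum u N)%C
    with ((csum u (N + k) - csum u N) + u (N + k)%nat)%C by ring.
  apply Rle_trans with (1 := Cmod_triangle _ _). specialize (h (N + k)%nat). lra.
Qed.

Lemma rsum_bounded_lim v M : (forall n, 0 <= v n) -> (forall N, rsum v N <= M) ->
  exists l : R, is_lim_seq (rsum v) l /\ forall N, rsum v N <= l.
Proof.
intros hv hM.
destruct (ex_finite_lim_seq_incr (rsum v) M) as [l hl]; trivial.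
- intros n; simpl. specialize (hv n); lra.
- exists l; split; trivial. intros N. apply (is_lim_seq_incr_compare (rsum v)); trivial.
  intros n; simpl. specialize (hv n); lra.
Qed.

Lemma is_lim_seq_ev (u : nat -> R) (l : R) : is_lim_seq u l ->
  forall e, 0 < e -> ev (fun n => Rabs (u n - l) < e).
Proof.
intros h e he. apply is_lim_seq_spec in h. exact (h (mkposreal e he)).
Qed.

Lemma summable_lim (u : nat -> C) (v : nat -> R) (M : R) : (forall n, Cmod (u n) <= v n) ->
  (forall N, rsum v N <= M) -> exists l, Clim (csum u) l.
Proof.
intros huv hM.
assert (hv : forall n, 0 <= v n) by (intros n; apply Rle_trans with (2 := huv n), Cmod_ge_0).
destruct (rsum_bounded_lim v M hv hM) as [L [hL hL']].
assert (cauchy : forall e : posreal, exists N, forall p q, (N <= p)%nat -> (N <= q)%nat ->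
   Cmod (csum u p - csum u q) < e).
{ intros e. destruct (is_lim_seq_ev _ _ hL e (cond_pos e)) as [N hN]. exists N.
  assert (W : forall p q, (N <= p)%nat -> (p <= q)%nat -> Cmod (csum u q - csum u p) < e).
  { intros p q hp hq. replace q with (p + (q - p))%nat by lia.
    apply Rle_lt_trans with (1 := csum_increment u v p (q - p) huv).
    specialize (hN p hp). apply Rabs_lt_between in hN.
    assert (h := hL' (p + (q - p))%nat). lra. }
  intros p q hp hq. destruct (Nat.le_ge_cases p q) as [h|h]; [|now apply W].
  replace (csum u p - csum u q)%C with (- (csum u q - csum u p))%C by ring.
  rewrite Cmod_opp. now apply W. }
assert (H : forall part : C -> R, (forall x y, Rabs (part x - part y) <= Cmod (x - y)) ->
   exists l : R, is_lim_seq (fun n => part (csum u n)) l).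
{ intros part hp. apply ex_lim_seq_cauchy_corr. intros e. destruct (cauchy e) as [N hN].
  exists N. intros p q h1 h2. apply Rle_lt_trans with (1 := hp _ _). auto. }
destruct (H Re) as [x hx].
{ intros a c. replace (Re a - Re c) with (Re (a - c)) by (unfold Re; simpl; ring). apply re_le_Cmod. }
destruct (H Im) as [y hy].
{ intros a c. replace (Im a - Im c) with (Im (a - c)) by (unfold Im; simpl; ring). apply im_le_Cmod. }
exists (x, y). intros e he.
assert (he2 : 0 < e / 2) by lra.
generalize (ev_and _ _ (is_lim_seq_ev _ _ hx _ he2) (is_lim_seq_ev _ _ hy _ he2)). apply ev_impl. simpl.
intros n [h1 h2]. apply Rle_lt_trans with (1 := Cmod_le_Re_Im _).
replace (Re (csum u n - (x, y))) with (Re (csum u n) - x) by reflexivity.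
replace (Im (csum u n - (x, y))) with (Im (csum u n) - y) by reflexivity. lra.
Qed.

Lemma Clim_tail (u : nat -> C) (v : nat -> R) (l : C) (L : R) (N : nat) :
  (forall n, Cmod (u n) <= v n) -> (forall N, rsum v N <= L) -> Clim (csum u) l ->
  Cmod (csum u N - l) <= L - rsum v N.
Proof.
intros huv hL hl.
apply (Clim_bound (fun n => csum u N + (-1) * csum u n)%C).
- replace (csum u N - l)%C with (csum u N + (-1) * l)%C by ring.
  apply Clim_plus; [|now apply Clim_scal].
  intros e he. exists O. intros i _. replace (csum u N - csum u N)%C with (RtoC 0) by ring. now rewrite Cmod_0.
- exists N. intros n hn. replace n with (N + (n - N))%nat by lia.
  replace (csum u N + (-1) * csum u (N + (n - N)))%C with (- (csum u (N + (n - N)) - csum u N))%C by ring.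
  rewrite Cmod_opp. apply Rle_trans with (1 := csum_increment u v N (n - N) huv).
  specialize (hL (N + (n - N))%nat). lra.
Qed.

(** * Binomial coefficients and their generating series *)

Fixpoint bin (n k : nat) : R :=
  match k, n with
  | O, _ => 1
  | S _, O => 0
  | S k', S n' => bin n' k' + bin n' k
  end.

Lemma bin_0 n : bin n 0 = 1.
Proof. now destruct n. Qed.

Lemma bin_S n k : bin (S n) (S k) = bin n k + bin n (S k).
Proof. reflexivity. Qed.

Lemma bin_small n : forall k, (n < k)%nat -> bin n k = 0.
Proof.
induction n; intros [|k] h; try lia; trivial.
rewrite bin_S, !IHn by lia. ring.
Qed.

Lemma bin_nonneg n : forall k, 0 <= bin n k.
Proof.
induction n; intros [|k]; simpl; try lra. generalize (IHn k) (IHn (S k)); lra.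
Qed.

Lemma bin_1 n : bin n 1 = INR n.
Proof. induction n; trivial. rewrite bin_S, IHn, bin_0, S_INR. ring. Qed.

Lemma bin_absorb n : forall k, (INR n - INR k) * bin n k = (INR k + 1) * bin n (S k).
Proof.
induction n; intros k.
- destruct k; simpl; ring.
- destruct k.
  + rewrite bin_0, bin_1, S_INR. simpl. ring.
  + rewrite !bin_S. assert (h1 := IHn k). assert (h2 := IHn (S k)). rewrite !S_INR in *. nra.
Qed.

Lemma bin_series_step x k N :
  rsum (fun n => bin (n + S k) (S k) * x ^ n) (S N)
  = rsum (fun n => bin (n + k) k * x ^ n) (S N) + x * rsum (fun n => bin (n + S k) (S k) * x ^ n) N.
Proof.
induction N.
- simpl. rewrite (bin_small k (S k)) by lia. ring.
- set (F := fun n => bin (n + S k) (S k) * x ^ n) in *.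
  set (G := fun n => bin (n + k) k * x ^ n) in *.
  change (rsum F (S (S N))) with (rsum F (S N) + F (S N)).
  change (rsum G (S (S N))) with (rsum G (S N) + G (S N)).
  change (rsum F (S N)) with (rsum F N + F N) at 2.
  assert (e : F (S N) = G (S N) + x * F N).
  { unfold F, G. replace (S N + S k)%nat with (S (S N + k)) by lia.
    rewrite bin_S. replace (N + S k)%nat with (S N + k)%nat by lia. simpl pow. ring. }
  rewrite e, IHN. ring.
Qed.

(** The negative binomial series: multiplication by [1 - x] lowers [k] by one, which
    [bin_series_step] states for partial sums. *)
Lemma bin_series x k N : 0 <= x < 1 ->
  rsum (fun n => bin (n + k) k * x ^ n) N <= (/ (1 - x)) ^ (S k).
Proof.
intros hx. revert N. induction k; intros N.
- assert (h : rsum (fun n => bin (n + 0) 0 * x ^ n) N * (1 - x) <= 1).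
  { assert (e : rsum (fun n => bin (n + 0) 0 * x ^ n) N * (1 - x) = 1 - x ^ N).
    { induction N; simpl; [ring|]. rewrite Rmult_plus_distr_r, IHN, bin_0. ring. }
    rewrite e. assert (0 <= x ^ N) by (apply pow_le; lra). lra. }
  simpl. rewrite Rmult_1_r. apply Rmult_le_reg_r with (1 - x); [lra|]. rewrite Rinv_l; lra.
- set (F := fun n => bin (n + S k) (S k) * x ^ n).
  assert (hF : forall n, 0 <= F n).
  { intros n; apply Rmult_le_pos; [apply bin_nonneg|apply pow_le; lra]. }
  apply Rle_trans with (rsum F (S N)); [simpl; specialize (hF N); lra|].
  assert (h := bin_series_step x k N). fold F in h.
  assert (h2 := IHk (S N)).
  assert (h3 : rsum F N <= rsum F (S N)) by (simpl; specialize (hF N); lra).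
  apply Rmult_le_reg_r with (1 - x); [lra|].
  replace ((/ (1 - x)) ^ S (S k) * (1 - x)) with ((/ (1 - x)) ^ S k) by (simpl; field; lra).
  apply Rle_trans with (2 := h2). assert (x * rsum F N <= x * rsum F (S N)) by (apply Rmult_le_compat_l; lra). lra.
Qed.

(** * Termwise derivatives and the identity theorem *)

Definition geom_bound (b : nat -> C) (K rho : R) : Prop := forall n, Cmod (b n) * rho ^ n <= K.

(* [shifted b k] are the coefficients of the [k]-th derivative divided by [k!]. *)
Definition shifted (b : nat -> C) (k n : nat) : C := (bin (n + k) k * b (n + k)%nat)%C.

Lemma geom_bound_pos b K rho : geom_bound b K rho -> 0 <= K.
Proof. intros h. apply Rle_trans with (2 := h O). simpl. rewrite Rmult_1_r. apply Cmod_ge_0. Qed.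

Lemma shifted_term b K rho k n t : geom_bound b K rho -> 0 < rho -> 0 <= t ->
  Cmod (shifted b k n) * t ^ n <= K * (/ rho) ^ k * (bin (n + k) k * (t / rho) ^ n).
Proof.
intros hb hrho ht. unfold shifted. rewrite Cmod_mult, Cmod_R, Rabs_pos_eq by apply bin_nonneg.
specialize (hb (n + k)%nat).
assert (hp : 0 < rho ^ (n + k)) by now apply pow_lt.
assert (h1 : Cmod (b (n + k)%nat) <= K * (/ rho) ^ (n + k)).
{ apply Rmult_le_reg_r with (rho ^ (n + k)); trivial.
  rewrite Rmult_assoc, <- Rpow_mult_distr, Rinv_l, pow1 by lra. lra. }
rewrite pow_add in h1. unfold Rdiv. rewrite (Rpow_mult_distr t).
apply Rle_trans with (bin (n + k) k * (K * ((/ rho) ^ n * (/ rho) ^ k)) * t ^ n).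
- apply Rmult_le_compat_r; [now apply pow_le|]. apply Rmult_le_compat_l; trivial. apply bin_nonneg.
- right; ring.
Qed.

Lemma shifted_sum b K rho k t N : geom_bound b K rho -> 0 < rho -> 0 <= t < rho ->
  rsum (fun n => Cmod (shifted b k n) * t ^ n) N <= K * (/ rho) ^ k * (/ (1 - t / rho)) ^ (S k).
Proof.
intros hb hrho ht.
apply Rle_trans with (rsum (fun n => K * (/ rho) ^ k * (bin (n + k) k * (t / rho) ^ n)) N).
- apply rsum_le. intros n _. apply shifted_term; trivial; lra.
- rewrite rsum_scal. apply Rmult_le_compat_l.
  + apply Rmult_le_pos; [now apply geom_bound_pos in hb|]. apply pow_le, Rlt_le, Rinv_0_lt_compat; lra.
  + apply bin_series. split; [apply Rdiv_le_0_compat; lra|].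
    apply Rmult_lt_reg_r with rho; trivial. unfold Rdiv; rewrite Rmult_assoc, Rinv_l; lra.
Qed.

Lemma shifted_geom_bound b K rho k t : geom_bound b K rho -> 0 < rho -> 0 <= t < rho ->
  geom_bound (shifted b k) (K * (/ rho) ^ k * (/ (1 - t / rho)) ^ (S k)) t.
Proof.
intros hb hrho ht n.
assert (h0 : forall i, 0 <= Cmod (shifted b k i) * t ^ i).
{ intros i. apply Rmult_le_pos; [apply Cmod_ge_0|apply pow_le; lra]. }
apply Rle_trans with (rsum (fun n => Cmod (shifted b k n) * t ^ n) (S n)).
- simpl. assert (h := rsum_increment_le _ O n h0). simpl in h. lra.
- now apply shifted_sum.
Qed.

Lemma shifted_0 b n : shifted b 0 n = b n.
Proof. unfold shifted. rewrite Nat.add_0_r, bin_0. ring. Qed.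

(** Differentiating the [k]-th derivative over [k!] gives [k + 1] times the next such quotient, so
    all Taylor coefficients are reached through first derivatives. *)
Lemma shifted_succ b k n :
  shifted (shifted b k) 1 n = ((INR k + 1)%R * shifted b (S k) n)%C.
Proof.
unfold shifted. rewrite bin_1.
replace (n + 1 + k)%nat with (n + S k)%nat by lia.
rewrite !Cmult_assoc, <- !RtoC_mult. f_equal. f_equal.
assert (h := bin_absorb (n + S k) k). rewrite <- h. rewrite !plus_INR, !S_INR. change (INR 0) with 0. ring.
Qed.

(** Radius of convergence at least [r], expressed by bounds on the terms, a form that passes to
    derivatives with explicit constants. *)
Definition converges_on (b : nat -> C) (r : R) : Prop :=
  forall rho, 0 < rho < r -> exists K, geom_bound b K rho.

Lemma shifted_converges b r k : converges_on b r -> converges_on (shifted b k) r.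
Proof.
intros h rho hr. destruct (h ((rho + r) / 2)) as [K hK]; [lra|].
eexists. apply shifted_geom_bound with (1 := hK); lra.
Qed.

Definition pterm (b : nat -> C) (z : C) (n : nat) : C := (b n * z ^ n)%C.

(* An arbitrary value where the series diverges. *)
Definition psum (b : nat -> C) (z : C) : C :=
  epsilon (inhabits (RtoC 0)) (Clim (csum (pterm b z))).

Lemma psum_eq b z l : Clim (csum (pterm b z)) l -> psum b z = l.
Proof.
intros h. apply (Clim_unique (csum (pterm b z))); trivial.
unfold psum. apply epsilon_spec. now exists l.
Qed.

Lemma psum_spec b r z : converges_on b r -> Cmod z < r -> Clim (csum (pterm b z)) (psum b z).
Proof.
intros hb hz. unfold psum. apply epsilon_spec.
assert (h0 := Cmod_ge_0 z).
destruct (hb ((Cmod z + r) / 2)) as [K hK]; [lra|].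
apply (summable_lim _ (fun n => Cmod (shifted b 0 n) * Cmod z ^ n)
   (K * (/ ((Cmod z + r) / 2)) ^ 0 * (/ (1 - Cmod z / ((Cmod z + r) / 2))) ^ 1)).
- intros n. unfold pterm. rewrite shifted_0, Cmod_mult, Cmod_pow. lra.
- intros N. apply shifted_sum; trivial; lra.
Qed.

Lemma psum_shifted_bound b K rho k z : geom_bound b K rho -> Cmod z < rho ->
  Cmod (psum (shifted b k) z) <= K * (/ rho) ^ k * (/ (1 - Cmod z / rho)) ^ (S k).
Proof.
intros hb hz. assert (h0 := Cmod_ge_0 z).
assert (hN : forall N, rsum (fun n => Cmod (shifted b k n) * Cmod z ^ n) N <=
   K * (/ rho) ^ k * (/ (1 - Cmod z / rho)) ^ (S k)) by (intros N; apply shifted_sum; trivial; lra).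
assert (hle : forall n, Cmod (pterm (shifted b k) z n) <= Cmod (shifted b k n) * Cmod z ^ n).
{ intros n. unfold pterm. rewrite Cmod_mult, Cmod_pow. lra. }
destruct (summable_lim _ _ _ hle hN) as [l hl]. rewrite (psum_eq _ _ _ hl).
apply (Clim_bound (csum (pterm (shifted b k) z))); trivial.
exists O. intros N _. apply Rle_trans with (1 := Cmod_csum _ _).
apply Rle_trans with (2 := hN N). apply rsum_le. auto.
Qed.

(** The derivative of [z ^ n], by the product rule, which avoids the exponent [n - 1]. *)
Fixpoint dpow (z : C) (n : nat) : C :=
  match n with O => RtoC 0 | S n => (z * dpow z n + z ^ n)%C end.

Lemma dpow_S z n : dpow z (S n) = ((INR n + 1)%R * z ^ n)%C.
Proof.
induction n; [simpl; rewrite Rplus_0_l; ring|].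
change (dpow z (S (S n))) with (z * dpow z (S n) + z ^ S n)%C. rewrite IHn, S_INR.
rewrite !RtoC_plus. simpl. ring.
Qed.

Lemma dpow_bound z q n : Cmod z <= q -> Cmod (dpow z n) * q <= INR n * q ^ n.
Proof.
intros hz. assert (h0 := Cmod_ge_0 z).
destruct n; [simpl; rewrite Cmod_0; lra|].
rewrite dpow_S, Cmod_mult, Cmod_R, Rabs_pos_eq, Cmod_pow by (generalize (pos_INR n); lra).
rewrite S_INR, Rmult_assoc. apply Rmult_le_compat_l; [generalize (pos_INR n); lra|].
rewrite Rmult_comm. simpl. apply Rmult_le_compat_l; [lra|]. apply pow_incr; lra.
Qed.

(** The second-order remainder of a power. Both sides carry the factor [q ^ 2], so that no exponent
    [n - 2] occurs and the induction is Pascal's rule. *)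
Lemma pow_taylor (z h : C) (q : R) n : Cmod z + Cmod h <= q ->
  Cmod ((z + h) ^ n - z ^ n - h * dpow z n) * q ^ 2 <= Cmod h ^ 2 * (bin n 2 * q ^ n).
Proof.
intros hq. assert (hz := Cmod_ge_0 z). assert (hh := Cmod_ge_0 h).
induction n.
- simpl. replace (1 - 1 - h * 0)%C with (RtoC 0) by ring. rewrite Cmod_0. lra.
- rewrite bin_S, bin_1.
  replace ((z + h) ^ S n - z ^ S n - h * dpow z (S n))%C
    with ((z + h) * ((z + h) ^ n - z ^ n - h * dpow z n) + h * h * dpow z n)%C by (simpl; ring).
  apply Rle_trans with ((q * Cmod ((z + h) ^ n - z ^ n - h * dpow z n) + Cmod h ^ 2 * Cmod (dpow z n)) * q ^ 2).
  + apply Rmult_le_compat_r; [apply pow2_ge_0|].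
    apply Rle_trans with (1 := Cmod_triangle _ _). rewrite !Cmod_mult.
    apply Rplus_le_compat; [|simpl; lra].
    apply Rmult_le_compat_r; [apply Cmod_ge_0|]. apply Rle_trans with (1 := Cmod_triangle _ _); lra.
  + assert (h1 := dpow_bound z q n ltac:(lra)).
    apply Rle_trans with (q * (Cmod h ^ 2 * (bin n 2 * q ^ n)) + Cmod h ^ 2 * q * (INR n * q ^ n)).
    * rewrite Rmult_plus_distr_r. apply Rplus_le_compat.
      -- rewrite Rmult_assoc. apply Rmult_le_compat_l; lra.
      -- replace (Cmod h ^ 2 * Cmod (dpow z n) * q ^ 2) with (Cmod h ^ 2 * q * (Cmod (dpow z n) * q)) by ring.
         apply Rmult_le_compat_l; trivial. apply Rmult_le_pos; [apply pow2_ge_0|lra].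
    * right. simpl. ring.
Qed.

Lemma bin_le_S n k : bin n k <= bin (S n) k.
Proof.
destruct k; [rewrite !bin_0; lra|]. rewrite bin_S. generalize (bin_nonneg n k); lra.
Qed.

Lemma psum_derivative b r z : converges_on b r -> Cmod z < r ->
  exists A d, 0 <= A /\ 0 < d /\ forall h, Cmod h < d ->
    Cmod (psum b (z + h) - psum b z - h * psum (shifted b 1) z) <= A * Cmod h ^ 2.
Proof.
intros hb hz. assert (h0 := Cmod_ge_0 z).
set (q := Cmod z + (r - Cmod z) / 3). set (rho := Cmod z + 2 * (r - Cmod z) / 3).
destruct (hb rho ltac:(unfold rho; lra)) as [K hK].
assert (hq : 0 < q) by (unfold q; lra). assert (hqr : q < rho) by (unfold q, rho; lra).
assert (hK0 := geom_bound_pos _ _ _ hK).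
set (A := K * (/ rho) ^ 0 * (/ (1 - q / rho)) ^ 3).
assert (hinv : 0 < / (1 - q / rho)).
{ apply Rinv_0_lt_compat. assert (q / rho < 1); [|lra].
  apply Rmult_lt_reg_r with rho; [lra|]. unfold Rdiv; rewrite Rmult_assoc, Rinv_l; lra. }
assert (hA : 0 <= A) by (unfold A; repeat apply Rmult_le_pos; try lra; apply pow_le; lra).
exists (A / q ^ 2), ((r - Cmod z) / 3).
split; [apply Rdiv_le_0_compat; trivial; now apply pow_lt|].
split; [lra|]. intros h hh.
assert (hzh : Cmod (z + h) < r) by (apply Rle_lt_trans with (1 := Cmod_triangle _ _); lra).
assert (s1 := psum_spec b r (z + h)%C hb hzh).
assert (s2 := psum_spec b r z hb hz).
assert (s3 := psum_spec (shifted b 1) r z (shifted_converges b r 1 hb) hz).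
assert (s3' : Clim (csum (fun n => b n * dpow z n)%C) (psum (shifted b 1) z)).
{ apply Clim_succ. apply Clim_ext with (2 := s3). intros n. rewrite csum_shift. simpl dpow at 1.
  rewrite Cmult_0_r, Cplus_0_l. apply csum_ext. intros i _. rewrite dpow_S. unfold pterm, shifted.
  rewrite bin_1, plus_INR. replace (i + 1)%nat with (S i) by lia. simpl INR. ring. }
apply (Clim_bound (fun n => csum (pterm b (z + h)) n + (-1) * csum (pterm b z) n
   + (- h) * csum (fun n => b n * dpow z n) n)%C).
{ replace (psum b (z + h) - psum b z - h * psum (shifted b 1) z)%C
    with (psum b (z + h) + (-1) * psum b z + (- h) * psum (shifted b 1) z)%C by ring.
  apply Clim_plus; [apply Clim_plus; trivial|]; now apply Clim_scal. }
exists O. intros N _.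
rewrite <- !csum_scal, <- !csum_plus.
apply Rle_trans with (1 := Cmod_csum _ _).
apply Rle_trans with (rsum (fun n => Cmod h ^ 2 / q ^ 2 * (K * (/ rho) ^ 0 * (bin (n + 2) 2 * (q / rho) ^ n))) N).
- apply rsum_le. intros n _. unfold pterm.
  replace (b n * (z + h) ^ n + -1 * (b n * z ^ n) + - h * (b n * dpow z n))%C
    with (b n * ((z + h) ^ n - z ^ n - h * dpow z n))%C by ring.
  rewrite Cmod_mult.
  assert (t1 := pow_taylor z h q n ltac:(unfold q; lra)).
  assert (t2 := shifted_term b K rho 0 n q hK ltac:(lra) ltac:(lra)).
  rewrite shifted_0, bin_0, Rmult_1_l in t2.
  assert (hq2 : 0 < q ^ 2) by now apply pow_lt.
  apply Rmult_le_reg_r with (q ^ 2); trivial.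
  apply Rle_trans with (Cmod (b n) * (Cmod h ^ 2 * (bin n 2 * q ^ n))).
  + rewrite Rmult_assoc. apply Rmult_le_compat_l; trivial. apply Cmod_ge_0.
  + replace (Cmod (b n) * (Cmod h ^ 2 * (bin n 2 * q ^ n))) with (Cmod h ^ 2 * (bin n 2 * (Cmod (b n) * q ^ n))) by ring.
    replace (Cmod h ^ 2 / q ^ 2 * (K * (/ rho) ^ 0 * (bin (n + 2) 2 * (q / rho) ^ n)) * q ^ 2)
      with (Cmod h ^ 2 * (bin (n + 2) 2 * (K * (/ rho) ^ 0 * (q / rho) ^ n))) by (field; lra).
    apply Rmult_le_compat_l; [apply pow2_ge_0|].
    apply Rmult_le_compat; trivial.
    * apply bin_nonneg.
    * apply Rmult_le_pos; [apply Cmod_ge_0|apply pow_le; lra].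
    * replace (n + 2)%nat with (S (S n)) by lia.
      apply Rle_trans with (1 := bin_le_S _ _), bin_le_S.
- rewrite rsum_scal, rsum_scal.
  assert (hbs := bin_series (q / rho) 2 N).
  replace (A / q ^ 2 * Cmod h ^ 2) with (Cmod h ^ 2 / q ^ 2 * A) by (field; lra).
  apply Rmult_le_compat_l.
  + apply Rdiv_le_0_compat; [apply pow2_ge_0|now apply pow_lt].
  + unfold A. apply Rmult_le_compat_l; [simpl; lra|]. apply hbs.
    split; [apply Rdiv_le_0_compat; lra|].
    apply Rmult_lt_reg_r with rho; [lra|]. unfold Rdiv; rewrite Rmult_assoc, Rinv_l; lra.
Qed.

Lemma psum_ext b b' z : (forall n, b n = b' n) -> psum b z = psum b' z.
Proof.
intros h. unfold psum. f_equal. apply functional_extensionality. intros l.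
assert (e : csum (pterm b z) = csum (pterm b' z)); [|now rewrite e].
apply functional_extensionality. intros n. apply csum_ext. intros i _. unfold pterm. now rewrite h.
Qed.

Lemma psum_scal b r c z : converges_on b r -> Cmod z < r ->
  psum (fun n => c * b n)%C z = (c * psum b z)%C.
Proof.
intros hb hz. apply psum_eq. apply Clim_ext with (2 := Clim_scal c _ _ (psum_spec b r z hb hz)).
intros n. rewrite <- csum_scal. apply csum_ext. intros i _. unfold pterm. ring.
Qed.

Lemma derivative_unique (b b' : nat -> C) (r r' d : R) (z z' : C) :
  converges_on b r -> converges_on b' r' -> Cmod z < r -> Cmod z' < r' -> 0 < d ->
  (forall h, Cmod h < d -> psum b (z + h) = psum b' (z' + h)) ->
  psum (shifted b 1) z = psum (shifted b' 1) z'.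
Proof.
intros hb hb' hz hz' hd heq.
destruct (psum_derivative b r z hb hz) as [A [d1 [hA [hd1 h1]]]].
destruct (psum_derivative b' r' z' hb' hz') as [A' [d2 [hA' [hd2 h2]]]].
set (D := (psum (shifted b 1) z - psum (shifted b' 1) z')%C).
assert (h0 : psum b z = psum b' z').
{ assert (h := heq 0%C ltac:(rewrite Cmod_0; trivial)). now rewrite !Cplus_0_r in h. }
assert (key : forall t, 0 < t < Rmin d (Rmin d1 d2) -> Cmod D <= (A + A') * t).
{ intros t [t0 t1].
  assert (a1 := Rmin_l d (Rmin d1 d2)). assert (a2 := Rmin_r d (Rmin d1 d2)).
  assert (a3 := Rmin_l d1 d2). assert (a4 := Rmin_r d1 d2).
  assert (ht : Cmod t = t) by (rewrite Cmod_R, Rabs_pos_eq; lra).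
  specialize (h1 t ltac:(lra)). specialize (h2 t ltac:(lra)).
  rewrite heq, h0 in h1 by lra. rewrite ht in h1, h2.
  apply Rmult_le_reg_r with t; trivial.
  apply Rle_trans with (A * t ^ 2 + A' * t ^ 2); [|right; ring].
  replace (Cmod D * t) with (Cmod (D * t)) by (rewrite Cmod_mult, ht; trivial).
  replace (D * t)%C with ((psum b' (z' + t) - psum b' z' - t * psum (shifted b' 1) z')
     - (psum b' (z' + t) - psum b' z' - t * psum (shifted b 1) z))%C by (unfold D; ring).
  apply Rle_trans with (1 := Cmod_triangle _ _). rewrite Cmod_opp. lra. }
assert (hD : Cmod D <= 0).
{ apply Rnot_lt_le; intros hlt.
  assert (hm : 0 < Rmin d (Rmin d1 d2)) by (repeat apply Rmin_glb_lt; trivial).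
  set (t := Rmin (Rmin d (Rmin d1 d2) / 2) (Cmod D / (2 * (A + A' + 1)))).
  assert (ht0 : 0 < t) by (apply Rmin_glb_lt; [lra|apply Rdiv_lt_0_compat; lra]).
  assert (ht1 : t <= Rmin d (Rmin d1 d2) / 2) by apply Rmin_l.
  assert (ht2 : t * (2 * (A + A' + 1)) <= Cmod D).
  { apply Rle_trans with (Cmod D / (2 * (A + A' + 1)) * (2 * (A + A' + 1))).
    - apply Rmult_le_compat_r; [lra|apply Rmin_r].
    - right; field; lra. }
  specialize (key t ltac:(lra)). nra. }
assert (e : D = 0%C) by (apply Cmod_eq_0, Rle_antisym; trivial; apply Cmod_ge_0).
replace (psum (shifted b 1) z) with (D + psum (shifted b' 1) z')%C by (unfold D; ring).
rewrite e; ring.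
Qed.

(** Agreement on an open disc passes to first derivatives, and [shifted_succ] turns this into an
    induction on [k]. The two expansions have different centres, hence the two base points. *)
Lemma taylor_unique (b b' : nat -> C) (r r' : R) (z z' : C) (d : R) :
  converges_on b r -> converges_on b' r' ->
  Cmod z + d <= r -> Cmod z' + d <= r' ->
  (forall h, Cmod h < d -> psum b (z + h) = psum b' (z' + h)) ->
  forall k h, Cmod h < d -> psum (shifted b k) (z + h) = psum (shifted b' k) (z' + h).
Proof.
intros hb hb' hz hz' heq.
assert (hin : forall (w : C) s h, Cmod w + d <= s -> Cmod h < d -> Cmod (w + h) < s).
{ intros w s h h1 h2. apply Rle_lt_trans with (1 := Cmod_triangle _ _). lra. }
induction k as [|k IH]; intros h hh.
- rewrite (psum_ext (shifted b 0) b), (psum_ext (shifted b' 0) b') by apply shifted_0. auto.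
- assert (e : psum (shifted (shifted b k) 1) (z + h) = psum (shifted (shifted b' k) 1) (z' + h)).
  { apply (derivative_unique _ _ r r' (d - Cmod h)); try (apply shifted_converges; trivial); auto; [lra|].
    intros h' hh'. rewrite <- !Cplus_assoc. apply IH.
    apply Rle_lt_trans with (1 := Cmod_triangle _ _). lra. }
  rewrite (psum_ext _ _ _ (shifted_succ b k)), (psum_ext _ _ _ (shifted_succ b' k)) in e.
  rewrite (psum_scal (shifted b (S k)) r), (psum_scal (shifted b' (S k)) r') in e;
    try (apply shifted_converges; trivial); auto.
  assert (hk : RtoC (INR k + 1) <> 0%C).
  { intros h'. apply RtoC_inj in h'. generalize (pos_INR k); lra. }
  apply (f_equal (Cmult (/ RtoC (INR k + 1)))) in e.
  rewrite !Cmult_assoc, Cinv_l, !Cmult_1_l in e by trivial. trivial.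
Qed.

Lemma sum_n_csum (b : nat -> C) (z : C) n :
  sum_n (fun k => @scal C_AbsRing C_NormedModule (@pow_n C_AbsRing z k) (b k)) n = csum (pterm b z) (S n).
Proof.
assert (hp : forall k, @pow_n C_AbsRing z k = (z ^ k)%C).
{ induction k; [reflexivity|]. simpl. now rewrite IHk. }
induction n.
- rewrite sum_O. simpl csum. unfold pterm. rewrite hp. change (z ^ 0 * b O = 0 + b O * z ^ 0)%C. ring.
- rewrite sum_Sn, IHn, hp. change (csum (pterm b z) (S n) + z ^ S n * b (S n) = csum (pterm b z) (S n) + b (S n) * z ^ S n)%C.
  ring.
Qed.

Lemma is_pseries_Clim (b : nat -> C) (z l : C) :
  @is_pseries C_AbsRing C_NormedModule b z l -> Clim (csum (pterm b z)) l.
Proof.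
intros h. apply Clim_succ. intros e he.
unfold is_pseries, is_series in h.
assert (h' := proj1 (filterlim_locally_ball_norm _ _) h (mkposreal e he)).
destruct h' as [N hN]. exists N. intros i hi. specialize (hN i hi).
unfold ball_norm in hN. rewrite sum_n_csum in hN. exact hN.
Qed.

Lemma Clim_term_bounded u l : Clim (csum u) l -> exists K, forall n, Cmod (u n) <= K.
Proof.
intros h. destruct (h 1 Rlt_0_1) as [N hN].
exists (rsum (fun n => Cmod (u n)) N + 2). intros n.
destruct (Nat.lt_ge_cases n N) as [hn|hn].
- assert (p : forall i, 0 <= Cmod (u i)) by (intros; apply Cmod_ge_0).
  assert (h1 := rsum_increment_le (fun n => Cmod (u n)) (S n) (N - S n) p).
  replace (S n + (N - S n))%nat with N in h1 by lia. simpl in h1.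
  assert (h2 := rsum_increment_le (fun n => Cmod (u n)) O n p). simpl in h2. lra.
- assert (a := hN n hn). assert (c := hN (S n) ltac:(lia)). simpl in c.
  replace (u n) with ((csum u n + u n - l) + - (csum u n - l))%C by ring.
  apply Rle_trans with (1 := Cmod_triangle _ _). rewrite Cmod_opp.
  assert (0 <= rsum (fun n => Cmod (u n)) N).
  { rewrite <- (Rmult_0_r (INR N)), <- rsum_const. apply rsum_le. intros; apply Cmod_ge_0. }
  lra.
Qed.

Lemma pseries_converges_on (b : nat -> C) (r : R) (g : C -> C) :
  (forall z, Cmod z < r -> @is_pseries C_AbsRing C_NormedModule b z (g z)) -> converges_on b r.
Proof.
intros h rho hrho. assert (hr : Cmod rho = rho) by (rewrite Cmod_R, Rabs_pos_eq; lra).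
destruct (Clim_term_bounded _ _ (is_pseries_Clim _ _ _ (h (RtoC rho) ltac:(lra)))) as [K hK].
exists K. intros n. specialize (hK n). unfold pterm in hK. now rewrite Cmod_mult, Cmod_pow, hr in hK.
Qed.

(** * Cauchy estimates along the arc *)

Lemma expi_lipschitz s t : Cmod (expi s - expi t) <= 2 * Rabs (s - t).
Proof.
assert (L : forall f f' : R -> R, (forall x, derivable_pt_lim f x (f' x)) -> (forall x, Rabs (f' x) <= 1) ->
   Rabs (f s - f t) <= Rabs (s - t)).
{ intros f f' hf hb. destruct (MVT_gen f t s f') as [c [_ hc]].
  - intros x _. apply is_derive_Reals, hf.
  - intros x _. apply derivable_continuous_pt. exists (f' x). apply hf.
  - rewrite hc, Rabs_mult. rewrite <- (Rmult_1_l (Rabs (s - t))) at 2.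
    apply Rmult_le_compat_r; [apply Rabs_pos|trivial]. }
apply Rle_trans with (1 := Cmod_le_Re_Im _).
replace (Re (expi s - expi t)) with (cos s - cos t) by reflexivity.
replace (Im (expi s - expi t)) with (sin s - sin t) by reflexivity.
assert (h1 := L cos (fun x => - sin x) derivable_pt_lim_cos).
assert (h2 := L sin cos derivable_pt_lim_sin).
assert (hc : forall x, Rabs (cos x) <= 1) by (intros; apply Rabs_le, COS_bound).
assert (hs : forall x, Rabs (- sin x) <= 1) by (intros; rewrite Rabs_Ropp; apply Rabs_le, SIN_bound).
specialize (h1 hs). specialize (h2 hc). lra.
Qed.

(** Cauchy's estimates at the points [r * expi t] near the circle. The one parameter [d] measures
    how near they are, the radius of the estimate and its constant, so that the property is
    inherited by smaller [d], as compactness requires. *)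
Definition taylor_small (a : nat -> C) (d t : R) : Prop :=
  forall r k, 1 - d < r < 1 -> Cmod (psum (shifted a k) (r * expi t)) * d ^ k <= / d.

Lemma local_taylor_small (a : nat -> C) (f g : C -> C) (t0 : R) :
  (forall z, unit_disc z -> @is_pseries C_AbsRing C_NormedModule a z (f z)) ->
  (forall z, unit_disc z -> g z = f z) -> analytic_at g (expi t0) ->
  exists d, 0 < d /\ forall t, Rabs (t - t0) < d -> taylor_small a d t.
Proof.
intros hf hgf [b [R0 hb]].
set (rho := R0 / 2). assert (hR0 := cond_pos R0).
assert (ha : converges_on a 1) by (apply (pseries_converges_on a 1 f); exact hf).
assert (hb' : converges_on b R0).
{ apply (pseries_converges_on b R0 (fun w => g (expi t0 + w)%C)). intros w hw.
  replace w with ((expi t0 + w) - expi t0)%C at 1 by ring. apply hb.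
  now replace (expi t0 + w - expi t0)%C with w by ring. }
destruct (hb' rho) as [K hK]; [unfold rho; lra|].
assert (hK0 := geom_bound_pos _ _ _ hK).
(* The distance of [r * expi t] from [expi t0] is at most [3 * d]: [2 * d] for the angle and [d] for
   the modulus. With [d <= R0 / 24] it stays below [rho / 2], and [/ (2 * K + 1)] lets [/ d] absorb
   the constant [2 * K]. *)
set (d := Rmin (Rmin (1 / 2) (R0 / 24)) (/ (2 * K + 1))).
assert (hd : 0 < d).
{ repeat apply Rmin_glb_lt; try lra. apply Rinv_0_lt_compat; lra. }
assert (d1 : d <= 1 / 2) by (apply Rle_trans with (1 := Rmin_l _ _), Rmin_l).
assert (d2 : d <= R0 / 24) by (apply Rle_trans with (1 := Rmin_l _ _), Rmin_r).
assert (d3 : 2 * K + 1 <= / d).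
{ rewrite <- (Rinv_inv (2 * K + 1)). apply Rinv_le_contravar; trivial. apply Rmin_r. }
exists d; split; trivial. intros t ht r k hr.
set (z := (r * expi t)%C). set (w := (z - expi t0)%C).
assert (hz : Cmod z = r) by (unfold z; rewrite Cmod_mult, Cmod_expi, Cmod_R, Rabs_pos_eq; lra).
assert (hw : Cmod w <= 3 * d).
{ unfold w, z. replace (r * expi t - expi t0)%C with ((expi t - expi t0) + (r - 1)%R * expi t)%C
    by (rewrite RtoC_minus; ring).
  apply Rle_trans with (1 := Cmod_triangle _ _).
  rewrite Cmod_mult, Cmod_expi, Cmod_R, Rabs_left by lra.
  assert (h := expi_lipschitz t t0). lra. }
assert (heq : psum (shifted a k) z = psum (shifted b k) w).
{ set (dd := Rmin (1 - r) (R0 / 2)).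
  assert (hdd : 0 < dd) by (apply Rmin_glb_lt; lra).
  assert (e1 : dd <= 1 - r) by apply Rmin_l.
  replace z with (z + 0)%C by ring. replace w with (w + 0)%C by ring.
  apply (taylor_unique a b 1 R0 z w dd); trivial; try lra; [|rewrite Cmod_0; lra].
  intros h hh.
  assert (hzh : Cmod (z + h) < 1) by (apply Rle_lt_trans with (1 := Cmod_triangle _ _); lra).
  transitivity (f (z + h)%C).
  - apply psum_eq, is_pseries_Clim, hf, hzh.
  - symmetry. apply psum_eq, is_pseries_Clim.
    rewrite <- hgf by exact hzh.
    replace (w + h)%C with (z + h - expi t0)%C by (unfold w; ring). apply hb.
    replace (z + h - expi t0)%C with (w + h)%C by (unfold w; ring).
    apply Rle_lt_trans with (1 := Cmod_triangle _ _). lra. }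
rewrite heq.
assert (hwr : Cmod w < rho) by (unfold rho; lra).
assert (hbd := psum_shifted_bound b K rho k w hK hwr).
assert (hq : / (1 - Cmod w / rho) <= 2).
{ rewrite <- (Rinv_inv 2). apply Rinv_le_contravar; [lra|].
  assert (Cmod w / rho <= 1 / 2); [|lra].
  apply Rmult_le_reg_r with rho; [unfold rho; lra|].
  unfold Rdiv at 1; rewrite Rmult_assoc, Rinv_l, Rmult_1_r by (unfold rho; lra). unfold rho; lra. }
assert (hq0 : 0 < / (1 - Cmod w / rho)).
{ apply Rinv_0_lt_compat. assert (Cmod w / rho < 1); [|lra].
  apply Rmult_lt_reg_r with rho; [unfold rho; lra|].
  unfold Rdiv at 1; rewrite Rmult_assoc, Rinv_l, Rmult_1_r by (unfold rho; lra). unfold rho; lra. }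
apply Rle_trans with (K * (/ rho) ^ k * 2 ^ (S k) * d ^ k).
- apply Rmult_le_compat_r; [apply pow_le; lra|]. apply Rle_trans with (1 := hbd).
  apply Rmult_le_compat_l.
  + apply Rmult_le_pos; trivial. apply pow_le, Rlt_le, Rinv_0_lt_compat. unfold rho; lra.
  + apply pow_incr; lra.
- rewrite <- tech_pow_Rmult.
  replace (K * (/ rho) ^ k * (2 * 2 ^ k) * d ^ k) with (2 * K * ((/ rho) * 2 * d) ^ k) by (rewrite !Rpow_mult_distr; ring).
  assert (hsm : (/ rho * 2 * d) ^ k <= 1).
  { rewrite <- (pow1 k). apply pow_incr. split.
    - apply Rmult_le_pos; [|lra]. apply Rmult_le_pos; [|lra]. apply Rlt_le, Rinv_0_lt_compat; unfold rho; lra.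
    - apply Rmult_le_reg_l with rho; [unfold rho; lra|].
      replace (rho * (/ rho * 2 * d)) with (2 * d) by (field; unfold rho; lra). unfold rho; lra. }
  assert (0 <= (/ rho * 2 * d) ^ k).
  { apply pow_le. apply Rmult_le_pos; [|lra]. apply Rmult_le_pos; [|lra]. apply Rlt_le, Rinv_0_lt_compat; unfold rho; lra. }
  nra.
Qed.

Lemma interval_uniform (a b : R) (Pr : R -> R -> Prop) :
  (forall d d' w, 0 < d' <= d -> Pr d w -> Pr d' w) ->
  (forall x, a <= x <= b -> exists d, 0 < d /\ forall w, Rabs (w - x) < d -> Pr d w) ->
  exists d, 0 < d /\ forall w, a <= w <= b -> Pr d w.
Proof.
intros mono loc.
assert (H : forall u : R, exists d : posreal, a <= u <= b -> forall w, Rabs (w - u) < d -> Pr d w).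
{ intros u. destruct (classic (a <= u <= b)) as [h|h].
  - destruct (loc u h) as [d [hd h']]. now exists (mkposreal d hd).
  - exists (mkposreal 1 Rlt_0_1). intros; contradiction. }
destruct (choice _ H) as [delta hdelta].
destruct (compactness_value_1d a b delta) as [d hd].
exists d; split; [apply cond_pos|]. intros w hw.
apply NNPP; intros nP. apply (hd w hw). intros [t [ht [h1 h2]]].
apply nP, mono with (delta t); [split; trivial; apply cond_pos|]. now apply hdelta.
Qed.

(** An expansion at one point of the arc serves all nearby arguments, so compactness gives a single
    [d] and an overshoot by [d] at both ends of the arc. This overshoot is the room that is spent
    later on strict inequalities. *)
Lemma arc_taylor_small (a : nat -> C) (f g : C -> C) (Delta : R) :
  (forall z, unit_disc z -> @is_pseries C_AbsRing C_NormedModule a z (f z)) ->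
  (forall z, unit_disc z -> g z = f z) -> (forall z, arc Delta z -> analytic_at g z) ->
  0 <= Delta ->
  exists d, 0 < d < 1 /\ forall t, Rabs t <= PI * Delta + d -> taylor_small a d t.
Proof.
intros hf hgf han hD.
assert (mono : forall d d' t, 0 < d' <= d -> taylor_small a d t -> taylor_small a d' t).
{ intros d d' t hd h r k hr. apply Rle_trans with (/ d).
  - apply Rle_trans with (2 := h r k ltac:(lra)). apply Rmult_le_compat_l; [apply Cmod_ge_0|].
    apply pow_incr; lra.
  - apply Rinv_le_contravar; lra. }
destruct (interval_uniform (- (PI * Delta)) (PI * Delta)
   (fun d t => forall t', Rabs (t' - t) < d -> taylor_small a d t')) as [d [hd h]].
- intros d d' w hd h t' ht'. apply mono with d; trivial. apply h; lra.
- intros x hx.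
  destruct (local_taylor_small a f g x hf hgf) as [d [hd h]].
  { apply han. exists x. split; trivial. now apply Rabs_le. }
  exists (d / 2). split; [lra|]. intros w hw t' ht'. apply mono with d; [lra|]. apply h.
  replace (t' - x) with ((t' - w) + (w - x)) by ring.
  apply Rle_lt_trans with (1 := Rabs_triang _ _). lra.
- set (d' := Rmin (d / 2) (1 / 2)).
  assert (d1 : d' <= d / 2) by apply Rmin_l. assert (d2 : d' <= 1 / 2) by apply Rmin_r.
  assert (hd' : 0 < d') by (apply Rmin_glb_lt; lra).
  assert (hpi := PI_RGT_0). assert (hpd : 0 <= PI * Delta) by (apply Rmult_le_pos; lra).
  exists d'. split; [lra|]. intros t ht. apply mono with d; [lra|].
  apply Rabs_le_between in ht.
  destruct (Rle_lt_dec (PI * Delta) t) as [h1|h1].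
  + apply (h (PI * Delta)); [lra|]. rewrite Rabs_pos_eq; lra.
  + destruct (Rle_lt_dec t (- (PI * Delta))) as [h2|h2].
    * apply (h (- (PI * Delta))); [lra|]. rewrite Rabs_left1; lra.
    * apply (h t); [lra|]. rewrite Rminus_diag, Rabs_R0; lra.
Qed.

(** * Binomial weights *)

(* The binomial weights [C(j,k) r^(j-k) (1-r)^k], by Pascal's recursion. *)
Fixpoint kernel (r : R) (j k : nat) : R :=
  match j with
  | O => match k with O => 1 | S _ => 0 end
  | S j => r * kernel r j k + match k with O => 0 | S k => (1 - r) * kernel r j k end
  end.

Lemma kernel_small r j : forall k, (j < k)%nat -> kernel r j k = 0.
Proof.
induction j; intros [|k] h; try lia; simpl; trivial.
rewrite !IHj by lia. ring.
Qed.

Lemma kernel_bin r j : forall k n, j = (n + k)%nat -> kernel r j k = bin j k * r ^ n * (1 - r) ^ k.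
Proof.
induction j; intros k n e.
- replace k with O by lia. replace n with O by lia. simpl. ring.
- destruct k as [|k].
  + replace n with (S j) by lia. simpl kernel. rewrite (IHj O j) by lia. rewrite !bin_0. simpl. ring.
  + rewrite bin_S. simpl kernel. rewrite (IHj k n) by lia. destruct n as [|n].
    * rewrite kernel_small, (bin_small j (S k)) by lia. simpl. ring.
    * rewrite (IHj (S k) n) by lia. simpl. ring.
Qed.

Lemma kernel_nonneg r j : 0 < r < 1 -> forall k, 0 <= kernel r j k.
Proof.
intros hr. induction j; intros k; simpl; [destruct k; lra|].
assert (h1 := IHj k). destruct k as [|k]; [nra|]. assert (h2 := IHj k). nra.
Qed.

(** [kernel r j k] is the probability of [k] successes in [j] trials of success probability [1 - r];
    this is its generating function. *)
Lemma kernel_generating r x j : forall N, (j < N)%nat ->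
  rsum (fun k => kernel r j k * x ^ k) N = (r + (1 - r) * x) ^ j.
Proof.
induction j; intros N hN.
- destruct N as [|N]; [lia|]. rewrite rsum_shift. simpl.
  rewrite (rsum_ext _ (fun _ => 0)) by (intros; ring). rewrite rsum_const. ring.
- destruct N as [|N]; [lia|]. rewrite rsum_shift. simpl kernel at 1.
  rewrite (rsum_ext _ (fun k => r * (kernel r j (S k) * x ^ S k) + (1 - r) * x * (kernel r j k * x ^ k)))
    by (intros; simpl; ring).
  rewrite rsum_plus, !rsum_scal, (IHj N) by lia.
  assert (h := IHj (S N) ltac:(lia)). rewrite rsum_shift in h.
  rewrite pow_O in *. apply (f_equal (Rmult r)) in h. rewrite <- tech_pow_Rmult. lra.
Qed.

Lemma expi_pow t n : (expi t ^ n)%C = expi (INR n * t).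
Proof.
induction n; [simpl; now rewrite Rmult_0_l, expi_0|].
rewrite Cpow_S, IHn, S_INR, <- expi_plus. f_equal. ring.
Qed.

Definition kernel_term (a : nat -> C) (r : R) (k : nat) (j : nat) : C := (kernel r j k * a j)%C.

(** The link between weights and Taylor coefficients: the Fourier transform of the weighted
    coefficients is [((1 - r) * expi t) ^ k] times the [k]-th Taylor coefficient at [r * expi t].
    The terms with [j < k] vanish. *)
Lemma csum_kernel a r k t N :
  csum (fun j => kernel_term a r k j * expi (INR j * t))%C (N + k)
  = (((1 - r) ^ k)%R * expi (INR k * t) * csum (pterm (shifted a k) (r * expi t)) N)%C.
Proof.
induction N.
- simpl. rewrite Cmult_0_r.
  assert (h : forall n, (n <= k)%nat -> csum (fun j => kernel_term a r k j * expi (INR j * t))%C n = 0%C).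
  { induction n; intros hn; simpl; trivial. rewrite IHn by lia. unfold kernel_term.
    rewrite kernel_small by lia. ring. }
  now apply h.
- simpl csum. rewrite IHN, Cmult_plus_distr_l. f_equal.
  unfold kernel_term, pterm, shifted. rewrite (kernel_bin r (N + k) k N) by trivial.
  rewrite Cpow_mult_l, <- RtoC_pow, expi_pow, plus_INR, Rmult_plus_distr_r, expi_plus, !RtoC_mult.
  ring.
Qed.

Lemma kernel_sum_bound (a : nat -> C) (r eta : R) : converges_on a 1 -> 0 < r < 1 -> 0 < eta ->
  exists K, 0 < K /\ forall k N, rsum (fun j => Cmod (kernel_term a r k j)) N <= K * exp (INR k * eta).
Proof.
intros ha hr heta.
(* Bounding the coefficients by powers of [/ q] gives growth with ratio [(1 - r) / (q - r)] in [k];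
   [q] makes this ratio [exp eta]. *)
set (q := r + (1 - r) * exp (- eta)).
assert (he : 0 < exp (- eta) < 1).
{ split; [apply exp_pos|]. rewrite <- exp_0. apply exp_increasing; lra. }
assert (hq : r < q < 1) by (unfold q; nra).
destruct (ha q ltac:(lra)) as [K hK].
assert (hK0 := geom_bound_pos _ _ _ hK).
assert (hrq : 0 < 1 - r / q).
{ assert (r / q < 1); [|lra]. apply Rmult_lt_reg_r with q; [lra|]. unfold Rdiv; rewrite Rmult_assoc, Rinv_l; lra. }
exists (K * / (1 - r / q) + 1).
assert (hi : 0 < / (1 - r / q)) by now apply Rinv_0_lt_compat.
split; [nra|]. intros k N.
assert (p : forall j, 0 <= Cmod (kernel_term a r k j)) by (intros; apply Cmod_ge_0).
apply Rle_trans with (1 := rsum_increment_le _ N k p).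
assert (e : rsum (fun j => Cmod (kernel_term a r k j)) (N + k)
   = (1 - r) ^ k * rsum (fun n => Cmod (shifted a k n) * r ^ n) N).
{ induction N.
  - simpl. rewrite Rmult_0_r.
    assert (h : forall n, (n <= k)%nat -> rsum (fun j => Cmod (kernel_term a r k j)) n = 0).
    { induction n; intros hn; simpl; trivial. rewrite IHn by lia. unfold kernel_term.
      rewrite kernel_small, Cmult_0_l, Cmod_0 by lia. ring. }
    now apply h.
  - simpl rsum. rewrite IHN, Rmult_plus_distr_l. f_equal.
    unfold kernel_term, shifted. rewrite (kernel_bin r (N + k) k N) by trivial.
    rewrite !Cmod_mult, !Cmod_R, !Rabs_mult, <- !RPow_abs, (Rabs_pos_eq r), (Rabs_pos_eq (1 - r)) by lra. ring. }
rewrite e.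
assert (hs := shifted_sum a K q k r N hK ltac:(lra) ltac:(lra)).
apply Rle_trans with ((1 - r) ^ k * (K * (/ q) ^ k * (/ (1 - r / q)) ^ S k)).
{ apply Rmult_le_compat_l; trivial. apply pow_le; lra. }
rewrite <- tech_pow_Rmult.
replace ((1 - r) ^ k * (K * (/ q) ^ k * (/ (1 - r / q) * (/ (1 - r / q)) ^ k)))
  with (K * / (1 - r / q) * ((1 - r) * / q * / (1 - r / q)) ^ k) by (rewrite !Rpow_mult_distr; ring).
replace ((1 - r) * / q * / (1 - r / q)) with (exp eta).
- rewrite exp_pow. apply Rmult_le_compat_r; [apply Rlt_le, exp_pos|lra].
- replace ((1 - r) * / q * / (1 - r / q)) with ((1 - r) / (q - r)) by (field; lra).
  replace (q - r) with ((1 - r) * exp (- eta)) by (unfold q; ring).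
  rewrite exp_Ropp. assert (h := exp_pos eta). field. lra.
Qed.

(** At [r = 1 - d / 4] the factor [(1 - r) ^ k] against Cauchy's [d ^ (-k)] leaves [4 ^ (-k)]. The
    truncation is uniform in [t] because the tails are dominated by a series in [r] alone. *)
Lemma kernel_sum_small (a : nat -> C) (d : R) (k : nat) (e : R) : converges_on a 1 ->
  0 < d < 1 -> 0 < e -> ev (fun N => forall t, taylor_small a d t ->
    Cmod (csum (fun j => kernel_term a (1 - d / 4) k j * expi (INR j * t))%C N) <= / d * (/ 4) ^ k + e).
Proof.
intros ha hd he. set (r := 1 - d / 4).
assert (hr : 0 < r < 1) by (unfold r; lra).
destruct (ha ((1 + r) / 2)) as [K hK]; [lra|].
assert (hp : forall n, 0 <= Cmod (shifted a k n) * r ^ n).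
{ intros n. apply Rmult_le_pos; [apply Cmod_ge_0|apply pow_le; lra]. }
destruct (rsum_bounded_lim _ _ hp (fun N => shifted_sum a K ((1 + r) / 2) k r N hK ltac:(lra) ltac:(lra)))
  as [L [hL hL']].
destruct (is_lim_seq_ev _ _ hL e he) as [N0 hN0].
exists (N0 + k)%nat. intros N hN t ht.
replace N with ((N - k) + k)%nat by lia. rewrite csum_kernel.
assert (hz : Cmod (r * expi t) = r) by (rewrite Cmod_mult, Cmod_expi, Cmod_R, Rabs_pos_eq; lra).
assert (hlim := psum_spec (shifted a k) 1 (r * expi t)%C (shifted_converges a 1 k ha) ltac:(rewrite hz; lra)).
assert (hle : forall n, Cmod (pterm (shifted a k) (r * expi t) n) <= Cmod (shifted a k n) * r ^ n).
{ intros n. unfold pterm. rewrite Cmod_mult, Cmod_pow, hz. lra. }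
assert (htail := Clim_tail _ _ _ L (N - k) hle hL' hlim).
assert (hN' := hN0 (N - k)%nat ltac:(lia)). apply Rabs_lt_between in hN'.
rewrite !Cmod_mult, Cmod_expi, Cmod_R, Rmult_1_r, Rabs_pos_eq by (apply pow_le; lra).
specialize (ht r k ltac:(unfold r; lra)).
set (P := psum (shifted a k) (r * expi t)) in *. set (Q := csum _ (N - k)) in *.
assert (hQ : Cmod Q <= Cmod P + e).
{ assert (h := Cmod_triangle_inv Q (Q - P)). replace (Q - (Q - P))%C with P in h by ring. lra. }
replace (1 - r) with (/ 4 * d) by (unfold r; field). rewrite Rpow_mult_distr.
assert (h4 : 0 < (/ 4) ^ k) by (apply pow_lt; lra).
assert (hdk : 0 < d ^ k) by (apply pow_lt; lra).
assert (h4' : (/ 4) ^ k <= 1) by (rewrite <- (pow1 k); apply pow_incr; lra).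
assert (hdk' : d ^ k <= 1) by (rewrite <- (pow1 k); apply pow_incr; lra).
apply Rle_trans with ((/ 4) ^ k * d ^ k * (Cmod P + e)).
- apply Rmult_le_compat_l; trivial. apply Rmult_le_pos; lra.
- assert ((/ 4) ^ k * d ^ k <= 1).
  { rewrite <- (Rmult_1_r 1). apply Rmult_le_compat; lra. }
  nra.
Qed.

(** By the generating function at [1 / 2], the values [k < c * m] carry mass at most
    [2 ^ (c * m) * s ^ m], which is eventually below one half. The rest is shared by at most [m + 1]
    values, so one of them has the stated weight. *)
Lemma kernel_peak (r : R) : 0 < r < 1 -> exists c, 0 < c /\ ev (fun m => exists k, (k <= m)%nat /\
  c * INR m <= INR k /\ / (2 * (INR m + 1)) <= kernel r m k).
Proof.
intros hr. set (s := (1 + r) / 2).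
assert (hs : 0 < s < 1) by (unfold s; lra).
assert (hls : ln s < 0) by (rewrite <- ln_1; apply ln_increasing; lra).
assert (hl2 : 0 < ln 2) by (rewrite <- ln_1; apply ln_increasing; lra).
(* Chosen so that [2 ^ (c * m)] is [s ^ (- m / 2)], half of the available decay. *)
set (c := - ln s / (2 * ln 2)).
exists c. split; [apply Rdiv_lt_0_compat; lra|].
destruct (nfloor_ex (2 * ln 2 / - ln s)) as [M [_ hM]]; [apply Rdiv_le_0_compat; lra|].
exists (S M). intros m hm.
assert (hm' : INR M + 1 <= INR m) by (rewrite <- S_INR; now apply le_INR).
apply NNPP; intros hno.
assert (hall : forall k, (k < S m)%nat -> kernel r m k * 1 ^ k <=
   exp (c * INR m * ln 2) * (kernel r m k * (/ 2) ^ k) + / (2 * (INR m + 1))).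
{ intros k hk. rewrite pow1, Rmult_1_r. assert (h0 := kernel_nonneg r m hr k).
  assert (h1 : 0 < / (2 * (INR m + 1))) by (apply Rinv_0_lt_compat; generalize (pos_INR m); lra).
  assert (h2 : 0 <= exp (c * INR m * ln 2) * (kernel r m k * (/ 2) ^ k)).
  { apply Rmult_le_pos; [apply Rlt_le, exp_pos|]. apply Rmult_le_pos; trivial. apply pow_le; lra. }
  destruct (Rle_lt_dec (c * INR m) (INR k)) as [h|h].
  - assert (kernel r m k < / (2 * (INR m + 1))); [|lra].
    apply Rnot_le_lt; intros h'. apply hno; exists k. repeat split; trivial; lia.
  - assert (hpow : 1 <= exp (c * INR m * ln 2) * (/ 2) ^ k).
    { replace ((/ 2) ^ k) with (exp (- (INR k * ln 2))).
      - rewrite <- exp_plus, <- exp_0. apply exp_le_compat. nra.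
      - rewrite exp_Ropp, <- exp_pow, exp_ln by lra. now rewrite pow_inv. }
    nra. }
assert (hsum := rsum_le _ _ (S m) hall).
rewrite (kernel_generating r 1 m (S m)) in hsum by lia.
rewrite rsum_plus, rsum_scal, (kernel_generating r (/ 2) m (S m)), rsum_const in hsum by lia.
replace (r + (1 - r) * 1) with 1 in hsum by ring. rewrite pow1 in hsum.
replace (r + (1 - r) * / 2) with s in hsum by (unfold s; field).
replace (INR (S m) * / (2 * (INR m + 1))) with (/ 2) in hsum by (rewrite S_INR; generalize (pos_INR m); intros; field; lra).
assert (e1 : exp (c * INR m * ln 2) * s ^ m = exp (INR m * ln s / 2)).
{ rewrite <- (exp_ln s) at 1 by lra. rewrite exp_pow, <- exp_plus. f_equal. unfold c. field. lra. }
rewrite e1 in hsum.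
assert (h3 : exp (INR m * ln s / 2) < exp (- ln 2)).
{ apply exp_increasing.
  apply (Rmult_lt_compat_r (- ln s)) in hM; [|lra].
  replace (2 * ln 2 / - ln s * - ln s) with (2 * ln 2) in hM by (field; lra). nra. }
rewrite exp_Ropp, exp_ln in h3 by lra. lra.
Qed.

(** * Interpolation by polynomials of exponential growth *)

Lemma expi_eq_1 x : 0 < Rabs x < 2 * PI -> expi x <> 1%C.
Proof.
intros hx h. apply (f_equal Re) in h. simpl in h.
assert (hc : cos (Rabs x) = 1).
{ unfold Rabs; destruct (Rcase_abs x); trivial. now rewrite cos_neg. }
replace (Rabs x) with (2 * (Rabs x / 2)) in hc by field.
rewrite cos_2a_sin in hc.
assert (hs := sin_gt_0 (Rabs x / 2) ltac:(lra) ltac:(lra)). nra.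
Qed.

Lemma expi_2PI_nat n : expi (INR n * (2 * PI)) = 1%C.
Proof.
rewrite <- expi_pow. replace (expi (2 * PI)) with (RtoC 1).
- apply Cpow_1_l.
- unfold expi. now rewrite cos_2PI, sin_2PI.
Qed.

Lemma expi_opp t : (expi t * expi (- t))%C = 1%C.
Proof. rewrite <- expi_plus, Rplus_opp_r. apply expi_0. Qed.

Lemma csum_geom w n : ((w - 1) * csum (fun l => w ^ l) n = w ^ n - 1)%C.
Proof.
induction n; simpl; [ring|]. rewrite Cmult_plus_distr_l, IHn. ring.
Qed.

Lemma csum_const c n : csum (fun _ => c) n = (INR n * c)%C.
Proof. induction n; [simpl; ring|]. rewrite S_INR, RtoC_plus; simpl. rewrite IHn. ring. Qed.

Lemma csum_swap (f : nat -> nat -> C) m n :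
  csum (fun i => csum (fun j => f i j) m) n = csum (fun j => csum (fun i => f i j) n) m.
Proof.
induction n; simpl.
- induction m; simpl; trivial. rewrite <- IHm. ring.
- rewrite IHn, <- csum_plus. trivial.
Qed.

Lemma csum_single (f : nat -> C) j n : (j < n)%nat -> (forall i, (i < n)%nat -> i <> j -> f i = 0%C) ->
  csum f n = f j.
Proof.
induction n; intros hj h; [lia|]. simpl. destruct (Nat.eq_dec j n) as [->|hne].
- assert (e : csum f n = 0%C); [|rewrite e; ring].
  rewrite (csum_ext _ (fun _ => 0%C)), csum_const; [ring|]. intros i hi. apply h; lia.
- rewrite IHn; try lia; [|intros; apply h; lia]. rewrite (h n); [ring|lia|lia].
Qed.

Definition node (N l : nat) : R := 2 * PI * INR l / INR N - PI.

Lemma root_orthogonality N i j : (i < N)%nat -> (j < N)%nat ->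
  csum (fun l => expi (INR i * node N l) * expi (- (INR j * node N l)))%C N
  = if Nat.eq_dec i j then RtoC (INR N) else 0%C.
Proof.
intros hi hj. assert (hN : 0 < INR N) by (apply lt_0_INR; lia). assert (hpi := PI_RGT_0).
destruct (Nat.eq_dec i j) as [->|hne].
- rewrite (csum_ext _ (fun _ => 1%C)), csum_const; [ring|]. intros l _. apply expi_opp.
- set (x := (INR i - INR j) * (2 * PI / INR N)).
  rewrite (csum_ext _ (fun l => expi (- ((INR i - INR j) * PI)) * expi x ^ l)%C).
  2:{ intros l _. rewrite expi_pow, <- !expi_plus. f_equal. unfold x, node. field. lra. }
  rewrite (csum_scal _ (fun l => expi x ^ l)%C).
  assert (hw : expi x <> 1%C).
  { apply expi_eq_1. unfold x. rewrite Rabs_mult, (Rabs_pos_eq (2 * PI / INR N)) by (apply Rdiv_le_0_compat; lra).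
    assert (hd : 0 < Rabs (INR i - INR j) < INR N).
    { split.
      - apply Rabs_pos_lt. intros h. apply hne, INR_eq. lra.
      - apply Rabs_lt_between. generalize (pos_INR i) (pos_INR j) (lt_INR _ _ hi) (lt_INR _ _ hj). lra. }
    assert (hq : 0 < 2 * PI / INR N) by (apply Rdiv_lt_0_compat; lra).
    split; [apply Rmult_lt_0_compat; lra|].
    replace (2 * PI) with (INR N * (2 * PI / INR N)) at 2 by (field; lra).
    apply Rmult_lt_compat_r; lra. }
  assert (hwN : (expi x ^ N = 1)%C).
  { rewrite expi_pow. unfold x.
    replace (INR N * ((INR i - INR j) * (2 * PI / INR N))) with (INR i * (2 * PI) + - (INR j * (2 * PI))) by (field; lra).
    rewrite expi_plus, expi_2PI_nat. assert (h := expi_opp (INR j * (2 * PI))).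
    rewrite expi_2PI_nat, Cmult_1_l in h. rewrite h. ring. }
  assert (hg := csum_geom (expi x) N). rewrite hwN in hg.
  assert (hne' : (expi x - 1)%C <> 0%C).
  { intros h. apply hw. replace (expi x) with ((expi x - 1) + 1)%C by ring. rewrite h. ring. }
  assert (hs : csum (fun l => expi x ^ l)%C N = 0%C).
  { apply (f_equal (Cmult (/ (expi x - 1)))) in hg. rewrite Cmult_assoc, Cinv_l, Cmult_1_l in hg by trivial.
    rewrite hg. ring. }
  rewrite hs. ring.
Qed.

(** The discrete transform at [N] nodes stands in for the Fourier integral, so that the approximants
    are finite exponential sums. *)
Lemma discrete_fourier_inversion (B : nat -> C) N j : (j < N)%nat ->
  csum (fun l => / INR N * csum (fun i => B i * expi (INR i * node N l)) N * expi (- (INR j * node N l)))%C N = B j.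
Proof.
intros hj. assert (hN : 0 < INR N) by (apply lt_0_INR; lia).
assert (hNc : RtoC (INR N) <> 0%C) by (intros h; apply RtoC_inj in h; lra).
rewrite (csum_ext _ (fun l => csum (fun i => / INR N * B i * (expi (INR i * node N l) * expi (- (INR j * node N l)))) N)%C).
2:{ intros l _. rewrite <- Cmult_assoc, (Cmult_comm (csum _ N)), Cmult_assoc, <- csum_scal.
    apply csum_ext. intros i _. ring. }
rewrite csum_swap.
rewrite (csum_single _ j N hj).
- rewrite csum_scal, root_orthogonality by trivial. destruct (Nat.eq_dec j j); [|contradiction].
  field. trivial.
- intros i hi hne. rewrite csum_scal, root_orthogonality by trivial.
  destruct (Nat.eq_dec i j); [contradiction|ring].
Qed.

Lemma node_bound N l : (l < N)%nat -> - PI <= node N l <= PI.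
Proof.
intros hl. assert (hN : 0 < INR N) by (apply lt_0_INR; lia). assert (hpi := PI_RGT_0).
assert (hl' := lt_INR _ _ hl). assert (h0 := pos_INR l).
assert (e : node N l = 2 * PI * (INR l / INR N) - PI) by (unfold node; field; lra). rewrite e.
assert (0 <= INR l / INR N <= 1).
{ split; [apply Rdiv_le_0_compat; lra|]. apply Rmult_le_reg_r with (INR N); trivial.
  unfold Rdiv; rewrite Rmult_assoc, Rinv_l; lra. }
nra.
Qed.

Lemma sin_cos_small x : Rabs (cos x - 1) <= x ^ 2 /\ Rabs (sin x - x) <= x ^ 2.
Proof.
assert (L : forall f f' : R -> R, (forall t, derivable_pt_lim f t (f' t)) ->
   (forall t, Rabs t <= Rabs x -> Rabs (f' t) <= Rabs x) -> Rabs (f x - f 0) <= x ^ 2).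
{ intros f f' hf hb. destruct (MVT_gen f 0 x f') as [c [hc e]].
  - intros t _. apply is_derive_Reals, hf.
  - intros t _. apply derivable_continuous_pt. exists (f' t). apply hf.
  - rewrite e, Rminus_0_r, Rabs_mult, <- pow2_abs. simpl. rewrite Rmult_1_r.
    apply Rmult_le_compat_r; [apply Rabs_pos|]. apply hb.
    unfold Rmin, Rmax in hc. destruct (Rle_dec 0 x).
    + rewrite !Rabs_pos_eq; lra.
    + rewrite (Rabs_left x) by lra. apply Rabs_le; lra. }
assert (hsin : forall t, Rabs (sin t) <= Rabs t).
{ intros t.
  destruct (MVT_gen sin 0 t cos) as [c [_ e]].
  - intros u _. apply is_derive_Reals, derivable_pt_lim_sin.
  - intros u _. apply derivable_continuous_pt. exists (cos u). apply derivable_pt_lim_sin.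
  - rewrite sin_0, !Rminus_0_r in e. rewrite e, Rabs_mult.
    assert (h1 : Rabs (cos c) <= 1) by apply Rabs_le, COS_bound. assert (h2 := Rabs_pos t). nra. }
split.
- rewrite <- cos_0. apply (L cos (fun t => - sin t)); [apply derivable_pt_lim_cos|].
  intros t ht. rewrite Rabs_Ropp. apply Rle_trans with (1 := hsin t); trivial.
- assert (h := L (fun t => sin t - t) (fun t => cos t - 1)). cbv beta in h.
  rewrite sin_0 in h. replace (sin x - x - (0 - 0)) with (sin x - x) in h by ring. apply h.
  + intros t. apply (derivable_pt_lim_minus sin id); [apply derivable_pt_lim_sin|apply derivable_pt_lim_id].
  + intros t ht. apply Rle_trans with (2 := ht).
    destruct (MVT_gen cos 0 t (fun t => - sin t)) as [c [_ e]].
    * intros u _. apply is_derive_Reals, derivable_pt_lim_cos.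
    * intros u _. apply derivable_continuous_pt. exists (- sin u). apply derivable_pt_lim_cos.
    * rewrite cos_0, Rminus_0_r in e. rewrite e, Rabs_mult, Rabs_Ropp.
      assert (h1 : Rabs (sin c) <= 1) by apply Rabs_le, SIN_bound. assert (h2 := Rabs_pos t). nra.
Qed.

Lemma Cpow_difference (a c : C) (Q : R) n : Cmod c = 1 -> (forall i, (i <= n)%nat -> Cmod a ^ i <= Q) ->
  Cmod (a ^ n - c ^ n) <= INR n * Cmod (a - c) * Q.
Proof.
intros hc. induction n; intros hQ.
- simpl. replace (1 - 1)%C with (RtoC 0) by ring. rewrite Cmod_0. lra.
- rewrite S_INR. replace (a ^ S n - c ^ S n)%C with ((a - c) * a ^ n + c * (a ^ n - c ^ n))%C by (simpl; ring).
  apply Rle_trans with (1 := Cmod_triangle _ _). rewrite !Cmod_mult, hc, Cmod_pow, Rmult_1_l.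
  assert (h1 := IHn ltac:(auto)). assert (h2 := hQ n ltac:(auto)).
  assert (h3 := Cmod_ge_0 (a - c)).
  assert (Cmod (a - c) * Cmod a ^ n <= Cmod (a - c) * Q) by now apply Rmult_le_compat_l.
  lra.
Qed.

(** At first order only the real part of [w] counts. This keeps the growth of the approximating
    powers tied to [|Im z|] instead of [|z|]. *)
Lemma Cmod_1_plus_le (w : C) : Cmod (1 + w) <= exp (Re w + Cmod w ^ 2 / 2).
Proof.
assert (h : Cmod (1 + w) ^ 2 <= exp (Re w + Cmod w ^ 2 / 2) ^ 2).
{ rewrite exp_pow. replace (INR 2 * (Re w + Cmod w ^ 2 / 2)) with (2 * Re w + Cmod w ^ 2) by (simpl; field).
  apply Rle_trans with (2 := exp_ineq1_le _). rewrite !Cmod2_alt.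
  right. unfold Re, Im; simpl. ring. }
assert (h0 := exp_pos (Re w + Cmod w ^ 2 / 2)).
apply Rnot_lt_le; intros hlt. nra.
Qed.

Lemma exp_half_le_2 : exp (1 / 2) <= 2.
Proof.
assert (h : exp (1 / 2) * exp (1 / 2) <= 3).
{ rewrite <- exp_plus. replace (1 / 2 + 1 / 2) with 1 by field. apply exp_le_3. }
 nra.
Qed.

Lemma poly_pow (P : C -> C) n : is_poly P -> is_poly (fun z => P z ^ n)%C.
Proof. intros hP; induction n; simpl; [constructor|now apply poly_mul]. Qed.

(* [exp (- i psi z)] is replaced by the polynomial [(1 - i psi z / M) ^ M]. *)
Lemma exponential_sum_poly (g : nat -> C) (psi : nat -> R) (N J : nat) (G beta e : R) :
  0 <= beta -> 0 <= G -> 0 < e ->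
  (forall l, (l < N)%nat -> Cmod (g l) <= G /\ Rabs (psi l) <= beta) ->
  exists F, is_poly F /\
    (forall z, Cmod z <= INR J -> Cmod (F z) <= 2 * (INR N * G) * exp (beta * Rabs (Im z))) /\
    (forall j, (j <= J)%nat ->
       Cmod (F (INR j) - csum (fun l => g l * expi (- (INR j * psi l))) N) <= e)%C.
Proof.
intros hbeta hG he hg.
set (Y := beta * INR J).
assert (hN := pos_INR N).
assert (hNG : 0 <= INR N * G) by now apply Rmult_le_pos.
(* [M >= Y ^ 2] keeps the accumulated second-order terms below 1/2, whence the factor
   [exp (1 / 2) <= 2]. The other summand brings the [N] errors [4 * G * Y ^ 2 / M] at the integers
   down to [e] in total. *)
destruct (nfloor_ex (Y ^ 2 + 4 * (INR N * G) * Y ^ 2 / e)) as [M0 [_ hM0]].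
{ assert (0 <= Y ^ 2) by apply pow2_ge_0. assert (0 <= 4 * (INR N * G) * Y ^ 2 / e); [|lra].
  apply Rdiv_le_0_compat; trivial. apply Rmult_le_pos; lra. }
set (M := S M0). rewrite <- S_INR in hM0. fold M in hM0.
assert (hM : 0 < INR M) by (apply lt_0_INR; unfold M; lia).
assert (hY2 : 0 <= Y ^ 2) by apply pow2_ge_0.
assert (hq : 0 <= 4 * (INR N * G) * Y ^ 2 / e).
{ apply Rdiv_le_0_compat; trivial. apply Rmult_le_pos; lra. }
assert (hM2 : 4 * (INR N * G) * Y ^ 2 <= e * INR M).
{ assert (h : 4 * (INR N * G) * Y ^ 2 / e <= INR M) by lra.
  apply (Rmult_le_compat_r e) in h; [|lra].
  replace (4 * (INR N * G) * Y ^ 2 / e * e) with (4 * (INR N * G) * Y ^ 2) in h by (field; lra). lra. }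
set (E := fun (l : nat) (z : C) => ((1 + - (psi l / INR M)%R * Ci * z) ^ M)%C).
assert (hE : forall l, is_poly (E l)).
{ intros l. apply (poly_pow (fun z => 1 + - (psi l / INR M)%R * Ci * z)%C). polytac. }
assert (hEb : forall l z k, (l < N)%nat -> (k <= M)%nat -> Cmod z <= INR J ->
  Cmod ((1 + - (psi l / INR M)%R * Ci * z) ^ k) <= 2 * exp (beta * Rabs (Im z))).
{ intros l z k hl hk hz. destruct (hg l hl) as [_ hpsi].
  set (w := (- (psi l / INR M)%R * Ci * z)%C).
  assert (hkr : INR k <= INR M) by now apply le_INR. assert (hk0 := pos_INR k).
  assert (hwre : Re w = psi l / INR M * Im z) by (unfold w, Re, Im; simpl; ring).
  assert (hwmod : Cmod w <= Y / INR M).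
  { unfold w. rewrite !Cmod_mult, Cmod_opp, Cmod_R, Cmod_Ci, Rmult_1_r.
    unfold Rdiv at 1. rewrite Rabs_mult, (Rabs_pos_eq (/ INR M)) by (apply Rlt_le, Rinv_0_lt_compat; lra).
    replace (Y / INR M) with (beta * / INR M * INR J) by (unfold Y; field; lra).
    assert (0 < / INR M) by now apply Rinv_0_lt_compat.
    apply Rmult_le_compat; trivial; try apply Cmod_ge_0.
    - apply Rmult_le_pos; [apply Rabs_pos|lra].
    - apply Rmult_le_compat_r; lra. }
  rewrite Cmod_pow. apply Rle_trans with (exp (Re w + Cmod w ^ 2 / 2) ^ k).
  { apply pow_incr. split; [apply Cmod_ge_0|apply Cmod_1_plus_le]. }
  rewrite exp_pow. apply Rle_trans with (exp (1 / 2 + beta * Rabs (Im z))).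
  - apply exp_le_compat. rewrite hwre.
    assert (h1 : psi l / INR M * Im z <= beta * Rabs (Im z) / INR M).
    { replace (psi l / INR M * Im z) with (psi l * Im z / INR M) by (field; lra).
      apply Rmult_le_compat_r; [apply Rlt_le, Rinv_0_lt_compat; lra|].
      apply Rle_trans with (1 := Rle_abs _). rewrite Rabs_mult. apply Rmult_le_compat_r; trivial. apply Rabs_pos. }
    assert (h2 : Cmod w ^ 2 <= 1 / INR M).
    { apply Rle_trans with ((Y / INR M) ^ 2); [apply pow_incr; split; [apply Cmod_ge_0|trivial]|].
      replace ((Y / INR M) ^ 2) with (Y ^ 2 / INR M / INR M) by (field; lra).
      apply Rmult_le_compat_r; [apply Rlt_le, Rinv_0_lt_compat; lra|].
      apply Rmult_le_reg_r with (INR M); trivial. unfold Rdiv; rewrite Rmult_assoc, Rinv_l; lra. }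
    apply Rle_trans with (INR k * ((1 / 2 + beta * Rabs (Im z)) / INR M)).
    + apply Rmult_le_compat_l; trivial. unfold Rdiv in *. lra.
    + assert (hn : 0 <= (1 / 2 + beta * Rabs (Im z)) / INR M).
      { apply Rdiv_le_0_compat; trivial. assert (0 <= beta * Rabs (Im z)); [|lra].
        apply Rmult_le_pos; trivial. apply Rabs_pos. }
      apply Rle_trans with (INR M * ((1 / 2 + beta * Rabs (Im z)) / INR M)); [now apply Rmult_le_compat_r|].
      right; field; lra.
  - rewrite exp_plus. apply Rmult_le_compat_r; [apply Rlt_le, exp_pos|apply exp_half_le_2]. }
exists (fun z => csum (fun l => g l * E l z)%C N). split; [|split].
- clear -hE. induction N; simpl; [constructor|]. apply poly_add; trivial. apply poly_mul; trivial. constructor.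
- intros z hz. apply Rle_trans with (1 := Cmod_csum _ _).
  apply Rle_trans with (rsum (fun _ => G * (2 * exp (beta * Rabs (Im z)))) N).
  + apply rsum_le. intros l hl. rewrite Cmod_mult. apply Rmult_le_compat; try apply Cmod_ge_0.
    * apply hg; trivial.
    * now apply hEb.
  + rewrite rsum_const. right; ring.
- intros j hj.
  assert (hj' : INR j <= INR J) by now apply le_INR. assert (hj0 := pos_INR j).
  replace (csum (fun l => g l * E l (INR j)) N - csum (fun l => g l * expi (- (INR j * psi l))) N)%C
    with (csum (fun l => g l * E l (INR j)) N + (-1) * csum (fun l => g l * expi (- (INR j * psi l))) N)%C by ring.
  rewrite <- csum_scal, <- csum_plus. apply Rle_trans with (1 := Cmod_csum _ _).
  apply Rle_trans with (rsum (fun _ => G * (4 * Y ^ 2 / INR M)) N).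
  + apply rsum_le. intros l hl.
    replace (g l * E l (INR j) + -1 * (g l * expi (- (INR j * psi l))))%C
      with (g l * (E l (INR j) - expi (- (INR j * psi l))))%C by ring.
    rewrite Cmod_mult. apply Rmult_le_compat; try apply Cmod_ge_0; [now apply hg|].
    set (x := - (INR j * psi l) / INR M).
    replace (expi (- (INR j * psi l))) with (expi x ^ M)%C.
    2:{ rewrite expi_pow. f_equal. unfold x. field. lra. }
    unfold E. replace (- (psi l / INR M)%R * Ci * INR j)%C with (Ci * x)%C.
    2:{ unfold x, Rdiv. apply injective_projections; simpl; ring. }
    assert (hx : Rabs x <= Y / INR M).
    { unfold x, Rdiv. rewrite Rabs_mult, Rabs_Ropp, (Rabs_pos_eq (/ INR M)) by (apply Rlt_le, Rinv_0_lt_compat; lra).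
      apply Rmult_le_compat_r; [apply Rlt_le, Rinv_0_lt_compat; lra|].
      rewrite Rabs_mult, (Rabs_pos_eq (INR j)) by trivial. unfold Y.
      rewrite (Rmult_comm beta). apply Rmult_le_compat; trivial; [apply Rabs_pos|now apply hg]. }
    apply Rle_trans with (INR M * Cmod (1 + Ci * x - expi x) * 2).
    * apply Cpow_difference; [apply Cmod_expi|]. intros i hi.
      assert (hb := hEb l (RtoC (INR j)) i hl hi ltac:(rewrite Cmod_R, Rabs_pos_eq; trivial)).
      replace (Im (RtoC (INR j))) with 0 in hb by reflexivity.
      rewrite Rabs_R0, Rmult_0_r, exp_0 in hb.
      replace (- (psi l / INR M)%R * Ci * INR j)%C with (Ci * x)%C in hb.
      2:{ unfold x, Rdiv. apply injective_projections; simpl; ring. }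
      rewrite Cmod_pow in hb. lra.
    * assert (hd : Cmod (1 + Ci * x - expi x) <= 2 * x ^ 2).
      { destruct (sin_cos_small x) as [h1 h2]. apply Rle_trans with (1 := Cmod_le_Re_Im _).
        replace (Re (1 + Ci * x - expi x)) with (- (cos x - 1)) by (unfold Re; simpl; ring).
        replace (Im (1 + Ci * x - expi x)) with (- (sin x - x)) by (unfold Im; simpl; ring).
        rewrite !Rabs_Ropp. lra. }
      assert (hx2 : x ^ 2 <= (Y / INR M) ^ 2).
      { rewrite <- pow2_abs. apply pow_incr. split; [apply Rabs_pos|trivial]. }
      apply Rle_trans with (INR M * (2 * (Y / INR M) ^ 2) * 2).
      -- apply Rmult_le_compat_r; [lra|]. apply Rmult_le_compat_l; lra.
      -- right. field. lra.
  + rewrite rsum_const. apply Rmult_le_reg_r with (INR M); trivial.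
    replace (INR N * (G * (4 * Y ^ 2 / INR M)) * INR M) with (4 * (INR N * G) * Y ^ 2) by (field; lra). trivial.
Qed.

Lemma Cconj_RtoC (x : R) : Cconj x = x.
Proof. unfold Cconj, RtoC; simpl; f_equal; ring. Qed.

Lemma poly_conj (P : C -> C) : is_poly P -> is_poly (fun z => Cconj (P (Cconj z))).
Proof.
induction 1.
- constructor.
- apply poly_ext with (2 := poly_id). intros z; now rewrite Cconj_conj.
- apply poly_ext with (2 := poly_add _ _ IHis_poly1 IHis_poly2). intros z; now rewrite Cplus_conj.
- apply poly_ext with (2 := poly_mul _ _ IHis_poly1 IHis_poly2). intros z; now rewrite Cmult_conj.
- apply poly_ext with (2 := IHis_poly). intros z; now rewrite H.
Qed.

Definition real_part_poly (P : C -> C) (z : C) : C := (/ 2 * (P z + Cconj (P (Cconj z))))%C.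

Lemma real_part_poly_poly P : is_poly P -> is_poly (real_part_poly P).
Proof.
intros h. apply poly_mul; [constructor|]. apply poly_add; trivial. now apply poly_conj.
Qed.

Lemma real_part_poly_symmetric P : real_symmetric (real_part_poly P).
Proof.
intros z. unfold real_part_poly. rewrite Cmult_conj, Cplus_conj, !Cconj_conj.
rewrite Cinv_conj, (Cconj_RtoC 2). 2:{ intros h; apply RtoC_inj in h; lra. }
ring.
Qed.

Lemma real_part_poly_real P (x : R) : real_part_poly P x = RtoC (Re (P x)).
Proof.
unfold real_part_poly. rewrite Cconj_RtoC. destruct (P (RtoC x)) as [u v].
apply injective_projections; simpl; field.
Qed.

Lemma real_part_poly_bound P z M : Cmod (P z) <= M -> Cmod (P (Cconj z)) <= M ->
  Cmod (real_part_poly P z) <= M.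
Proof.
intros h1 h2. unfold real_part_poly.
rewrite Cmod_mult, Cmod_inv by (intros h; apply RtoC_inj in h; lra).
rewrite Cmod_R, Rabs_pos_eq by lra.
assert (h := Cmod_triangle (P z) (Cconj (P (Cconj z)))). rewrite Cmod_conj in h. lra.
Qed.

(** * Lagrange interpolation at the integers *)

Lemma fact_binomial_le j n : INR (fact (j + n)) <= 2 ^ (j + n) * (INR (fact j) * INR (fact n)).
Proof.
assert (H : forall s j n, (j + n = s)%nat -> INR (fact (j + n)) <= 2 ^ (j + n) * (INR (fact j) * INR (fact n))).
{ induction s; intros i k e.
  - replace i with O by lia. replace k with O by lia. simpl. lra.
  - assert (hf : forall p, 0 < INR (fact p)) by (intros; apply INR_fact_lt_0).
    destruct i as [|i]; [|destruct k as [|k]].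
    + change (0 + k)%nat with k. change (INR (fact 0)) with 1.
      assert (h2 : 1 <= 2 ^ k) by (apply pow_R1_Rle; lra). specialize (hf k). nra.
    + rewrite Nat.add_0_r. change (INR (fact 0)) with 1.
      assert (h2 : 1 <= 2 ^ S i) by (apply pow_R1_Rle; lra). specialize (hf (S i)). nra.
    + assert (h1 := IHs i (S k) ltac:(lia)). assert (h2 := IHs (S i) k ltac:(lia)).
      replace (S i + S k)%nat with (S (i + S k)) by lia. rewrite fact_simpl, mult_INR.
      replace (S i + k)%nat with (i + S k)%nat in h2 by lia.
      replace (INR (S (i + S k))) with (INR (S i) + INR (S k)) by (rewrite <- plus_INR; f_equal; lia).
      rewrite (fact_simpl i), (fact_simpl k), !mult_INR in *.
      assert (p1 := pos_INR (S i)). assert (p2 := pos_INR (S k)).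
      apply (Rmult_le_compat_l (INR (S i))) in h1; trivial.
      apply (Rmult_le_compat_l (INR (S k))) in h2; trivial.
      rewrite <- tech_pow_Rmult. rewrite Rmult_plus_distr_r.
      apply Rle_trans with (1 := Rplus_le_compat _ _ _ _ h1 h2). right; ring. }
now apply (H (j + n)%nat).
Qed.

Lemma pow_le_fact J : INR J ^ J <= 3 ^ J * INR (fact J).
Proof.
induction J; [simpl; lra|].
rewrite fact_simpl, mult_INR, <- !tech_pow_Rmult.
replace (3 * 3 ^ J * (INR (S J) * INR (fact J))) with (INR (S J) * (3 * (3 ^ J * INR (fact J)))) by ring.
apply Rmult_le_compat_l; [apply pos_INR|].
apply Rle_trans with (3 * INR J ^ J); [|apply Rmult_le_compat_l; lra].
destruct J as [|n]; [simpl; lra|].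
set (x := INR (S n)). assert (hx : 0 < x) by (apply lt_0_INR; lia).
rewrite S_INR. fold x.
replace (x + 1) with (x * (1 + / x)) by (field; lra).
rewrite Rpow_mult_distr, Rmult_comm. apply Rmult_le_compat_r; [apply pow_le; lra|].
apply Rle_trans with (exp (/ x) ^ S n).
- apply pow_incr. split; [|apply exp_ineq1_le]. assert (0 < / x) by now apply Rinv_0_lt_compat. lra.
- rewrite exp_pow. fold x. rewrite Rinv_r by lra. apply exp_le_3.
Qed.

Fixpoint lagrange_num (j n : nat) (z : C) : C :=
  match n with
  | O => RtoC 1
  | S n => (lagrange_num j n z * (if Nat.eq_dec n j then 1 else z - INR n))%C
  end.

Lemma lagrange_num_poly j n : is_poly (lagrange_num j n).
Proof.
induction n; simpl; [constructor|]. apply poly_mul; trivial.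
destruct (Nat.eq_dec n j); [constructor|]. apply (poly_add _ (fun _ => - INR n)%C); constructor.
Qed.

Lemma lagrange_num_symmetric j n : real_symmetric (lagrange_num j n).
Proof.
intros z. induction n; simpl; [now rewrite Cconj_RtoC|].
rewrite Cmult_conj, IHn. f_equal. destruct (Nat.eq_dec n j).
- now rewrite Cconj_RtoC.
- now rewrite Cminus_conj, Cconj_RtoC.
Qed.

Lemma lagrange_num_zero j n i : (i < n)%nat -> i <> j -> lagrange_num j n (INR i) = 0%C.
Proof.
induction n; intros hi hne; [lia|]. simpl. destruct (Nat.eq_dec i n) as [->|hin].
- destruct (Nat.eq_dec n j); [contradiction|]. ring.
- rewrite IHn by lia. ring.
Qed.

Lemma lagrange_num_bound J j n z : (n <= S J)%nat -> (j < n)%nat -> Cmod z <= INR J ->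
  Cmod (lagrange_num j n z) <= (2 * INR J) ^ (n - 1).
Proof.
intros hn hj hz.
assert (hfac : forall i, (i <= J)%nat -> Cmod (z - INR i) <= 2 * INR J).
{ intros i hi. assert (h := Cmod_triangle z (- INR i)). rewrite Cmod_opp, Cmod_R, Rabs_pos_eq in h by apply pos_INR.
  assert (hi' := le_INR _ _ hi). unfold Cminus. lra. }
assert (L : forall i, (i <= j)%nat -> Cmod (lagrange_num j i z) <= (2 * INR J) ^ i).
{ induction i; intros hi; [simpl; rewrite Cmod_1; lra|]. simpl.
  destruct (Nat.eq_dec i j) as [h|h]; [lia|].
  rewrite Cmod_mult, Rmult_comm. apply Rmult_le_compat; try apply Cmod_ge_0; [apply hfac; lia|apply IHi; lia]. }
induction n; [lia|].
simpl lagrange_num. rewrite Cmod_mult. replace (S n - 1)%nat with n by lia.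
destruct (Nat.eq_dec n j) as [->|h].
- rewrite Cmod_1, Rmult_1_r. now apply L.
- assert (hIH := IHn ltac:(lia) ltac:(lia)).
  replace ((2 * INR J) ^ n) with ((2 * INR J) ^ (n - 1) * (2 * INR J)).
  + apply Rmult_le_compat; trivial; try apply Cmod_ge_0. apply hfac; lia.
  + replace n with (S (n - 1)) at 2 by lia. simpl. ring.
Qed.

Lemma lagrange_num_diag j k : Cmod (lagrange_num j (S j + k) (INR j)) = INR (fact j) * INR (fact k).
Proof.
assert (L : forall i, (i <= j)%nat -> Cmod (lagrange_num j i (INR j)) * INR (fact (j - i)) = INR (fact j)).
{ induction i; intros hi.
  - simpl lagrange_num. rewrite Cmod_1, Nat.sub_0_r. ring.
  - simpl lagrange_num. destruct (Nat.eq_dec i j) as [h|h]; [lia|].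
    rewrite Cmod_mult, <- RtoC_minus, Cmod_R, <- minus_INR, Rabs_pos_eq by (try apply pos_INR; lia).
    rewrite <- (IHi ltac:(lia)). replace (j - i)%nat with (S (j - S i)) by lia.
    rewrite fact_simpl, mult_INR. ring. }
induction k.
- rewrite Nat.add_0_r. simpl lagrange_num. destruct (Nat.eq_dec j j); [|contradiction].
  assert (h := L j ltac:(lia)). rewrite Nat.sub_diag in h. simpl fact in h. simpl INR in h.
  rewrite Cmod_mult, Cmod_1. simpl. lra.
- replace (S j + S k)%nat with (S (S j + k)) by lia.
  change (lagrange_num j (S (S j + k)) (INR j)) with
    (lagrange_num j (S j + k) (INR j) * (if Nat.eq_dec (S j + k) j then 1 else INR j - INR (S j + k)))%C.
  destruct (Nat.eq_dec (S j + k) j) as [h|h]; [lia|].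
  rewrite Cmod_mult, IHk, fact_simpl, mult_INR.
  replace (INR j - INR (S j + k))%C with (- RtoC (INR (S k)))%C.
  + rewrite Cmod_opp, Cmod_R, Rabs_pos_eq by apply pos_INR. ring.
  + rewrite <- RtoC_minus, <- RtoC_opp. f_equal. rewrite plus_INR, !S_INR. ring.
Qed.

Lemma lagrange_num_diag_real j n : exists x : R, lagrange_num j n (INR j) = RtoC x.
Proof.
induction n as [|n [x hx]]; [now exists 1|]. simpl. rewrite hx.
destruct (Nat.eq_dec n j).
- exists (x * 1). now rewrite RtoC_mult.
- exists (x * (INR j - INR n)). now rewrite RtoC_mult, RtoC_minus.
Qed.

(** The numerator is at most [(2 * J) ^ J <= 2 ^ J * 3 ^ J * J!], and the denominator
    [j! * (J - j)!] is at least [J! / 2 ^ J]; the three bases multiply to 12. *)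
Lemma lagrange_basis (J j : nat) : (j <= J)%nat -> exists P, is_poly P /\ real_symmetric P /\
  (forall i, (i <= J)%nat -> P (INR i) = if Nat.eq_dec i j then 1%C else 0%C) /\
  (forall z, Cmod z <= INR J -> Cmod (P z) <= 12 ^ J).
Proof.
intros hj.
destruct (lagrange_num_diag_real j (S J)) as [x hx].
assert (hmod := lagrange_num_diag j (J - j)).
replace (S j + (J - j))%nat with (S J) in hmod by lia. rewrite hx, Cmod_R in hmod.
assert (hf : forall p, 0 < INR (fact p)) by (intros; apply INR_fact_lt_0).
assert (hW : 0 < INR (fact j) * INR (fact (J - j))) by now apply Rmult_lt_0_compat.
assert (hx0 : x <> 0) by (intros ->; rewrite Rabs_R0 in hmod; lra).
exists (fun z => / x * lagrange_num j (S J) z)%C.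
split; [apply poly_mul; [constructor|apply lagrange_num_poly]|].
assert (hxc : RtoC x <> 0%C) by (intros h; now apply RtoC_inj in h).
split; [|split].
- intros z. rewrite Cmult_conj, lagrange_num_symmetric, Cinv_conj, Cconj_RtoC; trivial.
- intros i hi. destruct (Nat.eq_dec i j) as [->|hne].
  + rewrite hx. field. trivial.
  + rewrite lagrange_num_zero by (trivial; lia). ring.
- intros z hz. rewrite Cmod_mult, Cmod_inv, Cmod_R, hmod by trivial.
  apply Rmult_le_reg_l with (INR (fact j) * INR (fact (J - j))); trivial.
  rewrite <- Rmult_assoc, Rinv_r, Rmult_1_l by lra.
  assert (h1 := lagrange_num_bound J j (S J) z (le_n _) ltac:(lia) hz).
  replace (S J - 1)%nat with J in h1 by lia. apply Rle_trans with (1 := h1).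
  rewrite Rpow_mult_distr.
  assert (h2 := fact_binomial_le j (J - j)). replace (j + (J - j))%nat with J in h2 by lia.
  assert (h3 := pow_le_fact J).
  apply Rle_trans with (2 ^ J * (3 ^ J * (2 ^ J * (INR (fact j) * INR (fact (J - j)))))).
  + apply Rmult_le_compat_l; [apply pow_le; lra|]. apply Rle_trans with (1 := h3).
    apply Rmult_le_compat_l; trivial. apply pow_le; lra.
  + right. replace 12 with (2 * 3 * 2) by ring. rewrite !Rpow_mult_distr. ring.
Qed.

(** The real-symmetric part of [F] is corrected node by node with Lagrange polynomials, each node
    costing [e * 12 ^ J]. Exact values are the point: they make the signs at the integers
    certain. *)
Lemma interpolation_correction (F : C -> C) (J : nat) (t : nat -> R) (e : R) :
  is_poly F -> 0 <= e -> (forall j, (j <= J)%nat -> Rabs (Re (F (INR j)) - t j) <= e) ->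
  exists P, is_poly P /\ real_symmetric P /\
  (forall j, (j <= J)%nat -> P (INR j) = RtoC (t j)) /\
  (forall z M, Cmod z <= INR J -> Cmod (F z) <= M -> Cmod (F (Cconj z)) <= M ->
     Cmod (P z) <= M + INR (S J) * (e * 12 ^ J)).
Proof.
intros hF he ht.
assert (H : forall n, (n <= S J)%nat -> exists P, is_poly P /\ real_symmetric P /\
  (forall j, (j <= J)%nat -> P (INR j) = RtoC (if lt_dec j n then t j else Re (F (INR j)))) /\
  (forall z M, Cmod z <= INR J -> Cmod (F z) <= M -> Cmod (F (Cconj z)) <= M ->
     Cmod (P z) <= M + INR n * (e * 12 ^ J))).
{ induction n; intros hn.
  - exists (real_part_poly F). split; [now apply real_part_poly_poly|].
    split; [apply real_part_poly_symmetric|]. split.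
    + intros j hj. destruct (lt_dec j 0); [lia|]. apply real_part_poly_real.
    + intros z M hz h1 h2. simpl. rewrite Rmult_0_l, Rplus_0_r. now apply real_part_poly_bound.
  - destruct (IHn ltac:(lia)) as [P [p1 [p2 [p3 p4]]]].
    destruct (lagrange_basis J n ltac:(lia)) as [Q [q1 [q2 [q3 q4]]]].
    set (y := t n - Re (F (INR n))).
    exists (fun z => P z + y * Q z)%C.
    split; [apply poly_add; trivial; apply poly_mul; trivial; constructor|].
    split; [intros z; now rewrite Cplus_conj, Cmult_conj, p2, q2, Cconj_RtoC|]. split.
    + intros j hj. rewrite p3, q3 by trivial. destruct (Nat.eq_dec j n) as [->|hne].
      * destruct (lt_dec n n); [lia|]. destruct (lt_dec n (S n)); [|lia].
        unfold y. rewrite RtoC_minus. ring.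
      * destruct (lt_dec j n), (lt_dec j (S n)); try lia; ring.
    + intros z M hz h1 h2. apply Rle_trans with (1 := Cmod_triangle _ _).
      rewrite S_INR, Rmult_plus_distr_r, Rmult_1_l, <- Rplus_assoc.
      apply Rplus_le_compat; [now apply p4|]. rewrite Cmod_mult, Cmod_R.
      apply Rmult_le_compat; [apply Rabs_pos|apply Cmod_ge_0| |now apply q4].
      unfold y. rewrite Rabs_minus_sym. apply ht. lia. }
destruct (H (S J) (le_n _)) as [P [p1 [p2 [p3 p4]]]]. exists P. repeat split; trivial.
intros j hj. rewrite p3 by trivial. destruct (lt_dec j (S J)); [trivial|lia].
Qed.

(** The side of [m] is a parameter, so that [Fr_plus] and [Fr_minus] share one proof. *)
Definition index (s : bool) (m j : nat) : nat := if s then (m + j)%nat else (m - j)%nat.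

Lemma RtoC_m1_pow_mod n : Cmod ((-1) ^ n)%C = 1.
Proof. rewrite Cmod_pow, Cmod_R, Rabs_left by lra. replace (- -1) with 1 by ring. apply pow1. Qed.

Lemma expi_PI_pow n : expi (INR n * PI) = RtoC ((-1) ^ n).
Proof.
rewrite <- expi_pow, RtoC_pow. f_equal. unfold expi. now rewrite cos_PI, sin_PI.
Qed.

(* The Fourier transform of [A] is small off an arc around [-1]; discarding that
   part makes the alternating sequence [(-1)^j A (index s m j)] interpolable. *)
Lemma approximating_poly (A : nat -> C) (u : C) (s : bool) (m N J : nat) (H b e : R) (t : nat -> R) :
  Cmod u = 1 -> 0 <= b <= 1 -> 0 < e -> 0 <= H -> (m + J < N)%nat -> (J <= m)%nat ->
  (forall th, Cmod (csum (fun j => A j * expi (INR j * th))%C N) <= H) ->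
  (forall th, Rabs th <= PI - PI * b -> Cmod (csum (fun j => A j * expi (INR j * th))%C N) <= e) ->
  (forall j, (j <= J)%nat -> Rabs (Re (u * A (index s m j)) - t j) <= e) ->
  exists P, is_poly P /\ real_symmetric P /\
    (forall j, (j <= J)%nat -> P (INR j) = RtoC ((-1) ^ j * t j)) /\
    (forall z, Cmod z <= INR J ->
       Cmod (P z) <= 2 * H * exp (PI * b * Rabs (Im z)) + INR (S J) * (3 * e * 12 ^ J)).
Proof.
intros hu hb he hH hNm hJm hall hsmall ht. assert (hpi := PI_RGT_0).
assert (hN : 0 < INR N) by (apply lt_0_INR; lia).
set (B := fun j => (RtoC ((-1) ^ j) * A j)%C).
set (h := fun l => csum (fun i => B i * expi (INR i * node N l))%C N).
(* The factor [(-1) ^ j] turns frequencies by [PI], in either direction. Turning towards 0 brings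
   the nodes with [|node| >= PI * b] into the arc where the transform of [A] is small. *)
assert (hh : forall l c, (c = 1 \/ c = -1) ->
   h l = csum (fun j => A j * expi (INR j * (node N l + c * PI)))%C N).
{ intros l c hc. apply csum_ext. intros i _. unfold B.
  rewrite Rmult_plus_distr_l, expi_plus.
  assert (ec : expi (INR i * (c * PI)) = RtoC ((-1) ^ i)).
  { destruct hc as [-> | ->].
    - rewrite Rmult_1_l. apply expi_PI_pow.
    - rewrite <- expi_pow, RtoC_pow. f_equal. unfold expi.
      replace (-1 * PI) with (- PI) by ring. rewrite cos_neg, sin_neg, cos_PI, sin_PI.
      unfold RtoC. f_equal; ring. }
  rewrite ec. ring. }
assert (hhH : forall l, Cmod (h l) <= H) by (intros l; rewrite (hh l 1) by (now left); apply hall).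
assert (hhe : forall l, (l < N)%nat -> PI * b <= Rabs (node N l) -> Cmod (h l) <= e).
{ intros l hl hn. assert (hnb := node_bound N l hl). assert (hpb : 0 <= PI * b) by (apply Rmult_le_pos; lra).
  unfold Rabs in hn. destruct (Rcase_abs (node N l)).
  - rewrite (hh l 1) by now left. apply hsmall. rewrite Rabs_pos_eq; lra.
  - rewrite (hh l (-1)) by now right. apply hsmall. rewrite Rabs_left1; lra. }
set (sg := if s then 1 else -1).
set (mid := fun l => if Rlt_dec (Rabs (node N l)) (PI * b) then true else false).
set (g := fun l => if mid l then (u * (/ INR N * h l * expi (- (INR m * node N l))) * RtoC ((-1) ^ m))%C else 0%C).
set (psi := fun l => if mid l then sg * node N l else 0).
assert (hm1 : forall n, Cmod (RtoC ((-1) ^ n)) = 1).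
{ intros n. rewrite RtoC_pow. apply RtoC_m1_pow_mod. }
assert (hNc : RtoC (INR N) <> 0%C) by (intros h'; apply RtoC_inj in h'; lra).
assert (hgm : forall l, Cmod (u * (/ INR N * h l * expi (- (INR m * node N l))) * RtoC ((-1) ^ m)) = Cmod (h l) / INR N).
{ intros l. rewrite !Cmod_mult, hu, hm1, Cmod_expi, Cmod_inv, Cmod_R, Rabs_pos_eq by (trivial; lra). field; lra. }
destruct (exponential_sum_poly g psi N J (H / INR N) (PI * b) e) as [F [F1 [F2 F3]]].
{ apply Rmult_le_pos; lra. }
{ apply Rdiv_le_0_compat; lra. }
{ trivial. }
{ intros l hl. unfold g, psi, mid. destruct (Rlt_dec (Rabs (node N l)) (PI * b)) as [hc|hc].
  - split.
    + rewrite hgm. apply Rmult_le_compat_r; [apply Rlt_le, Rinv_0_lt_compat; lra|apply hhH].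
    + rewrite Rabs_mult. replace (Rabs sg) with 1; [lra|].
      unfold sg; destruct s; [rewrite Rabs_pos_eq|rewrite Rabs_left]; lra.
  - rewrite Cmod_0, Rabs_R0. split; [apply Rdiv_le_0_compat; lra|apply Rmult_le_pos; lra]. }
(* Three errors of size [e]: from the polynomial to the exponential sum, from the discarded nodes,
   and from the weighted coefficients to [t]. *)
destruct (interpolation_correction F J (fun j => (-1) ^ j * t j) (3 * e)) as [P [P1 [P2 [P3 P4]]]]; trivial; [lra| |].
2:{ exists P. repeat split; trivial. intros z hz. apply P4; trivial.
    - replace (2 * H) with (2 * (INR N * (H / INR N))) by (field; lra). now apply F2.
    - replace (2 * H) with (2 * (INR N * (H / INR N))) by (field; lra).
      rewrite <- (Rabs_Ropp (Im z)), <- im_conj. apply F2. now rewrite Cmod_conj. }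
intros j hj.
set (n := index s m j).
assert (hn : (n < N)%nat) by (unfold n, index; destruct s; lia).
assert (hidx : INR n = INR m + sg * INR j).
{ unfold n, index, sg. destruct s; [rewrite plus_INR; ring|rewrite minus_INR by lia; ring]. }
assert (hpar : (-1) ^ n * (-1) ^ m = (-1) ^ j).
{ unfold n, index. destruct s.
  - rewrite <- pow_add. replace (m + j + m)%nat with (2 * m + j)%nat by lia.
    rewrite pow_add, pow_1_even. ring.
  - rewrite <- pow_add. replace (m - j + m)%nat with (2 * (m - j) + j)%nat by lia.
    rewrite pow_add, pow_1_even. ring. }
assert (hinv := discrete_fourier_inversion B N n hn).
set (S0 := csum (fun l => g l * expi (- (INR j * psi l)))%C N).
assert (hS0 : Cmod (RtoC ((-1) ^ j) * (u * A n) - S0) <= e).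
{ assert (e1 : (RtoC ((-1) ^ j) * (u * A n) = u * RtoC ((-1) ^ m) * B n)%C).
  { unfold B. rewrite <- hpar, RtoC_mult. ring. }
  rewrite e1, <- hinv. unfold S0.
  match goal with |- Cmod (?a * csum ?f N - csum ?f' N) <= _ =>
    replace (a * csum f N - csum f' N)%C with (csum (fun l => a * f l + (-1) * f' l)%C N)
      by (rewrite csum_plus, !csum_scal; ring) end.
  apply Rle_trans with (1 := Cmod_csum _ _).
  apply Rle_trans with (rsum (fun _ => e / INR N) N); [|rewrite rsum_const; right; field; lra].
  apply rsum_le. intros l hl. fold (h l). unfold g, psi.
  destruct (mid l) eqn:em.
  - match goal with |- Cmod ?x <= _ => replace x with (RtoC 0) end.
    + rewrite Cmod_0. apply Rdiv_le_0_compat; lra.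
    + assert (e2 : expi (- (INR n * node N l)) = (expi (- (INR m * node N l)) * expi (- (INR j * (sg * node N l))))%C).
      { rewrite <- expi_plus. f_equal. rewrite hidx. ring. }
      rewrite e2. ring.
  - rewrite Cmult_0_l, Cmult_0_r, Cplus_0_r.
    rewrite !Cmod_mult, hu, hm1, Cmod_expi, Cmod_inv, Cmod_R, Rabs_pos_eq by (trivial; lra).
    replace (1 * 1 * (/ INR N * Cmod (h l) * 1)) with (Cmod (h l) / INR N) by (field; lra).
    apply Rmult_le_compat_r; [apply Rlt_le, Rinv_0_lt_compat; lra|]. apply hhe; trivial.
    unfold mid in em. destruct (Rlt_dec (Rabs (node N l)) (PI * b)); [discriminate|lra]. }
assert (hF := F3 j hj). fold S0 in hF.
assert (ht' := ht j hj). fold n in ht'.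
assert (r1 : Rabs (Re (F (INR j)) - Re S0) <= e).
{ apply Rle_trans with (2 := hF). replace (Re (F (INR j)) - Re S0) with (Re (F (INR j) - S0)) by (unfold Re; simpl; ring).
  apply re_le_Cmod. }
assert (r2 : Rabs ((-1) ^ j * Re (u * A n) - Re S0) <= e).
{ apply Rle_trans with (2 := hS0).
  replace ((-1) ^ j * Re (u * A n) - Re S0) with (Re (RtoC ((-1) ^ j) * (u * A n) - S0)) by (unfold Re; simpl; ring).
  apply re_le_Cmod. }
assert (r3 : Rabs ((-1) ^ j * Re (u * A n) - (-1) ^ j * t j) <= e).
{ rewrite <- Rmult_minus_distr_l, Rabs_mult, pow_1_abs, Rmult_1_l. trivial. }
apply Rabs_le_between in r1. apply Rabs_le_between in r2. apply Rabs_le_between in r3.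
apply Rabs_le. lra.
Qed.

(** * Sign changes and zeros *)

Definition indicator (E : nat -> Prop) (j : nat) : nat :=
  if excluded_middle_informative (E j) then 1%nat else 0%nat.

Fixpoint count_from (E : nat -> Prop) (a n : nat) : nat :=
  match n with O => O | S n => (count_from E a n + indicator E (a + n))%nat end.

Lemma card_upto_count N E : card_upto N E = count_from E 0 (S N).
Proof.
unfold card_upto. generalize (S N). clear N. intros n.
induction n; trivial.
rewrite seq_S, filter_app, length_app, IHn. simpl. unfold indicator.
now destruct (excluded_middle_informative (E n)).
Qed.

Lemma indicator_le (E E' : nat -> Prop) j : (E j -> E' j) -> (indicator E j <= indicator E' j)%nat.
Proof.
intros h. unfold indicator.
destruct (excluded_middle_informative (E j)), (excluded_middle_informative (E' j)); auto; tauto.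
Qed.

Lemma count_from_le E E' a n : (forall j, E j -> E' j) -> (count_from E a n <= count_from E' a n)%nat.
Proof.
intros h. induction n; simpl; trivial. assert (h' := indicator_le E E' (a + n) (h _)). lia.
Qed.

Lemma count_from_window E a n N : (a + n <= N)%nat ->
  count_from (fun j => (a <= j < a + n)%nat /\ E j) 0 N = count_from E a n.
Proof.
intros hN.
assert (low : forall M, (M <= a)%nat -> count_from (fun j => (a <= j < a + n)%nat /\ E j) 0 M = O).
{ induction M; intros hM; simpl; trivial. rewrite IHM by lia. unfold indicator.
  destruct (excluded_middle_informative _); lia. }
assert (mid : forall k, (k <= n)%nat ->
  count_from (fun j => (a <= j < a + n)%nat /\ E j) 0 (a + k) = count_from E a k).
{ induction k; intros hk; [rewrite Nat.add_0_r; now apply low|].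
  replace (a + S k)%nat with (S (a + k)) by lia. simpl. rewrite IHk by lia. f_equal.
  apply Nat.le_antisymm; apply indicator_le; [tauto|]. intros h; split; trivial; lia. }
replace N with (a + n + (N - a - n))%nat by lia.
induction (N - a - n)%nat as [|k IH].
- rewrite Nat.add_0_r. now apply mid.
- replace (a + n + S k)%nat with (S (a + n + k)) by lia. simpl. rewrite IH. unfold indicator.
  destruct (excluded_middle_informative _); lia.
Qed.

Lemma count_from_difference E E1 E2 a n N : (a + n <= N)%nat -> (forall j, E1 j -> E2 j) ->
  (forall j, (a <= j < a + n)%nat -> E j -> E2 j /\ ~ E1 j) ->
  (count_from E1 0 N + count_from E a n <= count_from E2 0 N)%nat.
Proof.
intros hN h12 h. rewrite <- (count_from_window E a n N hN).
clear hN. induction N; simpl; trivial.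
set (D := fun j => (a <= j < a + n)%nat /\ E j) in *.
assert (h' : (indicator E1 N + indicator D N <= indicator E2 N)%nat).
{ unfold indicator.
  destruct (excluded_middle_informative (E1 N)) as [e1|e1],
    (excluded_middle_informative (D N)) as [eD|eD], (excluded_middle_informative (E2 N)) as [e2|e2]; auto.
  - destruct eD as [d1 d2]. destruct (h N d1 d2). contradiction.
  - destruct eD as [d1 d2]. destruct (h N d1 d2). contradiction.
  - exfalso; auto.
  - destruct eD as [d1 d2]. destruct (h N d1 d2). contradiction. }
lia.
Qed.

(** The indices [m - p] with [a <= p < a + n] begin at [m - a - n + 1], written [S m - a - n]. *)
Lemma count_from_reverse E m a n : (a + n <= m)%nat ->
  count_from (fun p => E (m - p)%nat) a n = count_from E (S m - a - n) n.
Proof.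
intros h. induction n; trivial.
assert (sh : forall E b n, count_from E b (S n) = (indicator E b + count_from E (S b) n)%nat).
{ clear. intros E b n. induction n; [simpl; now rewrite Nat.add_0_r, Nat.add_0_r|].
  change (count_from E b (S (S n))) with (count_from E b (S n) + indicator E (b + S n))%nat.
  rewrite IHn. simpl. replace (b + S n)%nat with (S (b + n)) by lia. lia. }
change (count_from (fun p => E (m - p)%nat) a (S n)) with
  (count_from (fun p => E (m - p)%nat) a n + indicator (fun p => E (m - p)%nat) (a + n))%nat.
rewrite IHn, sh by lia.
replace (S (S m - a - S n))%nat with (S m - a - n)%nat by lia.
replace (indicator (fun p => E (m - p)%nat) (a + n)) with (indicator E (S m - a - S n)).
- lia.
- unfold indicator. now replace (m - (a + n))%nat with (S m - a - S n)%nat by lia.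
Qed.

Lemma count_from_split E n : count_from E 0 (S n) = (count_from E 0 n + indicator E n)%nat.
Proof. reflexivity. Qed.

Lemma last_nonzero (c : nat -> R) i j : (i < j)%nat -> c i <> 0 ->
  exists k, (i <= k < j)%nat /\ c k <> 0 /\ forall l, (k < l < j)%nat -> c l = 0.
Proof.
induction j; intros hij hi; [lia|].
destruct (Req_EM_T (c j) 0) as [e|e].
- destruct (Nat.eq_dec i j) as [->|hne]; [contradiction|].
  destruct (IHj ltac:(lia) hi) as [k [h1 [h2 h3]]]. exists k. split; [lia|]. split; trivial.
  intros l hl. destruct (Nat.eq_dec l j) as [->|]; trivial. apply h3; lia.
- exists j. split; [lia|]. split; trivial. intros; lia.
Qed.

(* [c] times [parity c] does not change sign. *)
Definition parity (c : nat -> R) (j : nat) : R := (-1) ^ count_from (sign_change c) 0 (S j).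

Lemma parity_abs c j : Rabs (parity c j) = 1.
Proof. apply pow_1_abs. Qed.

Lemma parity_step c j : ~ sign_change c (S j) -> parity c (S j) = parity c j.
Proof.
intros h. unfold parity. rewrite (count_from_split _ (S j)). unfold indicator.
destruct (excluded_middle_informative (sign_change c (S j))); [contradiction|]. now rewrite Nat.add_0_r.
Qed.

(** Between consecutive nonzero entries the parity changes exactly when their signs differ. The
    general case chains such pairs through the last nonzero entry before [j]. *)
Lemma parity_nonzero_pair c : forall j i, (i < j)%nat -> c i <> 0 -> c j <> 0 ->
  0 < (parity c i * c i) * (parity c j * c j).
Proof.
assert (key : forall j k, (k < j)%nat -> c k <> 0 -> c j <> 0 -> (forall l, (k < l < j)%nat -> c l = 0) ->
   0 < (parity c k * c k) * (parity c j * c j)).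
{ intros j k hkj hk hj hz.
  assert (hflat : forall n, (k + n < j)%nat -> parity c (k + n) = parity c k).
  { induction n; intros hn; [now rewrite Nat.add_0_r|].
    rewrite <- IHn by lia. replace (k + S n)%nat with (S (k + n)) by lia. apply parity_step.
    intros [i [_ [hi _]]]. rewrite (hz (S (k + n))), Rmult_0_l in hi by lia. lra. }
  assert (hp : parity c k * parity c k = 1).
  { assert (h := parity_abs c k). unfold Rabs in h. destruct (Rcase_abs (parity c k)); nra. }
  assert (hj1 : parity c (j - 1) = parity c k).
  { replace (j - 1)%nat with (k + (j - 1 - k))%nat by lia. apply hflat; lia. }
  destruct (Rlt_dec (c j * c k) 0) as [hneg|hpos].
  - assert (hs : sign_change c j) by (exists k; repeat split; trivial).
    assert (e : parity c j = - parity c k).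
    { rewrite <- hj1. replace j with (S (j - 1)) at 1 by lia. unfold parity.
      rewrite (count_from_split _ (S (j - 1))). unfold indicator. replace (S (j - 1)) with j by lia.
      destruct (excluded_middle_informative (sign_change c j)); [|contradiction].
      rewrite pow_add. simpl. ring. }
    rewrite e. replace (parity c k * c k * (- parity c k * c j)) with (parity c k * parity c k * - (c j * c k)) by ring.
    rewrite hp. lra.
  - assert (hs : ~ sign_change c j).
    { intros [i [hi [h1 h2]]]. destruct (Nat.lt_trichotomy i k) as [h|[->|h]].
      - apply hk, h2; lia.
      - lra.
      - rewrite (hz i) in h1 by lia. lra. }
    assert (e : parity c j = parity c k).
    { rewrite <- hj1. replace j with (S (j - 1)) at 1 by lia. apply parity_step. now replace (S (j - 1)) with j by lia. }
    rewrite e. replace (parity c k * c k * (parity c k * c j)) with (parity c k * parity c k * (c j * c k)) by ring.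
    rewrite hp. assert (c j * c k <> 0) by now apply Rmult_integral_contrapositive. lra. }
intros j. induction j as [j IH] using (well_founded_induction Wf_nat.lt_wf).
intros i hij hi hj.
destruct (last_nonzero c i j hij hi) as [k [hk1 [hk2 hk3]]].
assert (h1 := key j k ltac:(lia) hk2 hj hk3).
destruct (Nat.eq_dec i k) as [->|hne]; trivial.
assert (h2 := IH k ltac:(lia) i ltac:(lia) hi hk2).
set (x := parity c i * c i) in *. set (y := parity c k * c k) in *. set (z := parity c j * c j) in *.
destruct (Rtotal_order y 0) as [hy|[hy|hy]]; nra.
Qed.

Lemma sign_pattern (c : nat -> R) : exists sigma : R, (sigma = 1 \/ sigma = -1) /\
  forall j, 0 <= sigma * parity c j * c j.
Proof.
destruct (classic (exists i, c i <> 0)) as [[i hi]|hno].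
- set (x := parity c i * c i).
  assert (hx : x <> 0).
  { apply Rmult_integral_contrapositive. split; trivial. intros h. assert (h' := parity_abs c i).
    rewrite h, Rabs_R0 in h'. lra. }
  exists (if Rlt_dec 0 x then 1 else -1). split; [destruct (Rlt_dec 0 x); auto|].
  intros j. rewrite Rmult_assoc. set (y := parity c j * c j).
  assert (hxy : 0 <= x * y).
  { destruct (Req_EM_T (c j) 0) as [e|e]; [unfold y; rewrite e, !Rmult_0_r; lra|].
    destruct (Nat.lt_trichotomy i j) as [h|[h|h]].
    - apply Rlt_le. now apply parity_nonzero_pair.
    - subst j. fold x in y. unfold y. nra.
    - apply Rlt_le. rewrite Rmult_comm. now apply parity_nonzero_pair. }
  destruct (Rlt_dec 0 x); nra.
- exists 1. split; [now left|]. intros j.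
  assert (e : c j = 0) by (apply NNPP; intros h; apply hno; now exists j). rewrite e. lra.
Qed.

Lemma zero_between (P : C -> C) (x y u v : R) : is_poly P -> real_symmetric P -> x < y ->
  P x = RtoC u -> P y = RtoC v -> u * v < 0 -> exists z, x < z < y /\ P (RtoC z) = 0%C.
Proof.
intros hP hs hxy hx hy huv.
assert (W : forall Q u v, is_poly Q -> real_symmetric Q -> Q (RtoC x) = RtoC u -> Q (RtoC y) = RtoC v -> u < 0 < v ->
   exists z, x < z < y /\ Q (RtoC z) = 0%C).
{ clear -hxy. intros Q u v hQ hs hx hy huv.
  destruct (IVT (fun t => Re (Q (RtoC t))) x y) as [z [[z1 z2] hz]]; trivial.
  - intros t e he. destruct (poly_continuous Q (RtoC t) hQ e he) as [d [hd h]].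
    exists d. split; trivial. intros w [_ hw]. simpl in *. unfold Rdist in *.
    replace (Re (Q (RtoC w)) - Re (Q (RtoC t))) with (Re (Q (RtoC w) - Q (RtoC t))) by (unfold Re; simpl; ring).
    apply Rle_lt_trans with (1 := re_le_Cmod _). apply h.
    now rewrite <- RtoC_minus, Cmod_R.
  - rewrite hx. simpl. lra.
  - rewrite hy. simpl. lra.
  - exists z. split.
    + split; apply Rnot_le_lt; intros hle.
      * replace z with x in hz by lra. rewrite hx in hz. simpl in hz. lra.
      * replace z with y in hz by lra. rewrite hy in hz. simpl in hz. lra.
    + assert (him : Im (Q (RtoC z)) = 0).
      { assert (h := hs (RtoC z)). rewrite Cconj_RtoC in h. apply (f_equal Im) in h. rewrite im_conj in h. lra. }
      destruct (Q (RtoC z)) as [p q]. simpl in *. now rewrite hz, him. }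
destruct (Rlt_dec u 0) as [hu|hu].
- apply (W P u v); trivial. split; trivial. nra.
- destruct (W (fun z => (-1) * P z)%C (- u) (- v)) as [z [hz e]]; trivial.
  + apply poly_mul; trivial. constructor.
  + intros z. now rewrite Cmult_conj, hs, Cconj_RtoC.
  + rewrite hx, RtoC_opp. ring.
  + rewrite hy, RtoC_opp. ring.
  + apply Rnot_lt_le in hu.
    assert (hv : v < 0) by (apply Rnot_le_lt; intros hv; nra).
    assert (hu' : 0 < u) by (apply Rnot_le_lt; intros hu'; replace u with 0 in huv by lra; lra). lra.
  + exists z. split; trivial. replace (P (RtoC z)) with ((-1) * ((-1) * P (RtoC z)))%C by ring. rewrite e. ring.
Qed.

Lemma collect_zeros (P : C -> C) (E : nat -> Prop) p0 n :
  (forall p, (p0 <= p < p0 + n)%nat -> ~ E p -> exists x, INR p < x < INR p + 1 /\ P (RtoC x) = 0%C) ->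
  exists l, NoDup l /\ (forall x, In x l -> P (RtoC x) = 0%C /\ INR p0 < x < INR (p0 + n)) /\
    (n <= length l + count_from E p0 n)%nat.
Proof.
induction n; intros h.
- exists nil. split; [constructor|]. split; [intros; contradiction|simpl; lia].
- destruct IHn as [l [l1 [l2 l3]]]; [intros; apply h; trivial; lia|].
  assert (hS : INR (p0 + S n) = INR (p0 + n) + 1) by (rewrite <- S_INR; f_equal; lia).
  simpl count_from. unfold indicator. destruct (excluded_middle_informative (E (p0 + n)%nat)) as [e|e].
  + exists l. split; trivial. split; [|lia]. intros x hx. destruct (l2 x hx). split; trivial. lra.
  + destruct (h (p0 + n)%nat ltac:(lia) e) as [x [hx1 hx2]].
    assert (hp : INR p0 <= INR (p0 + n)) by (apply le_INR; lia).
    exists (x :: l). split; [|split].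
    * constructor; trivial. intros hin. destruct (l2 x hin). lra.
    * intros y [<-|hy]; [split; trivial; lra|]. destruct (l2 y hy). split; trivial. lra.
    * simpl. lia.
Qed.

(** * The contradiction *)

(** A sign change between the positions [p] and [p + 1] counted from [m]. It is recorded at the
    larger of the two indices, hence the [+ 1] on the right side only. *)
Definition flip (c : nat -> R) (s : bool) (m p : nat) : Prop :=
  if s then sign_change c (m + p + 1) else sign_change c (m - p).

(** [H] is a partial sum whose length depends on [k] and [m], so it is delivered through every
    common bound [K] of these sums; [kernel_sum_bound] then provides one. *)
Lemma build_poly (a : nat -> C) (d c0 b T beta : R) (s : bool) (m : nat) :
  converges_on a 1 -> 0 < d < 1 -> 0 <= b <= 1 ->
  (forall t, Rabs t <= PI - PI * b -> taylor_small a d t) ->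
  0 < T -> T * INR m + 1 <= INR m ->
  (exists k, (k <= m)%nat /\ c0 * INR m <= INR k /\ / (2 * (INR m + 1)) <= kernel (1 - d / 4) m k) ->
  exists P J k H, is_poly P /\ real_symmetric P /\ (k <= m)%nat /\ c0 * INR m <= INR k /\
    T * INR m <= INR J <= T * INR m + 1 /\
    (forall z, Cmod z <= INR J -> Cmod (P z) <=
       2 * H * exp (PI * b * Rabs (Im z)) + INR (S J) * (3 * ((/ d + 1) * (/ 4) ^ k) * 12 ^ J)) /\
    (forall K, (forall N, rsum (fun j => Cmod (kernel_term a (1 - d / 4) k j)) N <= K) -> 0 <= H <= K) /\
    / (2 * (INR m + 1)) * Rabs (rotated_re a beta m) <= Cmod (P 0%C) /\
    (forall p, (p < J)%nat -> ~ flip (rotated_re a beta) s m p ->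
       exists x, INR p < x < INR p + 1 /\ P (RtoC x) = 0%C).
Proof.
intros ha hd hb hts hT hTm [k [k1 [k2 k3]]].
set (r := 1 - d / 4) in *. assert (hr : 0 < r < 1) by (unfold r; lra).
set (c := rotated_re a beta).
assert (hm := pos_INR m).
destruct (nfloor_ex (T * INR m)) as [J0 [hJ1 hJ2]]; [apply Rmult_le_pos; lra|].
set (J := S J0). assert (hJ : T * INR m <= INR J <= T * INR m + 1) by (unfold J; rewrite S_INR; lra).
assert (hJm : (J <= m)%nat) by (apply INR_le; lra).
assert (h4 : 0 < (/ 4) ^ k) by (apply pow_lt; lra).
assert (hd' : 0 < / d) by (apply Rinv_0_lt_compat; lra).
set (e := (/ d + 1) * (/ 4) ^ k).
assert (he : 0 < e) by (apply Rmult_lt_0_compat; lra).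
destruct (kernel_sum_small a d k ((/ 4) ^ k) ha hd h4) as [N0 hN0]. fold r in hN0.
set (N := (N0 + m + J + 1)%nat). specialize (hN0 N ltac:(unfold N; lia)).
set (A := kernel_term a r k) in *.
set (H := rsum (fun j => Cmod (A j)) N).
assert (hH : 0 <= H).
{ unfold H. rewrite <- (Rmult_0_r (INR N)), <- rsum_const. apply rsum_le. intros; apply Cmod_ge_0. }
destruct (sign_pattern c) as [sigma [hsig hpat]].
set (Sg := fun p => sigma * parity c (index s m p)).
set (t := fun p => Re (expi (- beta) * A (index s m p)) + e * Sg p).
assert (hSg : forall p, Sg p = 1 \/ Sg p = -1).
{ intros p. unfold Sg. assert (hp := parity_abs c (index s m p)).
  unfold Rabs in hp. destruct (Rcase_abs (parity c (index s m p))), hsig as [-> | ->]; [right|left|left|right]; lra. }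
assert (hRe : forall n, Re (expi (- beta) * A n) = kernel r n k * c n).
{ intros n. unfold A, kernel_term, c, rotated_re. unfold Re. simpl. ring. }
assert (htS : forall p, 0 < Sg p * t p).
{ intros p. unfold t. rewrite hRe.
  assert (h := hpat (index s m p)). fold (Sg p) in h.
  assert (hk := kernel_nonneg r (index s m p) hr k).
  assert (Sg p * Sg p = 1) by (destruct (hSg p) as [-> | ->]; ring). nra. }
destruct (approximating_poly A (expi (- beta)) s m N J H b e t) as [P [P1 [P2 [P3 P4]]]]; trivial.
{ apply Cmod_expi. }
{ unfold N; lia. }
{ intros th. apply Rle_trans with (1 := Cmod_csum _ _). apply rsum_le. intros j _.
  rewrite Cmod_mult, Cmod_expi. lra. }
{ intros th hth. apply Rle_trans with (1 := hN0 th (hts th hth)). unfold e. lra. }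
{ intros j hj. unfold t. match goal with |- Rabs (?x - (?x + ?y)) <= _ => replace (x - (x + y)) with (- y) by ring end.
  rewrite Rabs_Ropp, Rabs_mult, (Rabs_pos_eq e) by lra.
  destruct (hSg j) as [-> | ->]; [rewrite Rabs_pos_eq|rewrite Rabs_left]; lra. }
exists P, J, k, H. split; [trivial|]. split; [trivial|]. split; [trivial|]. split; [trivial|].
split; [trivial|]. split; [trivial|]. split; [|split].
- intros K hK. split; trivial. apply hK.
- assert (h0 := P3 O ltac:(lia)). change (RtoC (INR 0)) with (RtoC 0) in h0. rewrite h0, Cmod_R.
  simpl pow. rewrite Rmult_1_l.
  assert (ei : index s m 0 = m) by (unfold index; destruct s; lia).
  assert (h1 : Rabs (t O) = Sg O * t O).
  { assert (h := htS O). destruct (hSg O) as [e0 | e0]; rewrite e0 in *; [rewrite Rabs_pos_eq|rewrite Rabs_left]; lra. }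
  rewrite h1. unfold t. rewrite hRe, ei.
  assert (h2 := hpat m). assert (e2 : sigma * parity c m = Sg O) by (unfold Sg; now rewrite ei).
  rewrite e2 in h2.
  assert (h3 : Rabs (c m) = Sg O * c m).
  { destruct (hSg O) as [e0 | e0]; rewrite e0 in *; [rewrite Rabs_pos_eq|rewrite Rabs_left1]; lra. }
  rewrite h3. apply Rle_trans with (kernel r m k * (Sg O * c m)).
  + now apply Rmult_le_compat_r.
  + nra.
- intros p hp hflip.
  assert (hS : Sg (S p) = Sg p).
  { unfold Sg. f_equal. unfold flip in hflip. destruct s; simpl index.
    - replace (m + S p)%nat with (S (m + p)) by lia. apply parity_step.
      now replace (S (m + p)) with (m + p + 1)%nat by lia.
    - symmetry. replace (m - p)%nat with (S (m - S p)) by lia. apply parity_step.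
      now replace (S (m - S p)) with (m - p)%nat by lia. }
  rewrite <- S_INR.
  apply (zero_between P (INR p) (INR (S p)) ((-1) ^ p * t p) ((-1) ^ S p * t (S p))); trivial.
  + rewrite S_INR; lra.
  + apply P3; lia.
  + apply P3; lia.
  + assert (h1 := htS p). assert (h2 := htS (S p)). rewrite hS in h2.
    assert (hsq : (-1) ^ p * (-1) ^ p = 1) by (rewrite <- Rpow_mult_distr; replace (-1 * -1) with 1 by ring; apply pow1).
    rewrite <- tech_pow_Rmult.
    replace ((-1) ^ p * t p * (-1 * (-1) ^ p * t (S p))) with (- (((-1) ^ p * (-1) ^ p) * (t p * t (S p)))) by ring.
    rewrite hsq. assert (0 < t p * t (S p)); [|lra].
    destruct (hSg p) as [e0 | e0]; rewrite e0 in *; nra.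
Qed.

Definition n_side (s : bool) := if s then n_plus else n_minus.

Definition side_set (s : bool) (a : nat -> C) (m : nat) (beta r : R) (j : nat) : Prop :=
  if s then Lambda_plus a m beta j /\ INR m <= INR j <= (1 + r) * INR m
  else Lambda_minus a m beta j /\ (1 - r) * INR m <= INR j <= INR m.

Definition side_bound (s : bool) (m : nat) : nat := if s then S (2 * m) else S m.

Lemma n_side_count s a m beta r : (0 < m)%nat ->
  n_side s a m beta r * INR m = INR (count_from (side_set s a m beta r) 0 (side_bound s m)).
Proof.
intros hm. assert (0 < INR m) by now apply lt_0_INR.
unfold n_side, side_set, side_bound, n_plus, n_minus.
destruct s; rewrite card_upto_count; field; lra.
Qed.

Lemma side_set_mono s a m beta x y j : x <= y -> side_set s a m beta x j -> side_set s a m beta y j.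
Proof.
intros hxy. assert (hm := pos_INR m). unfold side_set. destruct s; intros [h1 h2]; split; trivial; nra.
Qed.

Lemma n_side_nonneg s a m beta x : (0 < m)%nat -> 0 <= n_side s a m beta x.
Proof.
intros hm. assert (hmr : 0 < INR m) by now apply lt_0_INR.
apply Rmult_le_reg_r with (INR m); trivial. rewrite Rmult_0_l, n_side_count by trivial. apply pos_INR.
Qed.

Lemma n_side_mono s a m beta x y : (0 < m)%nat -> x <= y -> n_side s a m beta x <= n_side s a m beta y.
Proof.
intros hm hxy. assert (hmr : 0 < INR m) by now apply lt_0_INR.
apply Rmult_le_reg_r with (INR m); trivial. rewrite !n_side_count by trivial.
apply le_INR, count_from_le. intros j. now apply side_set_mono.
Qed.

Lemma count_from_shift E b a n : count_from (fun p => E (b + p)%nat) a n = count_from E (b + a) n.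
Proof.
induction n; simpl; trivial. rewrite IHn. f_equal. unfold indicator.
now replace (b + (a + n))%nat with (b + a + n)%nat by lia.
Qed.

(** The strict inequality [al * m < p0] puts all these flips outside the closed window counted at
    [al]; the bound on [p0 + n] puts them inside the window at [be]. *)
Lemma flips_le (s : bool) (a : nat -> C) (m : nat) (beta al be : R) (p0 n : nat) :
  (0 < m)%nat -> 0 <= al <= be -> be <= 1 ->
  al * INR m < INR p0 -> INR (p0 + n) <= be * INR m ->
  INR (count_from (flip (rotated_re a beta) s m) p0 n)
    <= INR m * (n_side s a m beta be - n_side s a m beta al).
Proof.
intros hm hal hbe hp hn. assert (hmr : 0 < INR m) by now apply lt_0_INR.
assert (hpm : (p0 + n <= m)%nat) by (apply INR_le; nra).
replace (INR m * (n_side s a m beta be - n_side s a m beta al))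
  with (n_side s a m beta be * INR m - n_side s a m beta al * INR m) by ring.
rewrite !n_side_count by trivial.
assert (h : (count_from (side_set s a m beta al) 0 (side_bound s m)
    + count_from (flip (rotated_re a beta) s m) p0 n <= count_from (side_set s a m beta be) 0 (side_bound s m))%nat).
{ destruct s.
  - assert (e : count_from (flip (rotated_re a beta) true m) p0 n
       = count_from (sign_change (rotated_re a beta)) (m + 1 + p0) n).
    { rewrite <- count_from_shift. unfold flip.
      f_equal. apply functional_extensionality. intros p.
      now replace (m + p + 1)%nat with (m + 1 + p)%nat by lia. }
    rewrite e. apply count_from_difference.
    + unfold side_bound. lia.
    + intros j. apply side_set_mono; lra.
    + intros j hj hs.
      assert (j1 : INR m + 1 + INR p0 <= INR j).
      { replace (INR m + 1 + INR p0) with (INR (m + 1 + p0)) by (rewrite !plus_INR; simpl; ring). apply le_INR; lia. }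
      assert (j2 : INR j <= INR m + INR (p0 + n)) by (rewrite <- plus_INR; apply le_INR; lia).
      split.
      * split; [split; trivial; lia|]. split; [|lra]. generalize (pos_INR p0); lra.
      * intros [_ [_ h]]. lra.
  - assert (e : count_from (flip (rotated_re a beta) false m) p0 n
       = count_from (sign_change (rotated_re a beta)) (S m - p0 - n) n).
    { unfold flip. now apply count_from_reverse. }
    rewrite e. apply count_from_difference.
    + unfold side_bound. lia.
    + intros j. apply side_set_mono; lra.
    + intros j hj hs.
      assert (j1 : INR j + INR p0 <= INR m) by (rewrite <- plus_INR; apply le_INR; lia).
      assert (j2 : INR m <= INR j + INR (p0 + n)) by (rewrite <- plus_INR; apply le_INR; lia).
      split.
      * split; [split; trivial; lia|]. split; [|generalize (pos_INR p0); lra]. lra.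
      * intros [_ [h _]]. lra. }
apply le_INR in h. rewrite plus_INR in h. lra.
Qed.

(** The square of [exp (g * x / 2) >= g * x / 2]. The form [x + 2] covers the factors [m + 1] and
    [J + 1] that occur below. *)
Lemma exp_dominates (K g : R) : 0 <= K -> 0 < g -> exists X, 0 <= X /\ forall x, X <= x -> K * (x + 2) <= exp (g * x).
Proof.
intros hK hg. exists (8 * K / g ^ 2 + 2).
assert (hg2 : 0 < g ^ 2) by now apply pow_lt.
assert (h0 : 0 <= 8 * K / g ^ 2) by (apply Rdiv_le_0_compat; lra).
split; [lra|]. intros x hx.
assert (he := exp_ineq1_le (g * x / 2)).
assert (hgx : 0 < g * x / 2) by nra.
replace (g * x) with (g * x / 2 + g * x / 2) by field. rewrite exp_plus.
apply Rle_trans with ((g * x / 2) * (g * x / 2)).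
- assert (h8 : 8 * K <= g ^ 2 * x).
  { replace (8 * K) with (g ^ 2 * (8 * K / g ^ 2)) by (field; lra). apply Rmult_le_compat_l; lra. }
   nra.
- apply Rmult_le_compat; lra.
Qed.

Lemma nth_root_lower (n : nat) (x eta : R) : (0 < n)%nat -> 0 <= x ->
  exp (- eta) < nth_root n x -> exp (- (INR n * eta)) <= x.
Proof.
intros hn hx h. assert (hnr : 0 < INR n) by now apply lt_0_INR.
unfold nth_root in h. destruct (Req_EM_T x 0) as [e|e].
- assert (h' := exp_pos (- eta)). lra.
- unfold Rpower in h. apply exp_lt_inv in h.
  rewrite <- (exp_ln x) by lra. apply exp_le_compat.
  apply (Rmult_lt_compat_l (INR n)) in h; trivial.
  replace (INR n * (/ INR n * ln x)) with (ln x) in h by (field; lra). lra.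
Qed.

Lemma LimInf_right_lt (n : R -> R) (Delta D : R) :
  Rbar_le (LimInf_right (fun r : R => n r / r) 0) Delta -> Delta < D ->
  forall d, 0 < d -> exists r, 0 < r < d /\ n r < D * r.
Proof.
intros hle hD d hd. apply NNPP; intros hno.
assert (h : forall r, 0 < r < d -> D <= n r / r).
{ intros r hr. apply Rmult_le_reg_r with r; [lra|]. unfold Rdiv; rewrite Rmult_assoc, Rinv_l, Rmult_1_r by lra.
  apply Rnot_lt_le; intros hlt. apply hno. now exists r. }
set (E := fun v : R => exists r, 0 < r < 0 + d /\ v = n r / r).
assert (hg : Rbar_le D (Glb_Rbar E)).
{ apply (proj2 (Glb_Rbar_correct E)). intros v [r [hr ->]]. simpl. apply h; lra. }
assert (hl : Rbar_le (Glb_Rbar E) (LimInf_right (fun r : R => n r / r) 0)).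
{ unfold LimInf_right, Rbar_lub. apply (proj1 (proj2_sig (Rbar_ex_lub _))). now exists (mkposreal d hd). }
assert (hf := Rbar_le_trans _ _ _ (Rbar_le_trans _ _ _ hg hl) hle). simpl in hf. lra.
Qed.

Lemma increasing_ge_id (phi : nat -> nat) : (forall i, (phi i < phi (S i))%nat) -> forall i, (i <= phi i)%nat.
Proof. intros h i. induction i; [lia|]. specialize (h i). lia. Qed.

Lemma ev_large (m : nat -> nat) (X : R) : (forall i, (i <= m i)%nat) -> 0 <= X -> ev (fun i => X <= INR (m i)).
Proof.
intros hm hX. destruct (nfloor_ex X hX) as [N [_ hN]]. exists (S N). intros i hi.
apply Rle_trans with (INR i); [|now apply le_INR].
apply le_INR in hi. rewrite S_INR in hi. lra.
Qed.

Lemma ev_subseq (m : nat -> nat) Q : (forall i, (i <= m i)%nat) -> ev Q -> ev (fun i => Q (m i)).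
Proof. intros hm [N h]. exists N. intros i hi. apply h. specialize (hm i). lia. Qed.

(* The exponents satisfy [T ln 12 <= c0 ln 4 / 2], so the gain [4^(-k)] absorbs
   the loss [12^J] of the interpolation. *)
Lemma correction_negligible (d c0 T : R) : 0 < d -> 0 < c0 -> 0 < T <= 1 ->
  T * ln 12 <= c0 * ln 4 / 2 -> exists X, 0 <= X /\ forall m k J, X <= INR m ->
  c0 * INR m <= INR k -> INR J <= T * INR m + 1 ->
  INR (S J) * (3 * ((/ d + 1) * (/ 4) ^ k) * 12 ^ J) <= 1.
Proof.
intros hd hc hT hTc.
assert (hl4 : 0 < ln 4) by (rewrite <- ln_1; apply ln_increasing; lra).
assert (hl12 : 0 < ln 12) by (rewrite <- ln_1; apply ln_increasing; lra).
assert (hd' : 0 < / d) by now apply Rinv_0_lt_compat.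
destruct (exp_dominates (36 * (/ d + 1)) (c0 * ln 4 / 2)) as [X [hX h]]; [lra|nra|].
exists X. split; trivial. intros m k J hm hk hJ.
assert (e1 : (/ 4) ^ k <= exp (- (c0 * INR m * ln 4))).
{ replace ((/ 4) ^ k) with (exp (- (INR k * ln 4))).
  - apply exp_le_compat. nra.
  - rewrite exp_Ropp, <- exp_pow, exp_ln by lra. now rewrite pow_inv. }
assert (e2 : 12 ^ J <= 12 * exp (T * INR m * ln 12)).
{ rewrite <- (exp_ln 12) at 1 by lra. rewrite exp_pow. rewrite <- (exp_ln 12) at 2 by lra.
  rewrite <- exp_plus. apply exp_le_compat. nra. }
assert (e3 : INR (S J) <= INR m + 2) by (rewrite S_INR; nra).
assert (e4 : exp (- (c0 * INR m * ln 4)) * exp (T * INR m * ln 12) <= exp (- (c0 * ln 4 / 2 * INR m))).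
{ rewrite <- exp_plus. apply exp_le_compat. nra. }
assert (h4 : 0 <= (/ 4) ^ k) by (apply pow_le; lra). assert (h12 : 0 <= 12 ^ J) by (apply pow_le; lra).
apply Rle_trans with ((INR m + 2) * (3 * ((/ d + 1) * exp (- (c0 * INR m * ln 4))) * (12 * exp (T * INR m * ln 12)))).
- apply Rmult_le_compat; trivial; [apply pos_INR|apply Rmult_le_pos; trivial; nra|].
  apply Rmult_le_compat; trivial; [nra|]. apply Rmult_le_compat_l; [lra|]. apply Rmult_le_compat_l; lra.
- apply Rle_trans with (36 * (/ d + 1) * (INR m + 2) * exp (- (c0 * ln 4 / 2 * INR m))).
  + replace ((INR m + 2) * (3 * ((/ d + 1) * exp (- (c0 * INR m * ln 4))) * (12 * exp (T * INR m * ln 12))))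
      with (36 * (/ d + 1) * (INR m + 2) * (exp (- (c0 * INR m * ln 4)) * exp (T * INR m * ln 12))) by ring.
    apply Rmult_le_compat_l; trivial. apply Rmult_le_pos; lra.
  + rewrite exp_Ropp. assert (hh := h (INR m) hm). assert (hp := exp_pos (c0 * ln 4 / 2 * INR m)).
    apply Rmult_le_reg_r with (exp (c0 * ln 4 / 2 * INR m)); trivial.
    rewrite Rmult_assoc, Rinv_l; lra.
Qed.

(** The case [Delta = 1]. The transform is small at every node, so inversion bounds the single
    weighted coefficient at [m] by about [4 ^ (-k)], which the weight from [kernel_peak] and the
    lower bound on the coefficient exclude. *)
Lemma whole_circle_absurd (a : nat -> C) (d : R) (m : nat -> nat) (beta : nat -> R) :
  converges_on a 1 -> 0 < d < 1 -> (forall t, Rabs t <= PI -> taylor_small a d t) ->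
  (forall i, (i <= m i)%nat) ->
  (forall eta, 0 < eta -> ev (fun i => exp (- (INR (m i) * eta)) <= Rabs (rotated_re a (beta i) (m i)))) ->
  False.
Proof.
intros ha hd hts hm hlow.
set (r := 1 - d / 4). assert (hr : 0 < r < 1) by (unfold r; lra).
destruct (kernel_peak r hr) as [c0 [hc0 hpeak]].
assert (hl4 : 0 < ln 4) by (rewrite <- ln_1; apply ln_increasing; lra).
assert (hd' : 0 < / d) by (apply Rinv_0_lt_compat; lra).
destruct (exp_dominates (4 * (/ d + 1)) (c0 * ln 4 / 2)) as [X [hX hdom]]; [lra|nra|].
destruct (ev_exists _ (ev_and _ _ (ev_and _ _ (hlow (c0 * ln 4 / 2) ltac:(nra)) (ev_subseq m _ hm hpeak))
   (ev_large m X hm hX))) as [i [[h1 [k [k1 [k2 k3]]]] h2]].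
set (M := m i) in *. specialize (hdom (INR M) h2).
assert (h4 : 0 < (/ 4) ^ k) by (apply pow_lt; lra).
destruct (kernel_sum_small a d k ((/ 4) ^ k) ha hd h4) as [N0 hN0]. fold r in hN0.
set (N := (N0 + M + 1)%nat). specialize (hN0 N ltac:(unfold N; lia)).
assert (hN : 0 < INR N) by (apply lt_0_INR; unfold N; lia).
assert (hinv := discrete_fourier_inversion (kernel_term a r k) N M ltac:(unfold N; lia)).
assert (hb : Cmod (kernel_term a r k M) <= (/ d + 1) * (/ 4) ^ k).
{ rewrite <- hinv. apply Rle_trans with (1 := Cmod_csum _ _).
  apply Rle_trans with (rsum (fun _ => (/ d + 1) * (/ 4) ^ k / INR N) N); [|rewrite rsum_const; right; field; lra].
  apply rsum_le. intros l hl.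
  rewrite !Cmod_mult, Cmod_expi, Cmod_inv, Cmod_R, Rabs_pos_eq.
  2: lra. 2:{ intros h; apply RtoC_inj in h; lra. }
  rewrite Rmult_1_r, Rmult_comm. apply Rmult_le_compat_r; [apply Rlt_le, Rinv_0_lt_compat; lra|].
  eapply Rle_trans; [apply hN0, hts|lra].
  assert (h := node_bound N l hl). apply Rabs_le. lra. }
assert (hk : kernel r M k * Rabs (rotated_re a (beta i) M) <= (/ d + 1) * (/ 4) ^ k).
{ apply Rle_trans with (2 := hb). unfold kernel_term. rewrite Cmod_mult, Cmod_R, (Rabs_pos_eq (kernel r M k)) by now apply kernel_nonneg.
  apply Rmult_le_compat_l; [now apply kernel_nonneg|]. unfold rotated_re.
  apply Rle_trans with (1 := re_le_Cmod _). rewrite Cmod_mult, Cmod_expi. lra. }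
assert (e1 : (/ 4) ^ k <= exp (- (INR M * (c0 * ln 4 / 2))) * exp (- (INR M * (c0 * ln 4 / 2)))).
{ replace ((/ 4) ^ k) with (exp (- (INR k * ln 4))).
  - rewrite <- exp_plus. apply exp_le_compat. nra.
  - rewrite exp_Ropp, <- exp_pow, exp_ln by lra. now rewrite pow_inv. }
set (E := exp (- (INR M * (c0 * ln 4 / 2)))) in *. assert (hE : 0 < E) by apply exp_pos.
assert (hE2 : E * exp (c0 * ln 4 / 2 * INR M) = 1).
{ unfold E. rewrite <- exp_plus, <- exp_0. f_equal. ring. }
assert (h5 : / (2 * (INR M + 1)) * E <= (/ d + 1) * (E * E)).
{ apply Rle_trans with (kernel r M k * Rabs (rotated_re a (beta i) M)).
  - apply Rmult_le_compat; trivial; [|lra]. apply Rlt_le, Rinv_0_lt_compat; lra.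
  - apply Rle_trans with (1 := hk). apply Rmult_le_compat_l; lra. }
assert (h6 : 1 <= 2 * (INR M + 1) * (/ d + 1) * E).
{ apply Rmult_le_reg_r with (/ (2 * (INR M + 1)) * E).
  - apply Rmult_lt_0_compat; trivial. apply Rinv_0_lt_compat; lra.
  - rewrite Rmult_1_l. apply Rle_trans with (1 := h5). right. field. lra. }
assert (h7 : 4 * (/ d + 1) * (INR M + 2) * E <= 1).
{ apply Rle_trans with (exp (c0 * ln 4 / 2 * INR M) * E); [|lra]. apply Rmult_le_compat_r; lra. }
nra.
Qed.

Lemma proper_arc_absurd (a : nat -> C) (d b D : R) (m : nat -> nat) (beta : nat -> R) (s : bool) (n : R -> R) :
  converges_on a 1 -> 0 < d < 1 -> 0 <= b -> 0 <= D -> D < 1 - b ->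
  (forall t, Rabs t <= PI - PI * b -> taylor_small a d t) ->
  (forall i, (0 < m i)%nat) -> (forall i, (i <= m i)%nat) ->
  (forall eta, 0 < eta -> ev (fun i => exp (- (INR (m i) * eta)) <= Rabs (rotated_re a (beta i) (m i)))) ->
  (forall x, 0 <= x <= 1 -> is_lim_seq (fun i => n_side s a (m i) (beta i) x) (n x)) ->
  (forall d, 0 < d -> exists r, 0 < r < d /\ n r < D * r) ->
  False.
Proof.
intros ha hd hb hD hDb hts hm0 hm hlow hn hliminf.
set (r := 1 - d / 4). assert (hr : 0 < r < 1) by (unfold r; lra).
destruct (kernel_peak r hr) as [c0 [hc0 hpeak]].
assert (hl4 : 0 < ln 4) by (rewrite <- ln_1; apply ln_increasing; lra).
assert (hl12 : 0 < ln 12) by (rewrite <- ln_1; apply ln_increasing; lra).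
(* The second term is the condition of [correction_negligible]; [T <= 1 / 2] keeps the window of [J]
   steps inside [[0, m]]. *)
set (T := Rmin (1 / 2) (c0 * ln 4 / 2 / ln 12)).
assert (hT : 0 < T).
{ apply Rmin_glb_lt; [lra|]. apply Rdiv_lt_0_compat; nra. }
assert (hT1 : T <= 1 / 2) by apply Rmin_l.
assert (hT2 : T * ln 12 <= c0 * ln 4 / 2).
{ apply Rle_trans with (c0 * ln 4 / 2 / ln 12 * ln 12).
  - apply Rmult_le_compat_r; [lra|apply Rmin_r].
  - right; field; lra. }
assert (hmr : forall i, 0 < INR (m i)) by (intros i; apply lt_0_INR, hm0).
set (cond := fun i => T * INR (m i) + 1 <= INR (m i) /\
   exists k, (k <= m i)%nat /\ c0 * INR (m i) <= INR k /\ / (2 * (INR (m i) + 1)) <= kernel r (m i) k).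
assert (hcond : ev cond).
{ apply ev_and; [|exact (ev_subseq m _ hm hpeak)].
  generalize (ev_large m 2 hm ltac:(lra)). apply ev_impl. intros i hi. nra. }
set (good := fun i P => exists J k H, (k <= m i)%nat /\ c0 * INR (m i) <= INR k /\
    T * INR (m i) <= INR J <= T * INR (m i) + 1 /\
    (forall z, Cmod z <= INR J -> Cmod (P z) <=
       2 * H * exp (PI * b * Rabs (Im z)) + INR (S J) * (3 * ((/ d + 1) * (/ 4) ^ k) * 12 ^ J)) /\
    (forall K, (forall N, rsum (fun j => Cmod (kernel_term a r k j)) N <= K) -> 0 <= H <= K) /\
    / (2 * (INR (m i) + 1)) * Rabs (rotated_re a (beta i) (m i)) <= Cmod (P (RtoC 0)) /\
    (forall p, (p < J)%nat -> ~ flip (rotated_re a (beta i)) s (m i) p ->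
       exists x, INR p < x < INR p + 1 /\ P (RtoC x) = RtoC 0)).
(* Choice asks for a polynomial for every [i]; the zero polynomial fills in where [cond] fails,
   which is at finitely many [i]. *)
assert (hex : forall i, exists P : C -> C, is_poly P /\ real_symmetric P /\ (cond i -> good i P)).
{ intros i. destruct (classic (cond i)) as [hc|hc].
  - destruct hc as [hc1 hc2].
    destruct (build_poly a d c0 b T (beta i) s (m i) ha hd ltac:(lra) hts hT hc1 hc2)
      as [P [J [k [H [P1 [P2 P3]]]]]].
    exists P. split; trivial. split; trivial. intros _. exists J, k, H. exact P3.
  - exists (fun _ => RtoC 0). split; [constructor|]. split; [intros z; now rewrite Cconj_RtoC|]. intros; contradiction. }
destruct (choice _ hex) as [P hP].
set (p := fun i z => P i (INR (m i) * z + 0)%C).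
assert (hmod : forall i z, Cmod z <= T -> Cmod (INR (m i) * z + 0) <= T * INR (m i)).
{ intros i z hz. rewrite Cplus_0_r, Cmod_mult, Cmod_R, Rabs_pos_eq, Rmult_comm by apply pos_INR.
  apply Rmult_le_compat_r; trivial. apply pos_INR. }
assert (him : forall i z, Rabs (Im (INR (m i) * z + 0)) = INR (m i) * Rabs (Im z)).
{ intros i z. replace (Im (INR (m i) * z + 0)) with (INR (m i) * Im z) by (unfold Im; simpl; ring).
  rewrite Rabs_mult, Rabs_pos_eq; trivial. apply pos_INR. }
assert (hmono : nonneg_nondecreasing_on T n).
{ split.
  - intros x hx. assert (hl := hn x ltac:(lra)).
    apply (is_lim_seq_le (fun _ => 0) _ 0 (n x) (fun i => n_side_nonneg s a (m i) (beta i) x (hm0 i))); trivial.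
    apply is_lim_seq_const.
  - intros x y h1 h2 h3.
    apply (is_lim_seq_le _ _ (n x) (n y) (fun i => n_side_mono s a (m i) (beta i) x y (hm0 i) h2)); apply hn; lra. }
assert (Z : zero_family p (fun i => INR (m i)) n T b).
{ constructor.
  - intros i. apply poly_affine, hP.
  - intros i z. unfold p. destruct (hP i) as [_ [hs _]]. rewrite <- hs. f_equal.
    now rewrite Cplus_conj, Cmult_conj, !Cconj_RtoC.
  - exact hmr.
  - intros eta heta.
    (* Half of [eta] pays for the growth of [H], using [k <= m]; the other half absorbs the constant
       [2 * K + 1]. *)
    destruct (kernel_sum_bound a r (eta / 2) ha hr ltac:(lra)) as [K [hK hKb]].
    destruct (exp_dominates (2 * K + 1) (eta / 2)) as [X1 [hX1 hdom]]; [lra|lra|].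
    destruct (correction_negligible d c0 T) as [X2 [hX2 hcor]]; trivial; [lra|lra|].
    generalize (ev_and _ _ hcond (ev_and _ _ (ev_large m X1 hm hX1) (ev_large m X2 hm hX2))).
    apply ev_impl. intros i [hc [h1 h2]] z hz.
    destruct (hP i) as [_ [_ hg]]. destruct (hg hc) as [J [k [H [g1 [g2 [g3 [g4 [g5 _]]]]]]]].
    unfold p. eapply Rle_trans; [apply g4; apply Rle_trans with (1 := hmod i z hz); lra|].
    rewrite him. specialize (hcor (m i) k J h2 g2 (proj2 g3)).
    destruct (g5 _ (hKb k)) as [g5a g5b].
    set (E := exp (PI * b * (INR (m i) * Rabs (Im z)))).
    assert (hE : 1 <= E).
    { unfold E. rewrite <- exp_0. apply exp_le_compat. apply Rmult_le_pos.
      - apply Rmult_le_pos; trivial. apply Rlt_le, PI_RGT_0.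
      - apply Rmult_le_pos; [apply pos_INR|apply Rabs_pos]. }
    assert (hHe : H <= K * exp (INR (m i) * (eta / 2))).
    { apply Rle_trans with (1 := g5b). apply Rmult_le_compat_l; [lra|]. apply exp_le_compat.
      apply Rmult_le_compat_r; [lra|]. now apply le_INR. }
    set (Y := exp (INR (m i) * (eta / 2))) in *.
    assert (hY : 1 <= Y).
    { unfold Y. rewrite <- exp_0. apply exp_le_compat. apply Rmult_le_pos; [apply pos_INR|lra]. }
    assert (hKY : 2 * K + 1 <= Y).
    { unfold Y. rewrite (Rmult_comm (INR (m i))). apply Rle_trans with (2 := hdom (INR (m i)) h1).
      rewrite <- (Rmult_1_r (2 * K + 1)) at 1. apply Rmult_le_compat_l; [lra|]. generalize (pos_INR (m i)); lra. }
    replace (exp (INR (m i) * (PI * b * Rabs (Im z) + eta))) with (Y * Y * E).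
    + apply Rle_trans with ((2 * K + 1) * Y * E).
      * nra.
      * apply Rmult_le_compat_r; [lra|]. apply Rmult_le_compat_r; lra.
    + unfold Y, E. rewrite <- !exp_plus. f_equal. field.
  - intros eta heta.
    destruct (exp_dominates 2 (eta / 2)) as [X1 [hX1 hdom]]; [lra|lra|].
    generalize (ev_and _ _ hcond (ev_and _ _ (ev_large m X1 hm hX1) (hlow (eta / 2) ltac:(lra)))).
    apply ev_impl. intros i [hc [h1 h2]].
    destruct (hP i) as [_ [_ hg]]. destruct (hg hc) as [J [k [H [_ [_ [_ [_ [_ [g6 _]]]]]]]]].
    unfold p. replace (INR (m i) * 0 + 0)%C with (RtoC 0) by ring.
    apply Rle_trans with (2 := g6). specialize (hdom _ h1). specialize (hmr i).
    apply Rle_trans with (/ (2 * (INR (m i) + 1)) * exp (- (INR (m i) * (eta / 2)))).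
    + replace (- (INR (m i) * eta)) with (- (eta / 2 * INR (m i)) + - (INR (m i) * (eta / 2))) by field.
      rewrite exp_plus. apply Rmult_le_compat_r; [apply Rlt_le, exp_pos|].
      rewrite exp_Ropp. apply Rinv_le_contravar; lra.
    + apply Rmult_le_compat_l; trivial. apply Rlt_le, Rinv_0_lt_compat; lra.
  - intros al be eta hal halbe hbe heta.
    assert (l1 := is_lim_seq_ev _ _ (hn al ltac:(lra)) (eta / 3) ltac:(lra)).
    assert (l2 := is_lim_seq_ev _ _ (hn be ltac:(lra)) (eta / 3) ltac:(lra)).
    assert (hX : 0 <= 6 / eta) by (apply Rdiv_le_0_compat; lra).
    generalize (ev_and _ _ hcond (ev_and _ _ (ev_large m (6 / eta) hm hX) (ev_and _ _ l1 l2))).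
    apply ev_impl. clear l1 l2. intros i [hc [h1 [l1 l2]]].
    destruct (hP i) as [_ [_ hg]]. destruct (hg hc) as [J [k [H [_ [_ [g3 [_ [_ [_ g7]]]]]]]]].
    assert (hmi := hmr i).
    (* [p0] is the first integer strictly above [al * m], as [flips_le] requires. Rounding at both
       ends loses at most 2 cells, paid by one third of [eta]; the errors of the limits at [al] and
       [be] take the other two thirds. *)
    destruct (nfloor_ex (al * INR (m i))) as [q0 [q1 q2]]; [apply Rmult_le_pos; lra|].
    destruct (nfloor_ex (be * INR (m i))) as [q3 [q4 q5]]; [apply Rmult_le_pos; lra|].
    set (p0 := S q0). set (nn := (q3 - p0)%nat).
    assert (hp0 : INR p0 = INR q0 + 1) by (unfold p0; now rewrite S_INR).
    assert (hTb : be * INR (m i) <= T * INR (m i)) by (apply Rmult_le_compat_r; lra).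
    assert (hnn : be * INR (m i) - al * INR (m i) - 2 <= INR nn).
    { destruct (Nat.le_gt_cases p0 q3) as [h|h].
      - unfold nn. rewrite minus_INR by trivial. lra.
      - apply lt_INR in h. assert (h0 := pos_INR nn). lra. }
    assert (hm6 : 2 <= INR (m i) * (eta / 3)).
    { replace 2 with (6 / eta * (eta / 3)) by (field; lra). apply Rmult_le_compat_r; lra. }
    apply Rabs_lt_between in l1. apply Rabs_lt_between in l2.
    destruct (Nat.le_gt_cases p0 q3) as [hle|hgt].
    + assert (hsum : INR (p0 + nn) <= be * INR (m i)).
      { unfold nn. replace (p0 + (q3 - p0))%nat with q3 by lia. trivial. }
      destruct (collect_zeros (P i) (flip (rotated_re a (beta i)) s (m i)) p0 nn) as [l [z1 [z2 z3]]].
      { intros x hx hfl. apply g7; trivial. apply INR_lt.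
        apply Rlt_le_trans with (INR (p0 + nn)); [apply lt_INR; lia|lra]. }
      assert (hfl := flips_le s a (m i) (beta i) al be p0 nn (hm0 i) ltac:(lra) ltac:(lra) ltac:(lra) hsum).
      exists (map (fun x => x / INR (m i)) l). split; [|split].
      * apply Injective_map_NoDup; trivial. intros x y hxy.
        apply (f_equal (Rmult (INR (m i)))) in hxy.
        replace (INR (m i) * (x / INR (m i))) with x in hxy by (field; lra).
        replace (INR (m i) * (y / INR (m i))) with y in hxy by (field; lra). trivial.
      * intros x hx. apply in_map_iff in hx. destruct hx as [y [<- hy]]. destruct (z2 y hy) as [z4 z5].
        split; [|split].
        -- unfold p. replace (INR (m i) * RtoC (y / INR (m i)) + 0)%C with (RtoC y); trivial.
           rewrite <- RtoC_mult, Cplus_0_r. f_equal. field. lra.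
        -- apply Rmult_lt_reg_r with (INR (m i)); trivial. replace (y / INR (m i) * INR (m i)) with y by (field; lra). lra.
        -- apply Rmult_lt_reg_r with (INR (m i)); trivial. replace (y / INR (m i) * INR (m i)) with y by (field; lra). lra.
      * rewrite length_map. apply le_INR in z3. rewrite plus_INR in z3.
        assert (hdiff : INR (m i) * (n_side s a (m i) (beta i) be - n_side s a (m i) (beta i) al)
           <= INR (m i) * (n be - n al + 2 * (eta / 3))) by (apply Rmult_le_compat_l; lra).
        lra.
    + exists nil. split; [constructor|]. split; [intros; contradiction|].
      apply lt_INR in hgt. simpl (INR (length nil)).
      assert (hnm : n al <= n be) by (apply hmono; lra).
      assert (0 <= INR (m i) * (n be - n al)) by (apply Rmult_le_pos; lra).
      lra. }
apply (zero_family_absurd p (fun i => INR (m i)) n T b D Z hT hmono hliminf hb hD hDb).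
Qed.

Theorem corollary3 :
  forall (a : nat -> C) (f : C -> C) (m : nat -> nat) (beta : nat -> R)
         (Delta : R) (n : R -> R),
    (forall z : C, unit_disc z ->
       @is_pseries C_AbsRing C_NormedModule a z (f z)) ->
    is_LimSup_seq (fun j : nat => nth_root j (Cmod (a j))) 1 ->
    (forall k : nat, (0 < m k)%nat) ->
    (forall k : nat, (m k < m (S k))%nat) ->
    is_lim_seq
      (fun k : nat => nth_root (m k) (Rabs (rotated_re a (beta k) (m k)))) 1 ->
    0 <= Delta <= 1 ->
    (Fr_plus a m beta n \/ Fr_minus a m beta n) ->
    Rbar_le (LimInf_right (fun r : R => n r / r) 0) Delta ->
    has_singularity_on f (arc Delta).
Proof.
intros a f m beta Delta n hf _ hm0 hm hlim hD hFr hinf [U [g [_ [hU [han hgf]]]]].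
assert (hpi := PI_RGT_0).
assert (ha : converges_on a 1) by (apply (pseries_converges_on a 1 f); exact hf).
destruct (arc_taylor_small a f g Delta hf hgf (fun z hz => han z (or_intror (hU z hz))) (proj1 hD)) as [d [hd hts]].
assert (hs : exists (s : bool) (phi : nat -> nat), (forall i, (phi i < phi (S i))%nat) /\
   forall x, 0 <= x <= 1 -> is_lim_seq (fun i => n_side s a (m (phi i)) (beta (phi i)) x) (n x)).
{ destruct hFr as [[phi h]|[phi h]]; [exists true, phi|exists false, phi]; exact h. }
destruct hs as [s [phi [hphi hn]]].
assert (hmid := increasing_ge_id m hm). assert (hphid := increasing_ge_id phi hphi).
assert (hmphi : forall i, (i <= m (phi i))%nat).
{ intros i. apply Nat.le_trans with (1 := hphid i), hmid. }
assert (hlow : forall eta, 0 < eta -> ev (fun i => exp (- (INR (m (phi i)) * eta)) <=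
   Rabs (rotated_re a (beta (phi i)) (m (phi i))))).
{ intros eta heta.
  apply (ev_subseq phi (fun k => exp (- (INR (m k) * eta)) <= Rabs (rotated_re a (beta k) (m k))) hphid).
  assert (he : exp (- eta) < 1) by (rewrite <- exp_0; apply exp_increasing; lra).
  generalize (is_lim_seq_ev _ _ hlim (1 - exp (- eta)) ltac:(lra)). apply ev_impl. intros k hk.
  apply nth_root_lower; [apply hm0|apply Rabs_pos|]. apply Rabs_lt_between in hk. lra. }
destruct (Rle_lt_or_eq_dec _ _ (proj2 hD)) as [hlt|heq].
(* With [b = 1 - Delta - e], the arc [PI - PI * b = PI * (Delta + e)] stays within the overshoot
   [d], and [D = Delta + e / 2] lies strictly between [Delta] and [1 - b]. The second bound on [e]
   keeps [b >= 0]. *)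
- set (e := Rmin (d / PI) ((1 - Delta) / 2)).
  assert (he : 0 < e) by (apply Rmin_glb_lt; [apply Rdiv_lt_0_compat|]; lra).
  assert (he1 : e <= (1 - Delta) / 2) by apply Rmin_r.
  assert (he2 : PI * e <= d).
  { replace d with (PI * (d / PI)) by (field; lra). apply Rmult_le_compat_l; [lra|apply Rmin_l]. }
  apply (proper_arc_absurd a d (1 - Delta - e) (Delta + e / 2) (fun i => m (phi i)) (fun i => beta (phi i)) s n); trivial; try lra.
  + intros t ht. apply hts. lra.
  + apply (LimInf_right_lt n Delta); trivial. lra.
- apply (whole_circle_absurd a d (fun i => m (phi i)) (fun i => beta (phi i))); trivial.
  intros t ht. apply hts. rewrite heq. lra.
Qed.
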